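(* Let $q$ be a real-valued function on $(0,\infty)$ with $q\in L^1(0,1)$ and $q(x)=0$ for $x>1$. Let $u(x,t)$ solve $$u_{tt}=u_{xx}-q(x)u,\quad x>0,\ t>0,\qquad u=u_t=0\ \text{ at } t=0,$$ with the boundary condition either $u(0,t)=\delta(t)$ or $u_x(0,t)=\delta(t)$, where $\delta$ is the delta-function. Suppose that $$u(1,t)=a(t)\quad\text{for all } t>0$$ is known. Then the inverse problem of finding $q$ from the data $\{a(t)\}_{t>0}$ has at most one solution; that is, if two such potentials produce (with the same type of boundary condition) the same $a(t)$ for all $t>0$, they coincide.
   Context: The solution $u$ is understood in the sense of distributions, as the causal solution (vanishing for $t<0$) of the problem. *)

(* Defs.v *)
From HB Require Import structures.
From mathcomp Require Import all_boot all_order all_algebra.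
From mathcomp Require Import all_classical all_reals all_analysis.

Set Implicit Arguments.
Unset Strict Implicit.
Unset Printing Implicit Defensive.

Import Order.TTheory GRing.Theory Num.Theory.
Import numFieldNormedType.Exports.

Local Open Scope classical_set_scope.
Local Open Scope ring_scope.

(* C^oo: every iterated directional derivative D_{v_1} ... D_{v_k} f exists
   and is continuous.  Used with V = R and with V = R * R. *)
Definition smooth (R : realType) (V : normedModType R) (f : V -> R) : Prop :=
  forall s : seq V,
    let g : V -> R := foldr (fun v h => 'D_v h) f s in
    continuous g /\ forall x v : V, derivable g x v.

Definition supp (R : realType) (V : normedModType R) (f : V -> R) : set V :=
  closure [set x | f x != 0].

Definition test_function (R : realType) (V : normedModType R) (Omega : set V)
    (f : V -> R) : Prop :=
  [/\ smooth f, compact (supp f) & supp f `<=` Omega].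

(* A distribution on the real line is encoded by a function T defined on all of
   R -> R; only its values on test functions are meaningful. *)
Definition distribution1 (R : realType) (T : (R -> R) -> R) : Prop :=
  (forall (c : R) (f g : R -> R),
      test_function setT f -> test_function setT g ->
      T (fun t => c * f t + g t) = c * T f + T g) /\
  (forall K : set R, compact K ->
     exists (C : R) (N : nat), forall f : R -> R,
       test_function setT f -> supp f `<=` K ->
       `|T f| <= C * \sum_(n < N) sup (range (fun t : R => `|derive1n n f t|))).

Definition eq_distribution_on (R : realType) (Omega : set R)
    (S T : (R -> R) -> R) : Prop :=
  forall f : R -> R, test_function Omega f -> S f = T f.

Definition delta (R : realType) : (R -> R) -> R := fun f => f 0.

Definition potential (R : realType) (q : R -> R) : Prop :=
  (@lebesgue_measure R).-integrable `]0, 1[ (EFin \o q) /\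
  (forall x : R, 1 < x -> q x = 0).

(* Since q is only integrable, the product q u is meaningless for an arbitrary
   distribution u on the quarter plane, and so are the traces of u on x = 0 and
   x = 1.  A solution is therefore a (weakly) continuous function
   x |-> u(x, .) on [0, +oo[ with values in the distributions in t, which acts
   on a test function Phi(x, t) by  integral of <u(x, .), Phi(x, .)> dx.
   Both u(x, t) = delta(t - x) + w(x, t) with w continuous on t >= x and
   vanishing for t < x, and u(x, t) = - H(t - x) + w(x, t), are of this form. *)
Definition distribution_path (R : realType) (u : R -> (R -> R) -> R) : Prop :=
  (forall x : R, 0 <= x -> distribution1 (u x)) /\
  (forall f : R -> R, test_function setT f ->
     {within `[0, +oo[, continuous (fun x => u x f)}).

(* u_tt = u_xx - q u in the sense of distributions on x > 0, t real. *)
Definition wave_equation (R : realType) (q : R -> R) (u : R -> (R -> R) -> R)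
    : Prop :=
  forall Phi : R * R -> R,
    @test_function R (R * R)%type (`]0%R, +oo[ `*` setT) Phi ->
    let Phi_xx := 'D_((1, 0) : R * R) ('D_((1, 0) : R * R) Phi) in
    let Phi_tt := 'D_((0, 1) : R * R) ('D_((0, 1) : R * R) Phi) in
    (\int[lebesgue_measure]_(x in `]0%R, +oo[)
      (u x (fun t => Phi_tt (x, t) - Phi_xx (x, t) + q x * Phi (x, t)))%:E
     = 0)%E.

Definition causal (R : realType) (u : R -> (R -> R) -> R) : Prop :=
  forall x : R, 0 <= x -> eq_distribution_on `]-oo, 0[ (u x) (fun=> 0).

Inductive boundary_type := Dirichlet | Neumann.

(* u(0, .) = delta, resp. u_x(0, .) = delta, as distributions on the whole
   t-axis; u_x(0, .) is the one-sided weak derivative of x |-> u(x, .). *)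
Definition boundary_condition (R : realType) (bc : boundary_type)
    (u : R -> (R -> R) -> R) : Prop :=
  match bc with
  | Dirichlet => eq_distribution_on setT (u 0) (@delta R)
  | Neumann => forall f : R -> R, test_function setT f ->
      (u h f - u 0 f) / h @[h --> 0^'+] --> delta f
  end.

(* The condition u = u_t = 0 at t = 0 is expressed by extending u by 0 to
   t < 0: the extension vanishes there and solves the equation across t = 0. *)
Definition causal_solution (R : realType) (bc : boundary_type) (q : R -> R)
    (u : R -> (R -> R) -> R) : Prop :=
  [/\ distribution_path u, wave_equation q u, causal u
    & boundary_condition bc u].

(* Main.v *)
(* Testing u in the time variable only, z(x, s) = <u(x, .), psi(. + s)> is a classical
   object: it is jointly continuous, and its x-derivative along a characteristic is an
   integral of q z.  Causality kills one of the two Riemann invariants, so z_s solves on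
   [0, 1] a Volterra equation whose only datum is its trace at x = 1, and that trace is
   determined by a.  Hence both potentials produce the same map from traces at x = 1 to
   boundary sources at x = 0.  The operators involved commute with translations, hence
   with one another (span of the e^{nt} being dense), and applying this to sources which
   are locally exponential gives, for every real k <> 0, the same scalar boundary datum
   for the equation f'' = (k^2 + q) f with f ~ e^{kx} beyond x = 1.  Exchanging orders of
   integration yields int (q1 - q2) phi1 phi2 = 0, where phi1 and phi2 are the solutions
   normalised at x = 0, for k = 1, 2, ...

   Since phi_i(x, k) is the value at t = 0 of a transmutation operator applied to e^{kt},
   density turns this into int (q1 - q2)(x) [E1(x) E2(x) eta](0) dx = 0 for all
   continuous eta.  If eta vanishes left of 2s, finite speed of propagation gives
   E1(x) E2(x) eta (0) = eta(2x) / 4 + O(max(0, x - s)), and q1 - q2 = 0 follows by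
   descending from x = 1 in steps of a fixed length. *)

Require Import Defs.
From HB Require Import structures.
From mathcomp Require Import all_boot all_order all_algebra.
From mathcomp Require Import all_classical all_reals all_analysis.
From mathcomp Require Import measurable_realfun ring lra.

Import Order.TTheory GRing.Theory Num.Theory.
Import numFieldNormedType.Exports.

Set Implicit Arguments.
Unset Strict Implicit.
Unset Printing Implicit Defensive.

Local Open Scope classical_set_scope.
Local Open Scope ring_scope.

(** * Smooth functions of one variable *)

Section SmoothCalculus.
Context {R : realType}.
Implicit Types (f g : R -> R).

(** A distribution path has a seminorm estimate for each fixed x, whose order and constant may vary
    with x, and only weak continuity links different x. Joint continuity of z therefore rests on a
    uniform boundedness principle, which in turn asks for smooth functions built as series of
    translates. The weak equation is tested with Phi(x, t) = chi(x) psi(t + e x), e = 1 or -1. Then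
    psi'' cancels in Phi_tt - Phi_xx, and an identity in x alone along a characteristic remains.
    Traces at x = 1 are given by the solution and cannot be prescribed; only sources at x = 0 can.
    Equality of the two boundary operators is first known on traces, and commutation is what
    transfers it to sources. Sources have compact support, so exponentials enter through cutoffs;
    this is harmless because the boundary operators read their argument in a window of radius 4.
    Convergence is measured against powers of 1/4, and the exponential weights are tuned so that
    each iteration gains this factor. *)

Lemma is_derive_dir f (x m d : R) : is_derive x 1 f d -> is_derive x m f (m * d).
Proof.
move=> [df <-]; have dif : differentiable f x by apply/derivable1_diffP.
split; first exact: diff_derivable.
by rewrite deriveE// deriv1E// derive1E.
Qed.

(** The difference quotients of [f \o l] along [v] are literally those of [f] along [m]. The rule
    serves both affine substitutions on the line and plane waves on the plane. *)
Lemma is_derive_lin (V : normedModType R) (l : V -> R) (z v : V) (m : R) f d :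
  (forall h : R, l (h *: v + z) = h * m + l z) ->
  is_derive (l z) 1 f d -> is_derive z v (f \o l) (m * d).
Proof.
move=> lE /(is_derive_dir m)[dm dE].
have E : (fun h : R => h^-1 *: ((f \o l) (h *: v + z) - (f \o l) z)) =
         (fun h : R => h^-1 *: (f (h *: m + l z) - f (l z))).
  by apply/funext => h /=; rewrite lE.
by split; [rewrite /derivable /= /comp E|rewrite -dE /derive /= /comp E].
Qed.

Lemma smooth_coind (V : normedModType R) (S : set (V -> R)) (F : V -> R) :
  (forall G, S G -> continuous G) ->
  (forall G v, S G -> exists2 G', S G' & forall x, is_derive x v G (G' x)) ->
  S F -> smooth F.
Proof.
move=> Sc Sd SF s.
have SG : S (foldr (fun v h => 'D_v h) F s).
  elim: s => //= v s /(Sd _ v)[G' SG' dG].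
  by rewrite (_ : derive _ ^~ v = G')//; apply/funext => x; have [_ <-] := dG x.
split; first exact: Sc.
by move=> x v; have [G' _ /(_ x)[]] := Sd _ v SG.
Qed.

Lemma is_derive_continuous f (x d : R) : is_derive x 1 f d -> {for x, continuous f}.
Proof. by move=> [+ _] => /derivable1_diffP/differentiable_continuous. Qed.

(* A sealed copy of [smooth] for functions of one variable: it keeps conversion
   from unfolding iterated derivatives. *)
Variant smooth1 (f : R -> R) : Prop := Smooth1 of smooth f.

(* Membership in a class of functions stable under differentiation implies
   smoothness, which replaces all explicit formulas for higher derivatives. *)
Lemma smooth_coindR (S : set (R -> R)) f :
  (forall g, S g -> exists2 g', S g' & forall x : R, is_derive x 1 g (g' x)) ->
  S f -> smooth1 f.
Proof.
(* The derivative along [v] is [v] times the derivative along 1, so the class is first closed under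
   scalar multiples. *)
move=> Sd Sf; constructor; pose S' := [set h | exists (c : R) g, S g /\ h = fun x => c * g x].
have drv (g : R -> R) (c g' x : R) : is_derive x 1 g g' -> is_derive x 1 (fun x => c * g x) (c * g').
  by move=> ?; apply: is_deriveZ.
apply: (@smooth_coind _ S').
- move=> _ [c [g [Sg ->]]] x; have [g' _ /(_ x) dg] := Sd _ Sg.
  exact: (is_derive_continuous (drv g c _ x dg)).
- move=> _ v [c [g [Sg ->]]]; have [g' Sg' dg] := Sd _ Sg.
  exists (fun x => v * c * g' x); first by exists (v * c), g'.
  by move=> x; rewrite -mulrA; exact: (is_derive_dir v (drv _ _ _ _ (dg x))).
- by exists 1, f; split => //; apply/funext => x; rewrite mul1r.
Qed.

Lemma smooth_continuous f : smooth1 f -> continuous f.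
Proof. by case=> /(_ [::])[]. Qed.

Lemma smooth_is_derive f (x : R) : smooth1 f -> is_derive x 1 f ((derive1 f) x).
Proof. by case=> /(_ [::])[_ /(_ x 1) df]; rewrite derive1E; apply: derivableP. Qed.

Lemma smooth_derive1 f : smooth1 f -> smooth1 (derive1 f).
Proof.
case=> sf; constructor=> s; have := sf (rcons s 1); rewrite foldr_rcons.
by rewrite (_ : 'D_1 f = (derive1 f))//; apply/funext => x; rewrite derive1E.
Qed.

Lemma smooth_derive1n f n : smooth1 f -> smooth1 ((derive1n n f)).
Proof.
by move=> sf; elim: n => [//|n IH]; rewrite derive1nS; exact: smooth_derive1.
Qed.

Lemma derive1_eq f g : (forall x : R, is_derive x 1 f (g x)) -> (derive1 f) = g.
Proof. by move=> dfg; apply/funext => x; rewrite derive1E; have [_ ->] := dfg x. Qed.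

Lemma smooth_antideriv f g :
  (forall x : R, is_derive x 1 f (g x)) -> smooth1 g -> smooth1 f.
Proof.
move=> dfg sg; apply: (@smooth_coindR [set h | smooth1 h \/ h = f]); last by right.
move=> h [sh|->]; last by exists g => //; left.
by exists (derive1 h); [left; apply: smooth_derive1|move=> x; apply: smooth_is_derive].
Qed.

Lemma smooth_cst (c : R) : smooth1 (fun _ : R => c).
Proof.
apply: (@smooth_coindR [set h | exists c, h = cst c]); last by exists c.
by move=> _ [k ->]; exists (cst 0); [exists 0|move=> x; apply: is_derive_cst].
Qed.

(** Products alone are not stable under differentiation; by Leibniz' rule finite sums of products
    are. *)
Inductive sum_of_products : (R -> R) -> Prop :=
| sop_prod f g : smooth1 f -> smooth1 g -> sum_of_products (fun x => f x * g x)
| sop_add f g : sum_of_products f -> sum_of_products g ->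
    sum_of_products (fun x => f x + g x).

Lemma smooth_sum_of_products f : sum_of_products f -> smooth1 f.
Proof.
apply: smooth_coindR => h; elim=> [f1 f2 s1 s2|f1 f2 _ [f1' S1 d1] _ [f2' S2 d2]].
- exists (fun x => f1 x * (derive1 f2) x + (derive1 f1) x * f2 x).
    by apply: sop_add; apply: sop_prod; [exact: s1|exact: smooth_derive1|
      exact: smooth_derive1|exact: s2].
  move=> x; have d1 := smooth_is_derive x s1; have d2 := smooth_is_derive x s2.
  apply: (@is_derive_eq _ _ _ _ _ _ _ _ (is_deriveM d1 d2)).
  by rewrite /GRing.scale /=; ring.
- exists (fun x => f1' x + f2' x); first exact: sop_add.
  by move=> x; exact: is_deriveD.
Qed.

Lemma smoothM f g : smooth1 f -> smooth1 g -> smooth1 (fun x => f x * g x).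
Proof. by move=> sf sg; apply/smooth_sum_of_products/sop_prod. Qed.

Lemma smoothZ (c : R) f : smooth1 f -> smooth1 (fun x => c * f x).
Proof. by apply: smoothM; apply: smooth_cst. Qed.

Lemma smoothD f g : smooth1 f -> smooth1 g -> smooth1 (fun x => f x + g x).
Proof.
move=> sf sg; rewrite (_ : (fun _ => _) = fun x => f x * cst 1 x + g x * cst 1 x).
  apply: smooth_sum_of_products; apply: sop_add.
    exact: sop_prod sf (smooth_cst 1).
  exact: sop_prod sg (smooth_cst 1).
by apply/funext => x /=; rewrite !mulr1.
Qed.

Lemma smoothN f : smooth1 f -> smooth1 (fun x => - f x).
Proof.
by move=> /(smoothZ (-1)); congr smooth1; apply/funext => x; rewrite mulN1r.
Qed.

Lemma is_derive_affine f (a b x d : R) :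
  is_derive (a * x + b) 1 f d -> is_derive x 1 (fun y => f (a * y + b)) (a * d).
Proof.
move=> df; apply: (@is_derive_lin _ (fun y => a * y + b)) df => h.
by rewrite /GRing.scale /=; ring.
Qed.

Lemma smooth_affine f (a b : R) : smooth1 f -> smooth1 (fun x => f (a * x + b)).
Proof.
move=> sf; apply: (@smooth_coindR
  [set h | exists (c : R) g, smooth1 g /\ h = fun x => c * g (a * x + b)]); last first.
  by exists 1, f; split => //; apply/funext => x; rewrite mul1r.
move=> _ [c [g [sg ->]]]; exists (fun x => (c * a) * (derive1 g) (a * x + b)).
  by exists (c * a), (derive1 g); split; [exact: smooth_derive1|].
move=> x; rewrite -mulrA; apply: is_deriveZ.
exact: (is_derive_affine (smooth_is_derive _ sg)).
Qed.

Lemma smooth_expR : smooth1 (@expR R).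
Proof.
apply: (@smooth_coindR [set expR]) => // _ ->.
by exists expR => // x; apply: is_derive_expR.
Qed.

Lemma is_derive_shiftr f (s x d : R) :
  is_derive (x + s) 1 f d -> is_derive x 1 (fun t => f (t + s)) d.
Proof.
rewrite -[x in _ -> is_derive x _ _ _]mul1r.
move=> df; have := @is_derive_affine f 1 s x d.
rewrite mul1r => /(_ df); rewrite !mul1r.
by rewrite (_ : (fun _ => _) = fun t => f (t + s))//; apply/funext => t; rewrite mul1r.
Qed.

Lemma derive1_shiftr f (s : R) : smooth1 f ->
  derive1 (fun t => f (t + s)) = fun t => (derive1 f) (t + s).
Proof.
by move=> sf; apply: derive1_eq => x; exact: (is_derive_shiftr (smooth_is_derive _ sf)).
Qed.

Lemma smooth_shiftr f (s : R) : smooth1 f -> smooth1 (fun t => f (t + s)).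
Proof.
move=> /(smooth_affine 1 s); congr smooth1.
by apply/funext => t; rewrite mul1r.
Qed.

Lemma derive1n_shiftr f (s : R) n : smooth1 f ->
  derive1n n (fun t => f (t + s)) = fun t => (derive1n n f) (t + s).
Proof.
move=> sf; elim: n => [//|n IH].
by rewrite !derive1nS IH (derive1_shiftr s (smooth_derive1n n sf)).
Qed.

(** The multiplied-out form contains no quotient and admits [h = 0], which suits derivatives of
    limits and Taylor remainders. *)
Lemma is_derive_epsP f (x d : R) : is_derive x 1 f d <->
  forall e, 0 < e -> exists2 r, 0 < r &
    forall h, `|h| < r -> `|f (x + h) - f x - h * d| <= e * `|h|.
Proof.
split=> [[df dE] e e0|H].
- have : (fun h => h^-1 *: (f (h *: 1 + x) - f x)) @ 0^' --> d by rewrite -dE.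
  move=> /cvgrPdist_le /(_ e e0); rewrite /dnbhs near_withinE => -[r /= r0 Hr].
  exists r => // h hr; have [->|h0] := eqVneq h 0.
    by rewrite addr0 subrr mul0r subr0 normr0 mulr0.
  have := Hr h; rewrite /ball_ /= sub0r normrN => /(_ hr h0).
  rewrite /GRing.scale /= mulr1 (addrC h x) => le.
  have -> : f (x + h) - f x - h * d = - h * (d - h^-1 * (f (x + h) - f x)).
    by field.
  by rewrite normrM normrN mulrC ler_wpM2r.
- have cv : (fun h => h^-1 *: (f (h *: 1 + x) - f x)) @ 0^' --> d.
    apply/cvgrPdist_le => e e0; have [r r0 Hr] := H e e0.
    rewrite near_withinE; exists r => //= h; rewrite /ball_ /= sub0r normrN => hr h0.
    rewrite /GRing.scale /= mulr1 (addrC h x).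
    have -> : d - h^-1 * (f (x + h) - f x) = - h^-1 * (f (x + h) - f x - h * d).
      by field.
    rewrite normrM normrN normrV ?unitfE// mulrC ler_pdivrMr ?normr_gt0//.
    exact: Hr.
  split; first by apply/cvg_ex; exists d.
  exact: cvg_lim.
Qed.

End SmoothCalculus.

(** * Mean value bounds, supports and cutoff functions *)

Section TestFunctions.
Context {R : realType}.
Implicit Types (f g : R -> R).

Lemma MVT_upper f f' (a b M : R) : a <= b ->
  (forall x : R, a <= x <= b -> is_derive x 1 f (f' x)) ->
  (forall x : R, a <= x <= b -> f' x <= M) -> f b - f a <= M * (b - a).
Proof.
rewrite le_eqVlt => /predU1P[<- _ _|ab df fM]; first by rewrite !subrr mulr0.
have df' x : x \in `]a, b[ -> is_derive x 1 f (f' x).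
  by rewrite in_itv /= => /andP[/ltW ax /ltW xb]; apply: df; rewrite ax.
have cf : {within `[a, b], continuous f}.
  apply: continuous_in_subspaceT => x; rewrite inE /= in_itv /= => xab.
  exact: (is_derive_continuous (df x xab)).
have [c] := MVT ab df' cf; rewrite in_itv /= => /andP[/ltW ac /ltW cb] ->.
by rewrite ler_wpM2r ?subr_ge0 ?(ltW ab)// fM// ac.
Qed.

Lemma MVT_bound f f' (a b M : R) : a <= b ->
  (forall x : R, a <= x <= b -> is_derive x 1 f (f' x)) ->
  (forall x : R, a <= x <= b -> `|f' x| <= M) -> `|f b - f a| <= M * (b - a).
Proof.
move=> ab df fM; rewrite ler_norml; apply/andP; split.
- rewrite lerNl; have := @MVT_upper (fun x => - f x) (fun x => - f' x) a b M ab.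
  rewrite opprK addrC opprB; apply => x xab; first exact: (is_deriveN (df x xab)).
  by have := fM x xab; rewrite ler_norml => /andP[+ _]; rewrite lerNl.
- apply: MVT_upper ab df _ => x xab.
  by have := fM x xab; rewrite ler_norml => /andP[_].
Qed.

Lemma derive1_eq0 (a b : R) f : (forall x, a < x < b -> f x = 0) ->
  forall x, a < x < b -> derive1 f x = 0.
Proof.
move=> f0 x /andP[ax xb]; rewrite derive1E.
have /near_eq_is_derive : \near x, cst 0 x = f x.
  near=> y; rewrite f0//; apply/andP; split; near: y; [exact: lt_nbhsr|exact: lt_nbhsl].
by move=> /(_ 1 0 (is_derive_cst 0 x 1))[].
Unshelve. all: by end_near. Qed.

(** A pointwise substitute for compact support: it passes to derivatives, translates and products
    without any closure being taken. *)
Definition vanishes_off (a b : R) f := forall x, ~~ (a <= x <= b) -> f x = 0.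

Lemma vanishes_off_derive1 a b f : vanishes_off a b f -> vanishes_off a b (derive1 f).
Proof.
move=> f0 x; rewrite negb_and -!ltNge => /orP[xa|bx].
- apply: (@derive1_eq0 (x - 1) a); last by rewrite xa gtrBl ltr01.
  by move=> y /andP[_ ya]; apply: f0; rewrite negb_and -!ltNge ya.
- apply: (@derive1_eq0 b (x + 1)); last by rewrite bx ltrDl ltr01.
  by move=> y /andP[ya _]; apply: f0; rewrite negb_and -!ltNge ya orbT.
Qed.

Lemma supp_sub f (A : set R) : closed A -> (forall x, f x != 0 -> A x) -> supp f `<=` A.
Proof. by move=> /closure_id {2}-> fA; exact: closureS. Qed.

Lemma supp_vanishes_off a b f : vanishes_off a b f -> supp f `<=` `[a, b].
Proof.
move=> f0; apply: supp_sub; first exact: interval_closed.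
by move=> x fx; rewrite /= in_itv /=; apply: contraNT fx => /f0 ->.
Qed.

Lemma test_function_intro (Omega : set R) a b f : smooth1 f ->
  vanishes_off a b f -> `[a, b] `<=` Omega -> test_function Omega f.
Proof.
move=> [sf] f0 abO; have fab := supp_vanishes_off f0; split => //.
- by apply: (@subclosed_compact _ _ `[a, b]) => //;
    [exact: closed_closure|exact: segment_compact].
- exact: (subset_trans fab).
Qed.

Lemma test_function_setT a b f : smooth1 f -> vanishes_off a b f ->
  test_function setT f.
Proof. by move=> sf f0; apply: test_function_intro sf f0 _. Qed.

Lemma vanishes_offW a b c d f : c <= a -> b <= d ->
  vanishes_off a b f -> vanishes_off c d f.
Proof.
move=> ca bd f0 x xcd; apply: f0; apply: contra xcd => /andP[ax xb].
by rewrite (le_trans ca ax) (le_trans xb bd).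
Qed.

Lemma vanishes_off_shiftr a b f (s : R) : vanishes_off a b f ->
  vanishes_off (a - s) (b - s) (fun t => f (t + s)).
Proof. by move=> f0 x; rewrite lerBlDr lerBrDr => /f0. Qed.

Lemma vanishes_offMl a b f g : vanishes_off a b f ->
  vanishes_off a b (fun x => g x * f x).
Proof. by move=> f0 x /f0 ->; rewrite mulr0. Qed.

(** The polynomial makes the family of e^(-1/x) stable under differentiation: with y = 1/x one has
    d/dx = - y^2 d/dy, so p becomes X^2 (p - p'). *)
Definition flat (p : {poly R}) (x : R) : R :=
  if 0 < x then p.[x^-1] * expR (- x^-1) else 0.

(** From e^y >= y^(i+2) / (i+2)! each monomial satisfies y^i e^(-y) <= (i+2)! / y^2, which is
    quadratic in h = 1/y. A quadratic bound is what the derivative at 0 requires. *)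
Lemma flat_bound (p : {poly R}) :
  exists2 C, 0 <= C & forall h, `|flat p h| <= C * h ^+ 2.
Proof.
exists (\sum_(i < size p) `|p`_i| * (i.+2)`!%:R).
  by apply: sumr_ge0 => i _; rewrite mulr_ge0.
move=> h; rewrite /flat; case: ifPn => [h0|_]; last first.
  rewrite normr0 mulr_ge0 ?sqr_ge0//; apply: sumr_ge0 => i _.
  by rewrite mulr_ge0.
have y0 : 0 < h^-1 by rewrite invr_gt0.
rewrite horner_coef !mulr_suml; apply: (le_trans (ler_norm_sum _ _ _)).
apply: ler_sum => i _; rewrite !normrM -!mulrA ler_wpM2l//.
rewrite (ger0_norm (expR_ge0 _)) ger0_norm ?exprn_ge0 ?(ltW y0)//.
rewrite expRN ler_pdivrMr ?expR_gt0//.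
have := expR_ge1Dxn i.+1 (ltW y0).
set F := (i.+2)`!%:R; have F0 : 0 < F :> R by rewrite ltr0n fact_gt0.
move=> H; have {H} : h^-1 ^+ i.+2 / F <= expR h^-1 by apply: le_trans H; rewrite lerDr.
rewrite ler_pdivrMr// => H.
have -> : h^-1 ^+ i = h ^+ 2 * h^-1 ^+ i.+2.
  have hh : h ^+ 2 * h^-1 ^+ 2 = 1 by rewrite -exprMn mulfV ?gt_eqF// expr1n.
  by rewrite -(addn2 i) exprD mulrCA hh mulr1.
rewrite [leRHS](_ : _ = h ^+ 2 * (expR h^-1 * F)); last by ring.
by rewrite ler_pM2l// exprn_gt0.
Qed.

Lemma is_derive_flat (p : {poly R}) (x : R) :
  is_derive x 1 (flat p) (flat ('X^2 * (p - p^`())) x).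
Proof.
have [x0|x0|->] := ltgtP x 0.
- rewrite {2}/flat ltNge ltW//=.
  apply: (@near_eq_is_derive _ _ _ (cst 0)).
  near=> y; rewrite /flat ltNge ltW//=; near: y; exact: lt_nbhsl.
- rewrite {2}/flat x0.
  apply: (@near_eq_is_derive _ _ _ (fun y : R => p.[y^-1] * expR (- y^-1))).
    near=> y; rewrite /flat ifT//; near: y; exact: lt_nbhsr.
  have dV : is_derive x 1 (fun y : R => y^-1) (- x ^- 2).
    have := @is_deriveV _ id x 1 1; rewrite /GRing.scale /= mulr1; apply.
    by rewrite gt_eqF.
  have d1 : is_derive x 1 (fun y => p.[y^-1]) (p^`().[x^-1] * (- x ^- 2)).
    exact: (is_derive1_comp (is_derive_poly p x^-1) dV).
  have d2 : is_derive x 1 (fun y => expR (- y^-1)) (expR (- x^-1) * (- (- x ^- 2))).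
    have dN : is_derive x 1 (fun y : R => - y^-1) (- - x ^- 2) by exact: is_deriveN.
    exact: (@is_derive1_comp _ expR (fun y : R => - y^-1) x _ _ (is_derive_expR (- x^-1)) dN).
  apply: (@is_derive_eq _ _ _ _ _ _ _ _ (is_deriveM d1 d2)).
  rewrite /GRing.scale /= hornerM hornerXn hornerD hornerN; field.
  by rewrite gt_eqF.
- rewrite {2}/flat ltxx; apply/is_derive_epsP => e e0.
  have [C C0 HC] := flat_bound p.
  exists (e / (C + 1)); first by rewrite divr_gt0// ltr_pwDr.
  move=> h hr; rewrite add0r {2}/flat ltxx subr0 mulr0 subr0.
  apply: (le_trans (HC h)); rewrite -real_normK ?num_real// expr2 mulrA ler_wpM2r//.
  move: hr; rewrite ltr_pdivlMr ?ltr_pwDr// => hr.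
  by rewrite mulrC; apply/ltW/(le_lt_trans _ hr); rewrite ler_wpM2l// lerDl.
Unshelve. all: by end_near. Qed.

Lemma smooth_flat p : smooth1 (flat p).
Proof.
apply: (@smooth_coindR _ [set f | exists p, f = flat p]); last by exists p.
move=> _ [q ->]; exists (flat ('X^2 * (q - q^`()))); first by eexists.
by move=> x; exact: is_derive_flat.
Qed.

Lemma antideriv0 f : smooth1 f -> (forall x, x <= 0 -> f x = 0) ->
  exists F : R -> R, [/\ smooth1 F, forall x : R, is_derive x 1 F (f x) &
    forall x, x <= 0 -> F x = 0].
Proof.
move=> sf f0; have cf := smooth_continuous sf.
(* A base point left of 0 lets the fundamental theorem cover all [x > -1]; for the other [x] the
   function is locally 0. *)
pose F x := \int[@lebesgue_measure R]_(t in `[-1, x]) f t.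
have F0 x : x <= 0 -> F x = 0.
  move=> x0; rewrite /F (_ : \int[_]_(t in _) _ = \int[@lebesgue_measure R]_(t in `[-1, x]) cst 0 t).
    by rewrite Rintegral_cst//= mul0r.
  apply: eq_Rintegral => t; rewrite inE /= in_itv /= => /andP[_ tx].
  by rewrite f0//; exact: le_trans x0.
have dF (x : R) : is_derive x 1 F (f x).
  have [x1|x1] := ltP (-1) x.
    have /(_ _ _)[] := @continuous_FTC1_closed R f (-1) x (x + 1).
    - by rewrite ltrDl.
    - apply: continuous_compact_integrable; first exact: segment_compact.
      by apply: continuous_subspaceT => ?; apply: cf.
    - exact: x1.
    - exact: cf.
    - by move=> /derivableP dF; rewrite derive1E => <-.
  have x0 : x < 0 by apply: (le_lt_trans x1); rewrite ltrN10.
  rewrite f0 ?ltW//; apply: (@near_eq_is_derive _ _ _ (cst 0)).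
  near=> y; rewrite F0// ltW//; near: y; exact: lt_nbhsl.
by exists F; split; [exact: smooth_antideriv dF sf|exact: dF|exact: F0].
Unshelve. all: by end_near. Qed.

(* [r] is a mollifier supported in [0, 1], [K] a smooth Heaviside function and
   [L] a smooth version of the positive part. *)
Lemma smooth_ramp : exists r K L : R -> R,
  [/\ smooth1 r, (forall x : R, is_derive x 1 K (r x)),
      (forall x : R, is_derive x 1 L (K x)) &
      [/\ forall x, 0 <= r x, vanishes_off 0 1 r, forall x, x <= 0 -> K x = 0,
      forall x, 1 <= x -> K x = 1 & forall x, x <= 0 -> L x = 0]].
Proof.
pose b x := flat 1 x * flat 1 (- 1 * x + 1).
have flatE x : flat 1 x = if 0 < x then expR (- x^-1) else 0.
  by rewrite /flat hornerC mul1r.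
have sb : smooth1 b by apply: smoothM; [|apply: smooth_affine]; exact: smooth_flat.
have b_ge0 x : 0 <= b x.
  by rewrite /b mulr_ge0// flatE; case: ifP => // _; rewrite expR_ge0.
have b_le0 x : x <= 0 -> b x = 0 by move=> x0; rewrite /b flatE ltNge x0 mul0r.
have b_ge1 x : 1 <= x -> b x = 0.
  by move=> x1; rewrite /b [flat _ (_ + _)]flatE mulN1r addrC subr_gt0 ltNge x1 mulr0.
have b_half : 0 < b (1/2).
  rewrite /b mulr_gt0// flatE ifT ?expR_gt0//; lra.
have [K [sK dK K0]] := antideriv0 sb b_le0.
have Kmono x y : x <= y -> K x <= K y.
  move=> xy; rewrite -subr_ge0 -lerN2 oppr0 opprB.
  have := @MVT_upper (fun x => - K x) (fun x => - b x) x y 0 xy.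
  rewrite mul0r opprK addrC; apply=> z _; by rewrite oppr_le0.
have Kge1 x : 1 <= x -> K x = K 1.
  move=> x1; have := @MVT_bound K b 1 x 0 x1.
  rewrite mul0r normr_le0 subr_eq0 => H; apply/eqP/H => // z /andP[z1 _].
  by rewrite b_ge1 ?normr0.
(* If [K 1] were 0, monotonicity would make [K] constant on ]0, 1[, and its derivative [b] would
   vanish at 1/2. *)
have K1 : 0 < K 1.
  rewrite lt_neqAle -{2}(K0 0 (lexx 0)) (Kmono 0 1)//= andbT; apply/eqP => K10.
  have Kz x : 0 < x < 1 -> K x = 0.
    move=> /andP[x0 x1]; apply/le_anti; rewrite {1}K10 -[X in _ && (X <= _)](K0 0 (lexx 0)).
    by rewrite !Kmono// ltW.
  have := derive1_eq0 Kz (x := 1/2); rewrite (derive1_eq dK) => bz.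
  by move: b_half; rewrite bz ?ltxx//; lra.
have srK (c : R) : smooth1 (fun x => c * b x) by apply: smoothZ.
have dK' (x : R) : is_derive x 1 (fun x => (K 1)^-1 * K x) ((K 1)^-1 * b x).
  exact: (is_deriveZ (K 1)^-1 (dK x)).
have [L [sL dL L0]] := @antideriv0 (fun x => (K 1)^-1 * K x) (smoothZ _ sK) (fun x x0 => etrans (congr1 _ (K0 x x0)) (mulr0 _)).
exists (fun x => (K 1)^-1 * b x), (fun x => (K 1)^-1 * K x), L; split; [exact: srK|exact: dK'|exact: dL|split].
- by move=> x; rewrite mulr_ge0// invr_ge0 ltW.
- by move=> x; rewrite negb_and -!ltNge => /orP[/ltW/b_le0|/ltW/b_ge1] ->; rewrite mulr0.
- by move=> x /K0 ->; rewrite mulr0.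
- by move=> x /Kge1 ->; rewrite mulVf// gt_eqF.
- exact: L0.
Qed.

End TestFunctions.

(** * Uniform boundedness by a gliding hump *)

Section UniformBoundedness.
Context {R : realType}.

(** The common rate of the series below; with ratio 1/4 the powers beyond [quarter k] add up to a
    third of it. *)
Definition quarter (k : nat) : R := 4^-1 ^+ k.

Lemma quarter_gt0 k : 0 < quarter k. Proof. by rewrite exprn_gt0// invr_gt0. Qed.

Lemma quarterS k : quarter k = 4 * quarter k.+1.
Proof. by rewrite /quarter exprS mulrA mulfV ?mul1r. Qed.

(** An estimate with a geometric error suffices for the exact one; this is how limits of iterations
    are taken. *)
Lemma le_quarter (x y C : R) : (forall n, x <= y + C * quarter n) -> x <= y.
Proof.
move=> H; rewrite leNgt; apply/negP => yx.
have C0 : 0 < C.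
  have := H 0%N; rewrite /quarter expr0 mulr1 => xyC; rewrite -(ltrD2l y) addr0.
  exact: lt_le_trans yx xyC.
set z := C / (x - y); have z0 : 0 < z by rewrite divr_gt0// subr_gt0.
have [n zn] : exists n, z < 2 ^+ n.
  by exists (Num.bound z); apply: upper_nthrootP (leqnn _).
have : z < 4 ^+ n by apply: (lt_le_trans zn); apply: lerXn2r; rewrite ?nnegrE//; lra.
rewrite ltr_pdivrMr ?subr_gt0// => Cn; have := H n.
rewrite leNgt => /negP; apply; rewrite -ltrBrDl /quarter exprVn.
by rewrite ltr_pdivrMr ?exprn_gt0// mulrC.
Qed.

Lemma quarter_sum_tail (a : nat -> R) (M : R) m n : (m <= n)%N ->
  (forall k, `|a k| <= M * quarter k) ->
  `|\sum_(k < n) a k - \sum_(k < m) a k| <= M * (4 / 3) * (quarter m - quarter n).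
Proof.
move=> /subnKC <- aM; elim: (n - m)%N => [|p IH]; first by rewrite addn0 !subrr normr0 mulr0.
rewrite addnS big_ord_recr /= addrAC.
apply: (le_trans (ler_normD _ _)); apply: (le_trans (lerD IH (aM _))).
by rewrite (quarterS (m + p)); lra.
Qed.

(** The partial sums with their error bars form intervals that meet pairwise; the supremum of the
    lower ends lies in all of them. *)
Lemma quarter_sum_limit (a : nat -> R) (M : R) :
  (forall k, `|a k| <= M * quarter k) ->
  exists l, forall m, `|l - \sum_(k < m) a k| <= M * (4 / 3) * quarter m.
Proof.
move=> aM; have M0 : 0 <= M.
  by have := aM 0%N; rewrite /quarter expr0 mulr1; apply: le_trans.
have M43 : 0 <= M * (4 / 3) by rewrite mulr_ge0.
pose lo m := \sum_(k < m) a k - M * (4 / 3) * quarter m.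
pose hi m := \sum_(k < m) a k + M * (4 / 3) * quarter m.
have lohi m n : lo m <= hi n.
  have aux p r : (p <= r)%N -> lo p <= hi r /\ lo r <= hi p.
    move=> pr; have := quarter_sum_tail pr aM; rewrite /lo /hi.
    set A := \sum_(k < r) _; set B := \sum_(k < p) _.
    have qp : 0 <= M * (4 / 3) * quarter p by rewrite mulr_ge0// ltW// quarter_gt0.
    have qr : 0 <= M * (4 / 3) * quarter r by rewrite mulr_ge0// ltW// quarter_gt0.
    rewrite mulrBr ler_norml => /andP[]; set X := _ * quarter p in qp *.
    by set Y := _ * quarter r in qr * => *; split; lra.
  by case: (leqP m n) => [/aux[]|/ltnW/aux[]].
exists (sup (range lo)) => m; rewrite ler_distl.
have ub : ubound (range lo) (hi m) by move=> _ [p _ <-]; exact: lohi.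
have := @ub_le_sup _ (range lo) (ex_intro _ _ ub) (lo m) (ex_intro2 _ _ m I erefl).
have := @ge_sup _ (range lo) (hi m) (ex_intro _ _ (ex_intro2 _ _ 0%N I erefl)) ub.
by rewrite /lo /hi => -> ->.
Qed.

(* Sokal's gliding hump: the signs are chosen so that the partial sums never
   cancel, and the tail after the k-th term is a third of that term at most. *)
Lemma uniform_boundedness (X I : Type) (tau : X -> I -> R) :
  (forall x, exists M, forall s, `|tau x s| <= M) ->
  (forall (c : nat -> R) (s : nat -> I), (forall k, `|c k| <= quarter k) ->
     exists B, forall x, exists L C, `|L| <= B /\
       forall m, `|L - \sum_(k < m) c k * tau x (s k)| <= C * quarter m) ->
  exists M, forall x s, `|tau x s| <= M.
Proof.
move=> pw sm; apply: contrapT => /forallNP unb.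
(* The growth 8^k beats the coefficients, as [quarter k * 8 ^+ k] is 2^k. The third component is the
   supremum over all indices, of which the chosen index attains at least half. *)
have hump k : exists z : X * I * R, [/\ forall s, `|tau z.1.1 s| <= z.2,
    z.2 <= 2 * `|tau z.1.1 z.1.2| & 8 ^+ k <= z.2].
  have /existsNP[x /existsNP[s /negP]] := unb (8 ^+ k); rewrite -ltNge => xs.
  have [M0 M0P] := pw x; pose A := range (fun s => `|tau x s|).
  have subA : has_sup A.
    by split; [exists (`|tau x s|), s|exists M0 => _ [t _ <-]].
  have supA t : `|tau x t| <= sup A by apply: ub_le_sup subA.2 _ _; exists t.
  have sA0 : 0 < sup A.
    by apply: lt_le_trans (supA s); apply: lt_trans xs; rewrite exprn_gt0.
  have [_ [t _ <-] At] := sup_adherent (divr_gt0 sA0 (ltr0Sn R 1)) subA.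
  exists (x, t, sup A); split => //=; first by move: At; lra.
  by apply: le_trans (supA s); exact: ltW.
have [z zP] := choice hump.
pose x k := (z k).1.1; pose s k := (z k).1.2; pose M k := (z k).2.
pose part (cs : seq R) k := \sum_(j < k) cs`_j * tau (x k) (s j).
(* P + q t and P - q t differ by 2 q t, so one of them has modulus at least q |t|. The sign depends
   on all earlier choices, hence the recursion on lists. *)
pose nxt (cs : seq R) k := let P := part cs k in
  if `|P + quarter k * tau (x k) (s k)| < quarter k * `|tau (x k) (s k)|
  then - quarter k else quarter k.
pose cs := fix cs k := if k is k'.+1 then rcons (cs k') (nxt (cs k') k') else [::].
have szcs k : size (cs k) = k by elim: k => //= k IH; rewrite size_rcons IH.
pose c k := (cs k.+1)`_k.
have csE k j : (j < k)%N -> (cs k)`_j = c j.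
  elim: k => // k IH; rewrite ltnS leq_eqVlt => /predU1P[->//|jk].
  by rewrite /= nth_rcons szcs jk IH.
have cE k : c k = nxt (cs k) k by rewrite /c /= nth_rcons szcs ltnn eqxx.
have cq k : `|c k| <= quarter k.
  by rewrite cE /nxt; case: ifP => _; rewrite ?normrN ger0_norm// ltW// quarter_gt0.
have big k : quarter k * `|tau (x k) (s k)| <= `|\sum_(j < k.+1) c j * tau (x k) (s j)|.
  rewrite big_ord_recr /= cE.
  have -> : \sum_(i < k) c i * tau (x k) (s i) = part (cs k) k.
    by apply: eq_bigr => i _; rewrite csE.
  rewrite /nxt; set P := part _ _; set t := tau _ _.
  case: ltP => // H; rewrite mulNr.
  have : `|quarter k * t + quarter k * t| <= `|P + quarter k * t| + `|P - quarter k * t|.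
    by rewrite -[`|P - _|]normrN; apply: le_trans (ler_normD _ _); rewrite le_eqVlt;
      apply/orP; left; apply/eqP; congr `|_|; ring.
  rewrite -mulr2n normrMn normrM (ger0_norm (ltW (quarter_gt0 k))).
  by move: H; set a := quarter k * _; rewrite mulr2n; lra.
have [B BP] := sm c s cq.
(* The 6 is 1 / (1/2 - 1/3): the partial sum is at least half of [quarter k * M k], the tail at most
   a third of it. *)
have [k Bk] : exists k, 6 * `|B| < 2 ^+ k.
  by exists (Num.bound (6 * `|B|)); apply: upper_nthrootP (leqnn _).
have [L [C [LB LC]]] := BP (x k); have [zM zT z8] := zP k.
rewrite -/(x k) -/(s k) -/(M k) in zM zT z8.
have M0 : 0 <= M k by apply: le_trans z8; rewrite exprn_ge0.
have tail : `|L - \sum_(j < k.+1) c j * tau (x k) (s j)| <= M k * (4 / 3) * quarter k.+1.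
  apply: (@le_quarter _ _ C) => n.
  pose a j := c j * tau (x k) (s j).
  have aM j : `|a j| <= M k * quarter j.
    by rewrite normrM mulrC ler_pM.
  have LC' p : `|L - \sum_(j < k.+1 + p) a j| <= C * quarter (k.+1 + p) by exact: LC.
  have C0 : 0 <= C.
    have := LC 0%N; rewrite /quarter expr0 mulr1; exact: le_trans.
  have qmono p : quarter (p + n) <= quarter n.
    by rewrite /quarter exprD ler_piMl ?exprn_ge0 ?invr_ge0// exprn_ile1 ?invr_ge0// invf_le1; lra.
  have := quarter_sum_tail (leq_addr n k.+1) aM.
  rewrite -/(a _) => T; have := LC' n.
  have -> : L - \sum_(j < k.+1) c j * tau (x k) (s j) =
     (L - \sum_(j < k.+1 + n) a j) + (\sum_(j < k.+1 + n) a j - \sum_(j < k.+1) a j).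
    by rewrite addrA subrK.
  move=> H; apply: (le_trans (ler_normD _ _)); rewrite addrC; apply: lerD.
    apply: (le_trans T); rewrite ler_wpM2l// ?mulr_ge0//.
    by rewrite gerBl ltW// quarter_gt0.
  by apply: (le_trans H); rewrite ler_wpM2l.
have := big k; have qk := quarter_gt0 k.
set S := \sum_(j < k.+1) _ in tail * => bk.
have : `|S| <= `|L| + `|L - S|.
  by rewrite -[`|L - S|]normrN; apply: le_trans (ler_normD _ _); rewrite opprB addrC subrK.
have q8 : 2 ^+ k <= quarter k * M k.
  apply: le_trans (ler_wpM2l (ltW qk) z8); rewrite /quarter -exprMn.
  by rewrite (_ : 4^-1 * 8 = 2)//; field.
have zT' : quarter k * M k <= 2 * (quarter k * `|tau (x k) (s k)|).
  by rewrite mulrCA ler_wpM2l// ltW.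
have : M k * (4 / 3) * quarter k.+1 = (quarter k * M k) / 3.
  by rewrite (quarterS k); field.
have := ler_norm B.
lra.
Qed.

End UniformBoundedness.

(** * Distributions and continuous distribution paths *)

Section Distributions.
Context {R : realType}.
Implicit Types (f g psi : R -> R) (T : (R -> R) -> R).

Definition translate psi (s : R) : R -> R := fun t => psi (t + s).

Lemma smooth_translate psi s : smooth1 psi -> smooth1 (translate psi s).
Proof. exact: smooth_shiftr. Qed.

Lemma derive1n_translate psi s n : smooth1 psi ->
  derive1n n (translate psi s) = translate (derive1n n psi) s.
Proof. exact: derive1n_shiftr. Qed.

Lemma taylor2 f f' f'' (B : R) : (forall x : R, is_derive x 1 f (f' x)) ->
  (forall x : R, is_derive x 1 f' (f'' x)) -> (forall x, `|f'' x| <= B) ->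
  forall x h, `|f (x + h) - f x - h * f' x| <= B * h ^+ 2.
Proof.
move=> df df' bf x h.
have lip g g' M : (forall y : R, is_derive y 1 g (g' y)) ->
    (forall y, `|y - x| <= `|h| -> `|g' y| <= M) -> forall k, `|k| <= `|h| ->
    `|g (x + k) - g x| <= M * `|k|.
  move=> dg gM k kh; have [k0|/ltW k0] := leP 0 k.
    have -> : M * `|k| = M * (x + k - x) by rewrite addrAC subrr add0r ger0_norm.
    apply: (@MVT_bound R g g') => [|y /andP[xy yk]]; first by rewrite lerDl.
    apply: gM; rewrite ger0_norm ?subr_ge0// lerBlDl; apply: le_trans yk _.
    by rewrite lerD2l (le_trans _ kh)// ler_norm.
  rewrite distrC (_ : M * `|k| = M * (x - (x + k))); last first.
    by rewrite ler0_norm// opprD addrA subrr add0r.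
  apply: (@MVT_bound R g g') => [|y /andP[yk xy]]; first by rewrite gerDl.
  apply: gM; rewrite ler0_norm ?subr_le0// opprB lerBlDr -lerBlDl.
  by rewrite (le_trans _ yk)// lerD2l lerNl (le_trans _ kh)// -normrN ler_norm.
have b1 y : `|y - x| <= `|h| -> `|f' y - f' x| <= B * `|h|.
  move=> yh; have := lip f' f'' B df' (fun z _ => bf z) (y - x) yh.
  rewrite addrCA subrr addr0 => /le_trans; apply; rewrite ler_wpM2l//.
  exact: le_trans (bf x).
pose g y := f y - y * f' x.
have dg (y : R) : is_derive y 1 g (f' y - f' x).
  have d1 : is_derive y 1 (fun y : R => y * f' x) (f' x).
    have := @is_deriveM _ _ id (cst (f' x)) y 1 1 0 (is_derive_id _ _) (is_derive_cst _ _ _).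
    by rewrite /GRing.scale /= mulr0 add0r mulr1.
  exact: is_deriveB.
have := lip g _ (B * `|h|) dg b1 h (lexx _).
rewrite /g -mulrA -expr2 real_normK ?num_real//; congr (`|_| <= _); ring.
Qed.

Lemma derive1n_lincomb f g c n : smooth1 f -> smooth1 g ->
  derive1n n (fun t => c * f t + g t) = fun t => c * derive1n n f t + derive1n n g t.
Proof.
move=> sf sg; elim: n => // n IH; rewrite !derive1nS IH; apply: derive1_eq => x.
have df := smooth_is_derive x (smooth_derive1n n sf).
have dg := smooth_is_derive x (smooth_derive1n n sg).
have dcf : is_derive x 1 (fun t => c * derive1n n f t) (c * derive1 (derive1n n f) x).
  exact: is_deriveZ.
exact: is_deriveD.
Qed.

Lemma smooth_lincomb f g c : smooth1 f -> smooth1 g -> smooth1 (fun t => c * f t + g t).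
Proof. by move=> sf sg; apply: smoothD => //; exact: smoothZ. Qed.

Lemma continuous_bounded_on f (a b : R) : {within `[a, b], continuous f} ->
  exists2 B, 0 <= B & forall x, a <= x <= b -> `|f x| <= B.
Proof.
move=> cf; have [ab|ba] := leP a b; last first.
  by exists 0 => // x /andP[ax xb]; have := le_trans ax xb; rewrite leNgt ba.
have cn : {within `[a, b], continuous (fun x => `|f x|)}.
  by move=> x; apply: cvg_norm; exact: cf.
have [c _ cB] := EVT_max ab cn.
by exists `|f c| => // x xab; apply: cB; rewrite in_itv.
Qed.

Lemma test_derive_bounds psi a b : smooth1 psi -> vanishes_off a b psi ->
  forall N, exists2 B, 0 <= B & forall n, (n < N)%N -> forall t, `|derive1n n psi t| <= B.
Proof.
move=> sp p0; elim=> [|N [B B0 IH]]; first by exists 0.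
have [C C0 HC] := @continuous_bounded_on (derive1n N psi) a b
  (continuous_subspaceT (smooth_continuous (smooth_derive1n N sp))).
have v0 : vanishes_off a b (derive1n N psi).
  by elim: N {IH C HC C0} => // N IH; rewrite derive1nS; exact: vanishes_off_derive1.
exists (B + C); first exact: addr_ge0.
move=> n; rewrite ltnS leq_eqVlt => /predU1P[-> t|nN t]; last first.
  by apply: (le_trans (IH n nN t)); rewrite lerDl.
have [tab|/v0 ->] := boolP (a <= t <= b); last by rewrite normr0 addr_ge0.
by apply: (le_trans (HC t tab)); rewrite lerDr.
Qed.

Lemma distribution1_bound T (a : R) : distribution1 T ->
  exists2 C, 0 <= C & exists N, forall f B, smooth1 f -> vanishes_off (- a) a f ->
    (forall n, (n < N)%N -> forall t, `|derive1n n f t| <= B) -> `|T f| <= C * B.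
Proof.
move=> [_ /(_ [set` `[- a, a]] (@segment_compact _ _ _))[C [N CN]]].
exists (`|C| * N%:R + `|T (cst 0)|); first by rewrite addr_ge0// mulr_ge0.
(* The successor makes order 0 available even when [N = 0], and with it [0 <= B]. *)
exists N.+1 => f B sf f0 fB.
have := CN f (test_function_setT sf f0) (supp_vanishes_off f0).
move=> /le_trans; apply.
have B0 : 0 <= B by apply: le_trans (fB 0%N isT 0).
rewrite mulrDl; apply: (@le_trans _ _ (`|C| * N%:R * B)); last first.
  by rewrite lerDl mulr_ge0.
apply: (@le_trans _ _ (`|C| * \sum_(n < N) B)); last first.
  by rewrite sumr_const card_ord -mulrA mulr_natl.
have sup_le n : (n < N)%N -> sup (range (fun t : R => `|derive1n n f t|)) <= B.
  move=> nN; apply: ge_sup; first by exists `|derive1n n f 0|, 0.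
  by move=> _ [t _ <-]; apply: fB; exact: ltnW.
apply: (@le_trans _ _ (`|C| * \sum_(n < N) sup (range (fun t : R => `|derive1n n f t|)))).
  apply: ler_wpM2r; last exact: ler_norm.
  apply: sumr_ge0 => n _; apply: (@le_trans _ _ `|derive1n n f 0|) => //.
  apply: ub_le_sup; last by exists 0.
  by exists B => _ [t _ <-]; apply: fB; apply: ltnW; exact: ltn_ord.
by rewrite ler_wpM2l//; apply: ler_sum => n _; exact: sup_le.
Qed.

Section Linearity.
Variables (T : (R -> R) -> R) (a b : R).
Hypothesis dT : distribution1 T.

Lemma distribution1_lincomb f g c : smooth1 f -> smooth1 g ->
  vanishes_off a b f -> vanishes_off a b g ->
  T (fun t => c * f t + g t) = c * T f + T g.
Proof.
move=> sf sg f0 g0.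
exact: (dT.1 c f g (test_function_setT sf f0) (test_function_setT sg g0)).
Qed.

Lemma distribution10 : T (fun=> 0) = 0.
Proof.
have s0 := @smooth_cst R 0; have v0 : vanishes_off a b (fun _ : R => 0 : R) by [].
have E : (fun t : R => 1 * 0 + 0) = fun=> 0 :> R by apply/funext => t; rewrite mulr0 addr0.
have := distribution1_lincomb 1 s0 s0 v0 v0; rewrite E mul1r.
by move=> /(congr1 (fun x => x - T (fun=> 0))); rewrite addrK subrr => <-.
Qed.

Lemma distribution1Z f c : smooth1 f -> vanishes_off a b f ->
  T (fun t => c * f t) = c * T f.
Proof.
move=> sf f0; have := @distribution1_lincomb f (fun=> 0) c sf (@smooth_cst R 0) f0.
rewrite distribution10 addr0 => <-//; congr T; apply/funext => t; by rewrite addr0.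
Qed.

Lemma distribution1B f g : smooth1 f -> smooth1 g ->
  vanishes_off a b f -> vanishes_off a b g ->
  T (fun t => f t - g t) = T f - T g.
Proof.
move=> sf sg f0 g0; rewrite (_ : (fun _ => _) = fun t => - 1 * g t + f t).
  by rewrite distribution1_lincomb// mulN1r addrC.
by apply/funext => t; rewrite mulN1r addrC.
Qed.

Lemma distribution1_sum m (c : nat -> R) (F : nat -> R -> R) :
  (forall k, smooth1 (F k)) -> (forall k, vanishes_off a b (F k)) ->
  [/\ T (fun t => \sum_(k < m) c k * F k t) = \sum_(k < m) c k * T (F k),
      smooth1 (fun t => \sum_(k < m) c k * F k t),
      vanishes_off a b (fun t => \sum_(k < m) c k * F k t) &
      forall n, derive1n n (fun t => \sum_(k < m) c k * F k t) =
                fun t => \sum_(k < m) c k * derive1n n (F k) t].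
Proof.
move=> sF vF; elim: m => [|m [IT Is Iv Id]].
  have E0 (G : nat -> R -> R) : (fun t => \sum_(k < 0) c k * G k t) = fun=> 0.
    by apply/funext => t; rewrite big_ord0.
  rewrite !E0 big_ord0; split; [exact: distribution10|exact: smooth_cst|by []|].
  move=> n; rewrite (E0 (fun k => derive1n n (F k))); elim: n => // n IH; rewrite derive1nS IH.
  by apply: derive1_eq => x; exact: is_derive_cst.
have E (G : nat -> R -> R) : (fun t => \sum_(k < m.+1) c k * G k t) =
    fun t => c m * G m t + \sum_(k < m) c k * G k t.
  by apply/funext => t; rewrite big_ord_recr addrC.
rewrite !E big_ord_recr /= distribution1_lincomb// IT addrC; split => //.
- exact: smooth_lincomb.
- by move=> x xab; rewrite vF// Iv// mulr0 addr0.
- by move=> n; rewrite (E (fun k => derive1n n (F k))) derive1n_lincomb// Id.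
Qed.

End Linearity.

Lemma vanishes_off_translate a b psi (s S : R) : vanishes_off a b psi -> `|s| <= S ->
  vanishes_off (- (`|a| + `|b| + S)) (`|a| + `|b| + S) (translate psi s).
Proof.
move=> p0; rewrite ler_norml => /andP[sS Ss].
have v := @vanishes_off_shiftr _ _ _ _ s p0; apply: (@vanishes_offW _ _ _ _ _ (translate psi s) _ _ v).
- have := ler_norm (- a); have := normr_ge0 b; rewrite normrN; lra.
- have := ler_norm b; have := normr_ge0 a; lra.
Qed.

(** The Taylor remainder of the translates is O(h^2) in every derivative. Bounding h by 1 keeps all
    translates in one compact set, so a single seminorm estimate of [T] applies. *)
Lemma is_derive_translate T psi a b (s : R) : distribution1 T -> smooth1 psi ->
  vanishes_off a b psi ->
  is_derive s 1 (fun s => T (translate psi s)) (T (translate (derive1 psi) s)).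
Proof.
move=> dT sp p0; apply/is_derive_epsP => e e0.
set A := `|a| + `|b| + (`|s| + 1).
have [C C0 [N HC]] := distribution1_bound A dT.
(* The second-order remainder of the n-th derivative costs two further derivatives. *)
have [B B0 HB] := test_derive_bounds sp p0 N.+2.
have CB : 0 <= C * B by exact: mulr_ge0.
exists (Num.min 1 (e / (C * B + 1))).
  by rewrite lt_min ltr01 divr_gt0// ltr_pwDr.
move=> h; rewrite lt_min => /andP[h1 he].
have sh : `|s + h| <= `|s| + 1 by apply: le_trans (ler_normD _ _) _; rewrite lerD2l ltW.
have ss : `|s| <= `|s| + 1 by rewrite lerDl.
have v1 := vanishes_off_translate p0 sh; have v2 := vanishes_off_translate p0 ss.
have v3 := vanishes_off_translate (vanishes_off_derive1 p0) ss.
have s1 := smooth_translate (s + h) sp; have s2 := smooth_translate s sp.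
have s3 := smooth_translate s (smooth_derive1 sp).
have s12 : smooth1 (fun t => - 1 * translate psi s t + translate psi (s + h) t).
  exact: smooth_lincomb.
have v12 : vanishes_off (- A) A (fun t => - 1 * translate psi s t + translate psi (s + h) t).
  by move=> x xA; rewrite v1// v2// mulr0 addr0.
have <- : T (fun t => - h * translate (derive1 psi) s t +
   (- 1 * translate psi s t + translate psi (s + h) t)) =
   T (translate psi (s + h)) - T (translate psi s) - h * T (translate (derive1 psi) s).
  rewrite (distribution1_lincomb dT (a := - A) (b := A))//.
  by rewrite (distribution1_lincomb dT (a := - A) (b := A))//; ring.
apply: (@le_trans _ _ (C * (B * h ^+ 2))); last first.
  rewrite mulrA -real_normK ?num_real// expr2 mulrA ler_wpM2r//.
  move: he; rewrite ltr_pdivlMr ?ltr_pwDr// => he.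
  by rewrite mulrC (le_trans _ (ltW he))// ler_wpM2l// lerDl.
apply: HC.
- exact: smooth_lincomb.
- by move=> x xA; rewrite v3// v12// mulr0 addr0.
- move=> n nN t; rewrite !derive1n_lincomb// !derive1n_translate//; last exact: smooth_derive1.
  rewrite /translate -derive1Sn derive1nS.
  have d1 (x : R) : is_derive x 1 (derive1n n psi) (derive1 (derive1n n psi) x).
    exact/smooth_is_derive/smooth_derive1n.
  have d2 (x : R) : is_derive x 1 (derive1 (derive1n n psi)) (derive1n n.+2 psi x).
    exact/smooth_is_derive/smooth_derive1/smooth_derive1n.
  have := taylor2 d1 d2 (HB n.+2 (nN : (n.+2 < N.+2)%N)) (t + s) h.
  apply: le_trans; rewrite (addrA t) le_eqVlt; apply/orP; left; apply/eqP.
  by congr `|_|; ring.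
Qed.

(** The series of translates converges in the space of test functions, as the gliding hump requires.
    Term by term differentiation follows from Taylor bounds that are uniform in the number of
    terms. *)
Lemma smooth_translate_series psi a b (S : R) (c s : nat -> R) :
  smooth1 psi -> vanishes_off a b psi -> (forall k, `|c k| <= quarter k) ->
  (forall k, `|s k| <= S) ->
  exists F, [/\ smooth1 F, vanishes_off (- (`|a| + `|b| + S)) (`|a| + `|b| + S) F &
    forall n, exists2 B, 0 <= B & forall m t,
    `|derive1n n F t - \sum_(k < m) c k * derive1n n psi (t + s k)| <= B * quarter m].
Proof.
move=> sp p0 cq sS.
have bnd n : exists2 B, 0 <= B & forall t, `|derive1n n psi t| <= B.
  by have [B B0 HB] := test_derive_bounds sp p0 n.+1; exists B => // t; exact: HB.
have cb n B : (forall t, `|derive1n n psi t| <= B) ->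
    forall t k, `|c k * derive1n n psi (t + s k)| <= B * quarter k.
  by move=> HB t k; rewrite normrM mulrC ler_pM.
(* The limit is fixed before the bound [B], so one function serves for every bound on the
   derivatives. *)
have [G GP] : exists G : nat -> R -> R, forall n t B,
    (forall t, `|derive1n n psi t| <= B) -> forall m,
    `|G n t - \sum_(k < m) c k * derive1n n psi (t + s k)| <= B * (4 / 3) * quarter m.
  have H (p : nat * R) : exists l, forall B, (forall t, `|derive1n p.1 psi t| <= B) ->
     forall m, `|l - \sum_(k < m) c k * derive1n p.1 psi (p.2 + s k)| <= B * (4 / 3) * quarter m.
    case: p => n t /=; have [B B0 HB] := bnd n.
    have [l Hl] := quarter_sum_limit (cb n B HB t).
    exists l => B' HB' m; have [l' Hl'] := quarter_sum_limit (cb n B' HB' t).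
    suff -> : l = l' by exact: Hl'.
    apply/eqP; rewrite -subr_eq0 -normr_le0.
    apply: (@le_quarter _ _ _ (B * (4 / 3) + B' * (4 / 3))) => p; rewrite add0r mulrDl.
    apply: le_trans (lerD (Hl p) (Hl' p)); rewrite (distrC l').
    by apply: le_trans (ler_normD _ _); rewrite addrA subrK.
  have [g gP] := choice H; exists (fun n t => g (n, t)) => n t B HB m.
  exact: (gP (n, t)).
have dG n (t : R) : is_derive t 1 (G n) (G n.+1 t).
  have [B0 B00 HB0] := bnd n; have [B1 B10 HB1] := bnd n.+1; have [B2 B20 HB2] := bnd n.+2.
  have main h : `|G n (t + h) - G n t - h * G n.+1 t| <= B2 * (4 / 3) * h ^+ 2.
    apply: (@le_quarter _ _ _ (B0 * (4 / 3) + B0 * (4 / 3) + `|h| * (B1 * (4 / 3)))) => m.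
    have E1 := GP n (t + h) B0 HB0 m; have E2 := GP n t B0 HB0 m.
    have E3 := GP n.+1 t B1 HB1 m.
    set S1 := \sum_(k < m) _ in E1; set S2 := \sum_(k < m) _ in E2.
    set S3 := \sum_(k < m) _ in E3.
    have ES : `|S1 - S2 - h * S3| <= B2 * (4 / 3) * h ^+ 2.
      have -> : S1 - S2 - h * S3 = \sum_(k < m) (c k * (derive1n n psi (t + h + s k) -
          derive1n n psi (t + s k) - h * derive1n n.+1 psi (t + s k))).
        rewrite /S1 /S2 /S3 mulr_sumr -!sumrB; apply: eq_bigr => k _; ring.
      apply: (le_trans (ler_norm_sum _ _ _)).
      apply: (@le_trans _ _ (\sum_(k < m) quarter k * (B2 * h ^+ 2))).
        apply: ler_sum => k _; rewrite normrM ler_pM//.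
        have d1 (x : R) : is_derive x 1 (derive1n n psi) (derive1n n.+1 psi x).
          exact/smooth_is_derive/smooth_derive1n.
        have d2 (x : R) : is_derive x 1 (derive1n n.+1 psi) (derive1n n.+2 psi x).
          exact/smooth_is_derive/(smooth_derive1n n.+1).
        by have := taylor2 d1 d2 HB2 (t + s k) h; rewrite (addrAC t).
      rewrite -mulr_suml (_ : B2 * (4 / 3) * h ^+ 2 = 4 / 3 * (B2 * h ^+ 2)); last by ring.
      rewrite ler_wpM2r//; first by rewrite mulr_ge0// sqr_ge0.
      have := @quarter_sum_tail R quarter 1 0 m (leq0n _).
      rewrite big_ord0 subr0 => H; apply: le_trans (ler_norm _) _; apply: le_trans (H _) _.
        by move=> k; rewrite mul1r ger0_norm// ltW// quarter_gt0.
      by rewrite mul1r ler_piMr// {1}/quarter expr0 gerBl ltW// quarter_gt0.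
    have -> : G n (t + h) - G n t - h * G n.+1 t = (S1 - S2 - h * S3) +
      ((G n (t + h) - S1) - (G n t - S2) - h * (G n.+1 t - S3)) by ring.
    apply: (le_trans (ler_normD _ _)); apply: lerD => //.
    apply: (le_trans (ler_normB _ _)); rewrite mulrDl; apply: lerD; last first.
      by rewrite normrM -mulrA ler_wpM2l.
    apply: (le_trans (ler_normB _ _)); rewrite mulrDl; exact: lerD.
  apply/is_derive_epsP => e e0; set K := B2 * (4 / 3) in main.
  have K0 : 0 <= K by rewrite mulr_ge0.
  exists (e / (K + 1)); first by rewrite divr_gt0// ltr_pwDr.
  move=> h; rewrite ltr_pdivlMr ?ltr_pwDr// => he; apply: (le_trans (main h)).
  rewrite -real_normK ?num_real// expr2 mulrA ler_wpM2r//.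
  by rewrite mulrC (le_trans _ (ltW he))// ler_wpM2l// lerDl.
have sG n : smooth1 (G n).
  apply: (@smooth_coindR _ [set g | exists n, g = G n]); last by exists n.
  by move=> _ [p ->]; exists (G p.+1); [exists p.+1|exact: dG].
have dnG n : derive1n n (G 0%N) = G n.
  by elim: n => // n IH; rewrite derive1nS IH; apply: derive1_eq; exact: dG.
exists (G 0%N); split; first exact: sG.
- move=> t tA; have [B B0 HB] := bnd 0%N; apply/eqP; rewrite -normr_le0.
  apply: (@le_quarter _ _ _ (B * (4 / 3))) => m; rewrite add0r.
  have := GP 0%N t B HB m; rewrite big1 ?subr0// => k _.
  by have /(_ t tA) := vanishes_off_translate p0 (sS k); rewrite /translate /= => ->; rewrite mulr0.
- move=> n; have [B B0 HB] := bnd n; exists (B * (4 / 3)); first by rewrite mulr_ge0.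
  by move=> m t; rewrite dnG; exact: GP.
Qed.

End Distributions.

(** * Joint continuity of the tested solution, and the weak equation on characteristics *)

Section WavePath.
Context {R : realType}.
Implicit Types (f g psi chi : R -> R) (u : R -> (R -> R) -> R).

Lemma continuous_pair_eps (F : R -> R -> R) :
  (forall x0 s0 e, 0 < e -> exists2 d, 0 < d & forall x s,
     `|x - x0| < d -> `|s - s0| < d -> `|F x s - F x0 s0| <= e) ->
  continuous (fun p : R * R => F p.1 p.2).
Proof.
move=> H [x0 s0]; apply/cvgrPdist_le => e e0; have [d d0 Hd] := H x0 s0 e e0.
exists (ball x0 d, ball s0 d) => /=; first by split; exact: nbhsx_ballx.
by move=> [x s] [/= xd sd]; rewrite distrC; apply: Hd; rewrite distrC.
Qed.

Lemma continuous_comp2 (T : topologicalType) (F : R -> R -> R) (f1 f2 : T -> R) :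
  continuous (fun p : R * R => F p.1 p.2) -> continuous f1 -> continuous f2 ->
  continuous (fun x => F (f1 x) (f2 x)).
Proof.
move=> cF c1 c2 x.
apply: (@continuous2_cvg _ _ _ _ _ _ f1 f2 F (f1 x) (f2 x)); [|exact: c1|exact: c2].
exact: (cF (f1 x, f2 x)).
Qed.

Lemma distribution_path_continuous u f a b : distribution_path u -> smooth1 f ->
  vanishes_off a b f -> continuous (fun x : R => u (Num.max x 0) f).
Proof.
move=> [_ cu] sf f0 x0; have := cu f (test_function_setT sf f0).
move=> /subspace_continuousP /(_ (Num.max x0 0)).
rewrite /= in_itv /= andbT le_max lexx orbT => /(_ isT) cf.
have cm : continuous (fun x : R => Num.max x 0).
  by move=> x; apply: (@continuous_max R R id (cst 0)); [exact: cvg_id|exact: cvg_cst].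
apply/cvgrPdist_le => e e0; move/cvgrPdist_le : cf => /(_ e e0).
rewrite near_withinE => H; near=> x.
suff : [set` `[0, +oo[] (Num.max x 0) -> `|u (Num.max x0 0) f - u (Num.max x 0) f| <= e.
  by apply; rewrite /= in_itv /= andbT le_max lexx orbT.
near: x; exact: (cm x0 _ H).
Unshelve. all: by end_near. Qed.

(** The function z of the overview, continued to x < 0 by its value at x = 0, so that continuity can
    be stated on the whole plane. *)
Definition pairing u psi (x s : R) : R := u (Num.max x 0) (translate psi s).

(** Each [u x] bounds the translates with its own constant. A sum F of translates is again a test
    function, and u(x, F) is continuous in x, hence bounded; the gliding hump turns this into a
    bound uniform in x. *)
Lemma pairing_bounded u psi a b (X S : R) : distribution_path u -> smooth1 psi ->
  vanishes_off a b psi ->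
  exists M, forall x s, x <= X -> `|s| <= S -> `|pairing u psi x s| <= M.
Proof.
move=> du sp p0; have [S0|S0] := ltP S 0.
  by exists 0 => x s _ sS; have := le_lt_trans sS S0; rewrite normr_lt0.
(* Clamping both variables lets the boundedness principle run over all real x and s. *)
pose cx x : R := Num.min x X; pose cs s : R := Num.max (- S) (Num.min s S).
have csS s : `|cs s| <= S.
  rewrite ler_norml /cs le_max lexx ge_max /= lerNl (le_trans _ S0) ?oppr_le0//=.
  by rewrite ge_min lexx orbT.
have dx x : distribution1 (u (Num.max x 0)) by apply: du.1; rewrite le_max lexx orbT.
pose A := `|a| + `|b| + S.
suff [M HM] : exists M, forall x s, `|pairing u psi (cx x) (cs s)| <= M.
  exists M => x s xX sS; have := HM x s; rewrite /cx min_l//.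
  rewrite /cs min_l ?(le_trans (ler_norm _) sS)// max_r//.
  by move: sS; rewrite ler_norml => /andP[].
have vt s := vanishes_off_translate p0 (csS s).
have st s := smooth_translate (cs s) sp.
apply: uniform_boundedness => [x|c s cq].
  have [C C0 [N HC]] := distribution1_bound A (dx (cx x)).
  have [B B0 HB] := test_derive_bounds sp p0 N.
  exists (C * B) => s; apply: HC => [||n nN t]; [exact: st|exact: vt|].
  by rewrite derive1n_translate//; apply: HB.
have [F [sF vF dF]] := smooth_translate_series sp p0 cq (fun k => csS (s k)).
have cuF := distribution_path_continuous du sF vF.
have [B B0 HB] := @continuous_bounded_on R (fun x => u (Num.max x 0) F) (Num.min 0 X) X
  (continuous_subspaceT cuF).
exists B => x; pose y := Num.max (cx x) 0.
have [C C0 [N HC]] := distribution1_bound A (dx (cx x)).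
have [D D0 HD] : exists2 D, 0 <= D & forall n, (n < N)%N -> forall m t,
    `|derive1n n F t - \sum_(k < m) c k * derive1n n psi (t + cs (s k))| <= D * quarter m.
  elim: (N) => [|n [D D0 IH]]; first by exists 0.
  have [E E0 HE] := dF n; exists (D + E); first exact: addr_ge0.
  move=> p; rewrite ltnS leq_eqVlt => /predU1P[-> m t|pn m t].
    by apply: (le_trans (HE m t)); rewrite ler_wpM2r// ?lerDr// ltW// quarter_gt0.
  by apply: (le_trans (IH p pn m t)); rewrite ler_wpM2r// ?lerDl// ltW// quarter_gt0.
exists (u y F), (C * D); split.
  have [X0|X0] := leP 0 X.
    have -> : y = Num.max y 0 by rewrite max_l// le_max lexx orbT.
    apply: HB; rewrite min_l// le_max lexx orbT /= /y ge_max X0 andbT.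
    by rewrite /cx ge_min lexx orbT.
  have -> : y = Num.max X 0.
    by rewrite /y !max_r ?(ltW X0)// /cx ge_min (ltW X0) orbT.
  by apply: HB; rewrite min_r ?lexx// ltW.
move=> m; have sk k := st (s k); have vk k := vt (s k).
have [uS sS vS dS] := distribution1_sum (dx (cx x)) m c sk vk.
rewrite /pairing -/y -uS -(distribution1B (dx (cx x)) sF sS vF vS) -mulrA; apply: HC.
- rewrite (_ : (fun _ => _) = fun t => -1 * (\sum_(k < m) c k * translate psi (cs (s k)) t) + F t).
    exact: smooth_lincomb.
  by apply/funext => t; rewrite mulN1r addrC.
- by move=> t tA; rewrite vF// vS// subrr.
- move=> n nN t; rewrite (_ : (fun _ => _) = fun t => -1 * (\sum_(k < m) c k * translate psi (cs (s k)) t) + F t); last first.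
    by apply/funext => t'; rewrite mulN1r addrC.
  rewrite derive1n_lincomb// dS mulN1r addrC.
  under eq_bigr do rewrite derive1n_translate//.
  exact: HD.
Qed.

Lemma pairing_derive u psi a b (x s : R) : distribution_path u -> smooth1 psi ->
  vanishes_off a b psi ->
  is_derive s 1 (pairing u psi x) (pairing u (derive1 psi) x s).
Proof.
move=> du sp p0; apply: is_derive_translate sp p0.
by apply: du.1; rewrite le_max lexx orbT.
Qed.

(** Weak continuity handles x at fixed s. In s the function is Lipschitz, locally uniformly in x,
    because the pairing with psi' is bounded. *)
Lemma pairing_continuous u psi a b : distribution_path u -> smooth1 psi ->
  vanishes_off a b psi -> continuous (fun p : R * R => pairing u psi p.1 p.2).
Proof.
move=> du sp p0; apply: continuous_pair_eps => x0 s0 e e0.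
have [M HM] := @pairing_bounded u (derive1 psi) a b (x0 + 1) (`|s0| + 1) du
  (smooth_derive1 sp) (vanishes_off_derive1 p0).
have M0 : 0 <= M.
  by apply: le_trans (HM x0 s0 _ _); rewrite ?lerDl.
have := distribution_path_continuous du (smooth_translate s0 sp)
  (vanishes_off_translate p0 (lexx `|s0|)) (x := x0).
move=> /cvgrPdist_le /(_ (e / 2) (divr_gt0 e0 (ltr0Sn _ _)))[d1 /= d10 Hd1].
exists (Num.min 1 (Num.min d1 (e / 2 / (M + 1)))).
  by rewrite !lt_min ltr01 d10 !divr_gt0// ltr_pwDr.
move=> x s; rewrite !lt_min => /and3P[x1 xd _] /and3P[s1 _ sd].
have H1 : `|pairing u psi x s0 - pairing u psi x0 s0| <= e / 2.
  by rewrite distrC; apply: Hd1; rewrite /ball_ /= distrC.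
have xx : x <= x0 + 1 by rewrite -lerBlDl (le_trans (ler_norm _))// ltW.
have s01 : `|s| <= `|s0| + 1.
  by rewrite -[s](subrK s0) (le_trans (ler_normD _ _))// addrC lerD2l ltW.
have H2 : `|pairing u psi x s - pairing u psi x s0| <= M * `|s - s0|.
  have key p q : p <= q -> `|p| <= `|s0| + 1 -> `|q| <= `|s0| + 1 ->
    `|pairing u psi x q - pairing u psi x p| <= M * (q - p).
    move=> pq pS qS; apply: (@MVT_bound R _ (pairing u (derive1 psi) x)) => // t /andP[pt tq].
      exact: pairing_derive sp p0.
    apply: HM => //; move: pS qS; rewrite !ler_norml => /andP[h1 h2] /andP[h3 h4].
    by rewrite (le_trans h1 pt) (le_trans tq h4).
  have s00 : `|s0| <= `|s0| + 1 by rewrite lerDl.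
  have [ss|/ltW ss] := leP s0 s; first by rewrite (@ger0_norm _ (s - s0)) ?subr_ge0// key.
  by rewrite distrC (distrC s) (@ger0_norm _ (s0 - s)) ?subr_ge0// key.
have H3 : M * `|s - s0| <= e / 2.
  move: sd; rewrite ltr_pdivlMr ?ltr_pwDr// => /ltW; apply: le_trans.
  by rewrite mulrC ler_wpM2l// lerDl.
have -> : pairing u psi x s - pairing u psi x0 s0 =
  (pairing u psi x s - pairing u psi x s0) + (pairing u psi x s0 - pairing u psi x0 s0).
  by ring.
apply: (le_trans (ler_normD _ _)); rewrite [leRHS](splitr e).
by apply: lerD => //; exact: le_trans H3.
Qed.

(** A plane wave localised in x. For e^2 = 1 the terms in psi'' cancel under the wave operator. *)
Definition ridge (e : R) chi psi : R * R -> R := fun z => chi z.1 * psi (z.2 + e * z.1).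

Lemma is_derive_ridge e chi psi (z v : R * R) : smooth1 chi -> smooth1 psi ->
  is_derive z v (ridge e chi psi)
    (v.1 * ridge e (derive1 chi) psi z + (v.2 + e * v.1) * ridge e chi (derive1 psi) z).
Proof.
move=> sc sp.
have d1 : is_derive z v (chi \o fst) (v.1 * derive1 chi z.1).
  by apply: (@is_derive_lin _ _ fst) => //; exact: smooth_is_derive.
have d2 : is_derive z v (psi \o (fun z => z.2 + e * z.1))
    ((v.2 + e * v.1) * derive1 psi (z.2 + e * z.1)).
  apply: (@is_derive_lin _ _ (fun z : R * R => z.2 + e * z.1)); last exact: smooth_is_derive.
  by move=> h /=; rewrite /GRing.scale /=; ring.
apply: (@is_derive_eq _ _ _ _ _ _ _ _ (is_deriveM d1 d2)).
by rewrite /ridge /GRing.scale /=; ring.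
Qed.

Inductive ridges (e : R) : (R * R -> R) -> Prop :=
| ridges1 chi psi : smooth1 chi -> smooth1 psi -> ridges e (ridge e chi psi)
| ridgesD F G : ridges e F -> ridges e G -> ridges e (fun z => F z + G z).

Lemma ridgeZl e c chi psi : (fun z => c * ridge e chi psi z) = ridge e (fun x => c * chi x) psi.
Proof. by apply/funext => z; rewrite /ridge mulrA. Qed.

Lemma smooth_ridge e chi psi : smooth1 chi -> smooth1 psi -> smooth (ridge e chi psi).
Proof.
move=> sc sp; apply: (@smooth_coind _ _ (ridges e)); last exact: ridges1.
- move=> H; elim=> [f g sf sg|F G _ cF _ cG] z; last by apply: cvgD; [exact: cF|exact: cG].
  apply: cvgM.
    by apply: (@cvg_comp _ _ _ fst f); [exact: cvg_fst|exact: smooth_continuous].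
  apply: (@cvg_comp _ _ _ (fun z : R * R => z.2 + e * z.1) g); last exact: smooth_continuous.
  by apply: cvgD; [exact: cvg_snd|apply: cvgMr; exact: cvg_fst].
- move=> H v; elim=> [f g sf sg|F G _ [F' SF dF] _ [G' SG dG]]; last first.
    exists (fun z => F' z + G' z); first exact: ridgesD.
    by move=> z; exact: is_deriveD.
  exists (fun z => v.1 * ridge e (derive1 f) g z + (v.2 + e * v.1) * ridge e f (derive1 g) z).
    apply: ridgesD; rewrite ridgeZl; apply: ridges1;
      by [exact/smoothZ/smooth_derive1|exact: smoothZ|exact: smooth_derive1|].
  by move=> z; exact: is_derive_ridge.
Qed.

Lemma test_function_ridge e chi psi al be a b : `|e| = 1 -> 0 < al ->
  smooth1 chi -> smooth1 psi -> vanishes_off al be chi -> vanishes_off a b psi ->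
  @test_function R (R * R)%type (`]0%R, +oo[ `*` setT) (ridge e chi psi).
Proof.
move=> e1 al0 sc sp c0 p0.
pose T := `|a| + `|b| + `|be|.
pose K := [set` `[al, be]] `*` [set` `[- T, T]].
have cK : compact K by apply: compact_setX; exact: segment_compact.
have clK : closed K by apply: compact_closed cK; exact: norm_hausdorff.
have sK : supp (ridge e chi psi) `<=` K.
  apply: (@subset_trans _ (closure K)); last by rewrite -(closure_id K).1.
  apply: closure_subset => -[x t] /=; rewrite /ridge /=.
  rewrite mulf_eq0 negb_or => /andP[cx px].
  have xab : al <= x <= be by apply: contraNT cx => /c0 ->.
  have tab : a <= t + e * x <= b by apply: contraNT px => /p0 ->.
  split => /=; rewrite in_itv //= -ler_norml.
  have ex : `|e * x| <= `|be|.
    rewrite normrM e1 mul1r; case/andP: xab => ax xb.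
    rewrite ger0_norm; last exact: le_trans (ltW al0) ax.
    exact: le_trans xb (ler_norm _).
  have : `|t + e * x| <= `|a| + `|b|.
    case/andP: tab => h1 h2; have := ler_norm b; have := ler_norm (- a); rewrite normrN ler_norml.
    have := normr_ge0 a; have := normr_ge0 b; lra.
  rewrite -{2}[t](addrK (e * x)) => h; apply: (le_trans (ler_normB _ _)).
  exact: lerD.
split; [exact: smooth_ridge|exact: subclosed_compact (@closed_closure _ _) cK sK|].
apply: (subset_trans sK) => -[x t] [/=]; rewrite !in_itv /= andbT => /andP[ax _] _.
by split => //; exact: lt_le_trans al0 ax.
Qed.

Lemma derive_ridge e chi psi v : smooth1 chi -> smooth1 psi ->
  'D_v (ridge e chi psi) = fun z => v.1 * ridge e (derive1 chi) psi z +
     (v.2 + e * v.1) * ridge e chi (derive1 psi) z.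
Proof.
by move=> sc sp; apply/funext => z; have [_ ->] := is_derive_ridge e z v sc sp.
Qed.

Lemma derive2_ridge e chi psi v : smooth1 chi -> smooth1 psi ->
  'D_v ('D_v (ridge e chi psi)) = fun z =>
     v.1 ^+ 2 * ridge e (derive1 (derive1 chi)) psi z +
     2 * (v.1 * (v.2 + e * v.1)) * ridge e (derive1 chi) (derive1 psi) z +
     (v.2 + e * v.1) ^+ 2 * ridge e chi (derive1 (derive1 psi)) z.
Proof.
move=> sc sp; rewrite (derive_ridge e v sc sp); apply/funext => z.
have d1 := is_deriveZ v.1 (is_derive_ridge e z v (smooth_derive1 sc) sp).
have d2 := is_deriveZ (v.2 + e * v.1) (is_derive_ridge e z v sc (smooth_derive1 sp)).
have [_] := is_deriveD d1 d2; rewrite /GRing.scale /=.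
by move=> E; apply: (etrans E); ring.
Qed.

(** With b and b1 the values of z and z_s on the line s = e x, this is the weak form of (b' - 2 e
    b1)' = q b. *)
Lemma wave_equation_characteristic u q psi chi a b al be c e :
  distribution_path u -> wave_equation q u -> smooth1 psi -> vanishes_off a b psi ->
  smooth1 chi -> vanishes_off al be chi -> 0 < al -> be < c -> e ^+ 2 = 1 ->
  \int[@lebesgue_measure R]_(x in `]0, c[)
    (q x * (chi x * pairing u psi x (e * x)) -
     derive1 (derive1 chi) x * pairing u psi x (e * x) -
     2 * e * (derive1 chi x * pairing u (derive1 psi) x (e * x))) = 0.
Proof.
move=> du wq sp p0 sc c0 al0 bec e2.
have e1 : `|e| = 1 by apply/eqP; rewrite -sqrp_eq1// real_normK ?num_real// e2.
have := wq _ (test_function_ridge e1 al0 sc sp c0 p0).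
have D10 z := congr1 (fun F => F z) (derive2_ridge e ((1, 0) : R * R) sc sp).
have D01 z := congr1 (fun F => F z) (derive2_ridge e ((0, 1) : R * R) sc sp).
cbv zeta => H.
set F := fun x => _ - _; rewrite /Rintegral.
suff -> : (\int[lebesgue_measure]_(x in `]0%R, c[) (F x)%:E = 0)%E by [].
rewrite -[RHS]H integral_mkcond [in RHS]integral_mkcond.
apply: eq_integral => x _; rewrite !patchE.
have [xc|xc] := boolP (x \in [set` `]0, c[]).
- have x0 : 0 < x by move: xc; rewrite inE /= in_itv /= => /andP[].
  rewrite ifT; last by rewrite inE /= in_itv /= x0.
  congr EFin.
  have E : (fun t => 'D_((0, 1) : R * R) ('D_((0, 1) : R * R) (ridge e chi psi)) (x, t) -
       'D_((1, 0) : R * R) ('D_((1, 0) : R * R) (ridge e chi psi)) (x, t) +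
       q x * ridge e chi psi (x, t)) =
     (fun t => (q x * chi x - derive1 (derive1 chi) x) * translate psi (e * x) t +
       (- (2 * e * derive1 chi x)) * translate (derive1 psi) (e * x) t).
    apply/funext => t; rewrite D10 D01 /ridge /translate /=.
    have -> : (0 + e * 1) ^+ 2 = 1 by rewrite mulr1 add0r.
    move: (derive1 (derive1 chi) x) (derive1 chi x) (chi x) (psi (t + e * x))
      (derive1 psi (t + e * x)) (derive1 (derive1 psi) (t + e * x)) => r2 r1 r0 w0 w1 w2.
    by ring.
  apply: etrans (congr1 (u x) (esym E)).
  pose A := `|a| + `|b| + `|e * x|.
  have v1 : vanishes_off (- A) A (translate psi (e * x)) := vanishes_off_translate p0 (lexx _).
  have v2 : vanishes_off (- A) A (translate (derive1 psi) (e * x)) :=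
    vanishes_off_translate (vanishes_off_derive1 p0) (lexx _).
  have s1 := smooth_translate (e * x) sp.
  have s2 := smooth_translate (e * x) (smooth_derive1 sp).
  have dx := du.1 x (ltW x0).
  rewrite (distribution1_lincomb dx _ s1 (smoothZ _ s2) v1 (vanishes_offMl _ v2)).
  rewrite (distribution1Z dx _ s2 v2) /F /pairing max_l ?(ltW x0)//; ring.
- case: ifPn => // x0.
  have cx : be < x.
    move: xc x0; rewrite !notin_setE !inE /= !in_itv /= andbT => xc x0.
    by apply: (lt_le_trans bec); rewrite leNgt; apply/negP => xc'; apply: xc; rewrite x0.
  have E : (fun t => 'D_((0, 1) : R * R) ('D_((0, 1) : R * R) (ridge e chi psi)) (x, t) -
       'D_((1, 0) : R * R) ('D_((1, 0) : R * R) (ridge e chi psi)) (x, t) +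
       q x * ridge e chi psi (x, t)) = fun=> 0.
    have xo : ~~ (al <= x <= be) by rewrite negb_and -!ltNge cx orbT.
    apply/funext => t; rewrite D10 D01 /ridge /translate /=.
    have c1 := vanishes_off_derive1 c0.
    by rewrite (c0 x xo) (c1 x xo) (vanishes_off_derive1 c1 xo); ring.
  symmetry; apply: etrans (congr1 (fun f => (u x f)%:E) E) _.
  have x0' : 0 < x by move: x0; rewrite inE /= in_itv /= andbT.
  by rewrite (distribution10 0 0 (du.1 x (ltW x0'))).
Qed.

End WavePath.

(** * Integrals over bounded intervals *)

Section IntegralOn.
Context {R : realType}.
Notation mu := (@lebesgue_measure R).
Implicit Types (c : R) (f g w : R -> R).

Definition integ c f := mu.-integrable `]0, c[ (EFin \o f).

Definition II c f : R := \int[mu]_(x in `]0, c[) f x.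

(** Multipliers that preserve integrability. Indicators of half-lines are among them and encode
    variable limits of integration, so that every integral keeps the domain ]0, c[. *)
Definition bmeas c f := measurable_fun `]0, c[ f /\
  exists M, forall x, 0 < x < c -> `|f x| <= M.

Lemma mem_oo c x : (x \in [set` `]0, c[]) = (0 < x < c) :> bool.
Proof. by apply/idP/idP; rewrite inE /= in_itv. Qed.

Lemma bmeas_continuous c f : continuous f -> bmeas c f.
Proof.
move=> cf; split; first exact: measurable_funS (continuous_measurable_fun cf).
have [B _ HB] := @continuous_bounded_on R f 0 c (continuous_subspaceT cf).
by exists B => x /andP[x0 xc]; apply: HB; rewrite !ltW.
Qed.

Lemma bmeas_cst c (k : R) : bmeas c (fun=> k).
Proof. by apply: bmeas_continuous => x; exact: cvg_cst. Qed.

Lemma bmeasM c f g : bmeas c f -> bmeas c g -> bmeas c (fun x => f x * g x).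
Proof.
move=> [mf [M HM]] [mg [N HN]]; split; first exact: measurable_funM.
by exists (M * N) => x xc; rewrite normrM ler_pM ?HM ?HN.
Qed.

Lemma bmeas_ltr c (a : R) : bmeas c (fun x => (a < x)%R%:R).
Proof.
split; last by exists 1 => x _; case: (a < x); rewrite ?normr1 ?normr0.
rewrite (_ : (fun _ => _) = \1_(`]a, +oo[ : set R)).
  exact: measurable_indic.
by apply/funext => x; rewrite indicE mem_setE in_itv /= andbT.
Qed.

Lemma bmeas_ler c (a : R) : bmeas c (fun x => (x <= a)%R%:R).
Proof.
split; last by exists 1 => x _; case: (x <= a); rewrite ?normr1 ?normr0.
rewrite (_ : (fun _ => _) = \1_(`]-oo, a] : set R)).
  exact: measurable_indic.
by apply/funext => x; rewrite indicE mem_setE in_itv /=.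
Qed.

Lemma eq_integ c f g : (forall x, 0 < x < c -> f x = g x) -> integ c f -> integ c g.
Proof.
by move=> fg; apply: eq_integrable => // x; rewrite mem_oo => /fg /= ->.
Qed.

Lemma integM c w f : integ c w -> bmeas c f -> integ c (fun x => w x * f x).
Proof.
move=> iw [mf [M HM]].
have := @integrableMl _ _ _ mu `]0, c[ _ (EFin \o w) f iw mf.
apply => //; exists M; split; first exact: num_real.
by move=> N MN x; rewrite /= in_itv /= => /HM /le_trans; apply; exact: ltW.
Qed.

Lemma integ_bmeas c f : bmeas c f -> integ c f.
Proof.
move=> [mf [M HM]]; apply: measurable_bounded_integrable => //.
  have : (mu `]0%R, c[ < +oo)%E by rewrite lebesgue_measure_itv /=; case: ifP => _; rewrite ltry.
  exact.
exists M; split; first exact: num_real.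
by move=> N MN x; rewrite /= in_itv /= => /HM /le_trans; apply; exact: ltW.
Qed.

Lemma integ_continuous c f : continuous f -> integ c f.
Proof. by move=> cf; exact/integ_bmeas/bmeas_continuous. Qed.

Lemma integMc c w f : integ c w -> continuous f -> integ c (fun x => w x * f x).
Proof. by move=> iw cf; exact: integM iw (bmeas_continuous c cf). Qed.

Lemma integD c f g : integ c f -> integ c g -> integ c (fun x => f x + g x).
Proof. by move=> If Ig; have := integrableD _ If Ig; exact. Qed.

Lemma integZ c (k : R) f : integ c f -> integ c (fun x => k * f x).
Proof. by move=> If; have := integrableZl _ k If; exact. Qed.

Lemma integB c f g : integ c f -> integ c g -> integ c (fun x => f x - g x).
Proof. by move=> If Ig; have := integrableB _ If Ig; exact. Qed.

Lemma integ_norm c f : integ c f -> integ c (fun x => `|f x|).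
Proof. exact: integrable_norm. Qed.

Lemma IID c f g : integ c f -> integ c g -> II c (fun x => f x + g x) = II c f + II c g.
Proof. by move=> If Ig; exact: RintegralD. Qed.

Lemma IIB c f g : integ c f -> integ c g -> II c (fun x => f x - g x) = II c f - II c g.
Proof. by move=> If Ig; exact: RintegralB. Qed.

Lemma IIZ c (k : R) f : integ c f -> II c (fun x => k * f x) = k * II c f.
Proof. by move=> If; exact: RintegralZl. Qed.

Lemma eq_II c f g : (forall x, 0 < x < c -> f x = g x) -> II c f = II c g.
Proof. by move=> fg; apply: eq_Rintegral => x; rewrite mem_oo => /fg. Qed.

Lemma le_II c f g : integ c f -> integ c g -> (forall x, 0 < x < c -> f x <= g x) ->
  II c f <= II c g.
Proof.
by move=> If Ig fg; apply: le_Rintegral => // x; rewrite /= in_itv /= => /fg.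
Qed.

Lemma norm_II c f g : integ c f -> integ c g -> (forall x, 0 < x < c -> `|f x| <= g x) ->
  `|II c f| <= II c g.
Proof.
move=> If Ig fg; apply: le_trans (le_normr_Rintegral _ If) _ => //.
by apply: le_II => //; exact: integ_norm.
Qed.

Lemma II_cst c (k : R) : 0 <= c -> II c (fun=> k) = k * c.
Proof.
move=> c0; rewrite /II Rintegral_cst//= lebesgue_measure_itv /= lte_fin.
by case: ltP => [|c0'] /=; rewrite ?subr0//; congr (_ * _); apply/le_anti; rewrite c0 c0'.
Qed.

Lemma II_ge0 c f : (forall x, 0 < x < c -> 0 <= f x) -> 0 <= II c f.
Proof. by move=> f0; apply: Rintegral_ge0 => x; rewrite /= in_itv /= => /f0. Qed.

Lemma norm_IIM c w f (M : R) : integ c w -> bmeas c f ->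
  (forall x, 0 < x < c -> `|f x| <= M) ->
  `|II c (fun x => w x * f x)| <= M * II c (fun x => `|w x|).
Proof.
move=> iw bf fM; have iw' := integ_norm iw; rewrite -IIZ//.
apply: norm_II; [exact: integM|exact: integZ|].
by move=> x xc; rewrite normrM mulrC ler_wpM2r// fM.
Qed.

Lemma integ_restrict c w : integ c w -> mu.-integrable setT (EFin \o (w \_ `]0, c[)).
Proof.
by move=> iw; rewrite -restrict_EFin; apply/integrable_restrict => //=; rewrite setTI.
Qed.

(** Absolute continuity of the integral, with [d] independent of the position [a] of the short
    interval. *)
Lemma II_small c w : integ c w -> forall e, 0 < e -> exists2 d, 0 < d &
  forall a h, 0 <= h < d ->
    II c (fun x => `|w x| * ((a < x)%R%:R * (x <= a + h)%R%:R)) < e.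
Proof.
move=> iw e e0; have iw' : mu.-integrable setT (EFin \o (w \_ `]0, c[)).
  exact: integ_restrict.
have [d [d0 Hd]] := integral_normr_continuous iw' e0.
exists d => // a h /andP[h0 hd].
have mah : (mu `]a, (a + h)%R] < d%:E)%E.
  rewrite lebesgue_measure_itv /= lte_fin; case: ifP => _; rewrite lte_fin //.
  by rewrite addrAC subrr add0r.
have := Hd [set` `]a, a + h]] (measurable_itv _) mah.
have -> : \int[mu]_(x in `]a, a + h]) `|(w \_ `]0, c[) x| =
    II c (fun x => `|w x| * ((a < x)%R%:R * (x <= a + h)%R%:R)).
  rewrite /II Rintegral_mkcond [RHS]Rintegral_mkcond; apply: eq_Rintegral => x _.
  rewrite !patchE mem_oo mem_setE in_itv /=.
  by case: (a < x); case: (x <= a + h); case: (0 < x < c); rewrite /= ?mulr1 ?mulr0 ?mul0r ?normr0.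
by [].
Qed.

(** Compactness of [0, c] makes F t tend to F t0 uniformly in y, and the integrable weight then
    needs only its total mass. *)
Lemma II_continuous (T : topologicalType) c w (F : T -> R -> R) : integ c w ->
  continuous (fun z : T * R => F z.1 z.2) ->
  continuous (fun t => II c (fun y => w y * F t y)).
Proof.
move=> iw cF t0.
have cFt t : continuous (F t).
  move=> y; apply: (@cvg_comp _ _ _ (fun y => (t, y)) (fun z => F z.1 z.2)); last exact: (cF (t, y)).
  exact: (cvg_pair (cvg_cst t) cvg_id).
apply/cvgrPdist_le => e e0; set W := II c (fun x => `|w x|) + 1.
have W0 : 0 < W by rewrite ltr_pwDr// II_ge0.
have eW : 0 < e / W by rewrite divr_gt0.
have unif : \forall t \near t0, forall y, 0 <= y <= c -> `|F t0 y - F t y| <= e / W.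
  have [cov _] := compact_near_coveringP [set` `[0, c]].
  have := cov (@segment_compact _ _ _) T (nbhs t0) (fun t y => `|F t0 y - F t y| <= e / W) _.
  move=> /(_ _) H; have : \forall t \near t0, [set` `[0, c]] `<=` (fun y => `|F t0 y - F t y| <= e / W).
    apply: H => y _.
    have /cvgrPdist_le /(_ (e / W / 2) (divr_gt0 eW (ltr0Sn _ _))) := cF (t0, y).
    move=> [[A B] /= [At0 By] HAB].
    exists (B, A) => //= -[y' t] [/= By' At].
    have H1 := HAB (t, y') (conj At By').
    have H2 := HAB (t0, y') (conj (nbhs_singleton At0) By').
    rewrite /= in H1 H2.
    rewrite -(subrK (F t0 y) (F t0 y')) -addrA [e / W]splitr.
    by apply: (le_trans (ler_normD _ _)); apply: lerD => //; rewrite distrC.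
  by apply: filterS => t Ht y yc; apply: Ht; rewrite /= in_itv.
apply: filterS unif => t Ht.
rewrite -IIB; try exact: integMc.
have -> : II c (fun x => w x * F t0 x - w x * F t x) = II c (fun x => w x * (F t0 x - F t x)).
  by apply: eq_II => x _; rewrite mulrBr.
apply: (le_trans (norm_IIM (M := e / W) iw _ _)).
- by apply: bmeas_continuous => y; apply: cvgB; exact: cFt.
- by move=> x /andP[x0 xc]; apply: Ht; rewrite !ltW.
- rewrite mulrAC ler_pdivrMr// ler_wpM2l ?(ltW e0)// /W lerDl ler01 //.
Qed.

Lemma integ_potential q c : potential q -> integ c q.
Proof.
move=> [iq q0].
have i1 : integ c (q \_ `]0, 1[).
  apply: (@integrableS _ _ _ mu setT) => //.
  exact: integ_restrict.
(* A potential is arbitrary at the single point 1, so its value there is added as a separate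
   term. *)
have i2 : integ c (fun x => q 1 * \1_[set (1 : R)] x).
  apply/integZ/integ_bmeas; split; first exact: measurable_indic.
  by exists 1 => x _; rewrite indicE; case: (_ \in _); rewrite ?normr1 ?normr0.
apply: eq_integ (integD i1 i2) => x /andP[x0 xc].
rewrite patchE mem_oo x0 indicE; have [x1|x1|->] := ltgtP x 1 => /=.
- rewrite (_ : x \in _ = false) ?mulr0 ?addr0//.
  by apply/negbTE; rewrite notin_setE /=; move=> xE; rewrite xE ltxx in x1.
- rewrite (_ : x \in _ = false) ?mulr0 ?addr0 ?q0//.
  by apply/negbTE; rewrite notin_setE /=; move=> xE; rewrite xE ltxx in x1.
- by rewrite mem_set// mulr1 add0r.
Qed.

End IntegralOn.

(** * From the weak equation to characteristics *)

Section WeakToClassical.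
Context {R : realType}.
Implicit Types (c : R) (f g w : R -> R).

Lemma le_eps0 (x C : R) : (forall e, 0 < e -> `|x| <= C * e) -> x = 0.
Proof.
move=> H; apply/eqP; rewrite -normr_le0; apply/ler_addgt0Pr => e e0; rewrite add0r.
have C0 : 0 <= C by have := H 1 ltr01; rewrite mulr1; apply: le_trans.
have C1 : 0 < C + 1 by rewrite ltr_pwDr.
apply: (le_trans (H (e / (C + 1)) (divr_gt0 e0 C1))).
by rewrite mulrCA ler_piMr ?(ltW e0)// ler_pdivrMr// mul1r lerDl.
Qed.

Lemma continuous_eps f (a e : R) : continuous f -> 0 < e ->
  exists2 d, 0 < d & forall x, `|x - a| < d -> `|f x - f a| <= e.
Proof.
move=> cf e0; have /cvgrPdist_le /(_ e e0)[d /= d0 Hd] := cf a.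
by exists d => // x xa; rewrite distrC; apply: Hd; rewrite /ball_ /= distrC.
Qed.

Lemma II_FTC c f F : 0 < c -> continuous f ->
  (forall x : R, is_derive x 1 F (f x)) -> II c f = F c - F 0.
Proof.
move=> c0 cf dF; have icf : forall b0 b1, lebesgue_measure.-integrable
    [set` Interval (BSide b0 0) (BSide b1 c)] (EFin \o f).
  move=> b0 b1; apply: (@integrableS _ _ _ (@lebesgue_measure R) [set` `[0, c]] [set` Interval (BSide b0 0) (BSide b1 c)] (EFin \o f)) => //.
    by apply: subset_itv; rewrite bnd_simp; case: b0 b1 => -[].
  apply: continuous_compact_integrable; first exact: segment_compact.
  exact: continuous_subspaceT.
rewrite /II Rintegral_itv_bndo_bndc// Rintegral_itv_obnd_cbnd//.
rewrite /Rintegral (@continuous_FTC2 R f F 0 c)//.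
- exact: continuous_subspaceT.
- have cF : continuous F by move=> x; exact: (is_derive_continuous (dF x)).
  split; first by move=> x _; have [] := dF x.
  + exact/cvg_at_right_filter/cF.
  + exact/cvg_at_left_filter/cF.
- by move=> x _; rewrite derive1E; have [_ ->] := dF x.
Qed.

(** Rescaled at a point, these functions approximate a unit mass, a jump and a positive part. The
    offset [k] is common to all centres and cancels in affine combinations. *)
Lemma ramp_estimates : exists r K L (k : R), [/\ smooth1 r /\ smooth1 K /\ smooth1 L,
   forall x : R, is_derive x 1 K (r x),
   forall x : R, is_derive x 1 L (K x) &
   [/\ forall x, 0 <= r x, vanishes_off 0 1 r,
    forall x, `|K x - (0 < x)%R%:R| <= (0 < x)%R%:R * (x <= 1)%R%:R,
    (forall x, x <= 0 -> K x = 0) /\ (forall x, 1 <= x -> K x = 1) &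
    [/\ forall x, x <= 0 -> L x = 0, forall x, 1 <= x -> L x = x + k &
      forall x, `|L x - Num.max x 0| <= 1]]].
Proof.
have [r [K [L [sr dK dL [r0 rv K0 K1 L0]]]]] := @smooth_ramp R.
have sK := smooth_antideriv dK sr; have sL := smooth_antideriv dL sK.
have Kmono x y : x <= y -> K x <= K y.
  move=> xy; rewrite -lerN2 -subr_le0 opprK addrC.
  have := @MVT_upper R (fun x => - K x) (fun x => - r x) x y 0 xy.
  by rewrite mul0r opprK addrC; apply=> z _; rewrite oppr_le0.
have Kge x : 0 <= K x.
  have [x0|/ltW x0] := leP x 0; first by rewrite K0.
  by rewrite -(K0 0 (lexx _)) Kmono.
have Kle x : K x <= 1.
  have [x1|/ltW x1] := leP 1 x; first by rewrite K1.
  by rewrite -(K1 1 (lexx _)) Kmono.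
have L1 x : 1 <= x -> L x = x + (L 1 - 1).
  move=> x1; have := @MVT_bound R (fun x => L x - x) (fun x => K x - 1) 1 x 0 x1.
  rewrite mul0r normr_le0 subr_eq0 => H; have /eqP E : L x - x == L 1 - 1.
    by apply: H => z /andP[z1 _]; rewrite K1// subrr normr0.
  by rewrite -E; ring.
have Lup x : 0 <= x -> 0 <= L x <= x.
  move=> x0; apply/andP; split.
    have := @MVT_upper R (fun x => - L x) (fun x => - K x) 0 x 0 x0.
    rewrite mul0r opprK (L0 0 (lexx _)) addr0 oppr_le0; by apply=> z _; rewrite oppr_le0.
  have := @MVT_upper R L K 0 x 1 x0.
  by rewrite mul1r (L0 0 (lexx _)) !subr0; apply.
exists r, K, L, (L 1 - 1); split => //; split => //.
- move=> x; have [x0|x0] := ltP 0 x; last by rewrite K0// subrr normr0 mul0r.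
  have [x1|x1] := leP x 1; last by rewrite K1 ?(ltW x1)// subrr normr0 mulr0.
  by rewrite mulr1 distrC ger0_norm ?subr_ge0// lerBlDr lerDl.
- split => // x; have [x0|/ltW x0] := leP x 0.
    by rewrite L0// subrr normr0.
  have /andP[h1 h2] := Lup x x0; rewrite distrC ger0_norm ?subr_ge0//.
  have [x1|/ltW x1] := leP x 1; first by rewrite lerBlDr (le_trans x1)// lerDl.
  have /andP[h3 h4] := Lup 1 ler01; rewrite (L1 x x1); lra.
Qed.

(** One-sided, so that the boundary point x = 0 is treated like the interior ones. *)
Definition right_derivative (b : R -> R) (a d : R) := forall e, 0 < e -> exists2 r, 0 < r &
  forall h, 0 < h < r -> `|b (a + h) - b a - h * d| <= e * h.

Section Limit.
Variables (c : R) (q b b1 : R -> R) (e : R).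
Hypotheses (c0 : 0 < c) (iq : integ c q) (cb : continuous b) (cb1 : continuous b1).
Hypothesis weak : forall chi al be, smooth1 chi -> vanishes_off al be chi ->
  0 < al -> be < c ->
  II c (fun x => q x * (chi x * b x) - derive1 (derive1 chi) x * b x -
                 2 * e * (derive1 chi x * b1 x)) = 0.

Let pos (a x : R) : R := Num.max (x - a) 0.

Let cpos a : continuous (pos a).
Proof.
move=> x; apply: (@continuous_max R R (fun x => x - a) (cst 0)); last exact: cvg_cst.
by apply: cvgB; [exact: cvg_id|exact: cvg_cst].
Qed.

(** The weak functional at chi = max (x - a) 0, for which chi' is a jump and chi'' a unit mass at a.
    This chi has no compact support, so [G a] need not vanish; it is affine in a instead. *)
Let G (a : R) : R := II c (fun x => q x * (pos a x * b x)) - b a -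
  2 * e * II c (fun x => (a < x)%R%:R * b1 x).

Let iqb a : integ c (fun x => q x * (pos a x * b x)).
Proof. by apply: integMc => // x; apply: cvgM; [exact: cpos|exact: cb]. Qed.

Let ib1 a : integ c (fun x => (a < x)%R%:R * b1 x).
Proof. by apply: integ_bmeas; apply: bmeasM; [exact: bmeas_ltr|exact: bmeas_continuous]. Qed.

Let bnd f : continuous f -> exists2 B, 0 <= B & forall x, 0 <= x <= c -> `|f x| <= B.
Proof. by move=> cf; exact: (continuous_bounded_on (continuous_subspaceT cf)). Qed.

Let small eta : 0 < eta -> exists2 d, 0 < d & forall a h, 0 <= h < d ->
  II c (fun x => (a < x)%R%:R * (x <= a + h)%R%:R) < eta.
Proof.
move=> eta0; have [d d0 Hd] := II_small (integ_bmeas (bmeas_cst c (1 : R))) eta0.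
exists d => // a h /(Hd a); rewrite (eq_II (g := fun x => (a < x)%R%:R * (x <= a + h)%R%:R))//.
by move=> x _; rewrite normr1 mul1r.
Qed.

(** At scale d the smoothed ramp is within d of [pos a], the mollifier is a unit mass in [a, a + d],
    and the smoothed jump differs from the indicator on ]a, a + d] only. Each of the three errors is
    at most eta / 4. *)
Let affine_approx (r K L : R -> R) (k : R) :
   smooth1 r /\ smooth1 K /\ smooth1 L ->
   (forall x : R, is_derive x 1 K (r x)) -> (forall x : R, is_derive x 1 L (K x)) ->
   (forall x, 0 <= r x) -> vanishes_off 0 1 r ->
   (forall x, `|K x - (0 < x)%R%:R| <= (0 < x)%R%:R * (x <= 1)%R%:R) ->
   (forall x, x <= 0 -> K x = 0) /\ (forall x, 1 <= x -> K x = 1) ->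
   (forall x, `|L x - Num.max x 0| <= 1) ->
   forall a eta, 0 < a < c -> 0 < eta -> exists2 d0, 0 < d0 & forall d, 0 < d < d0 ->
   `|II c (fun x => q x * (d * L (d^-1 * x + - (a / d)) * b x)) -
     II c (fun x => d^-1 * r (d^-1 * x + - (a / d)) * b x) -
     2 * e * II c (fun x => K (d^-1 * x + - (a / d)) * b1 x) - G a| <= eta.
Proof.
move=> [sr [sK sL]] dK dL r0 rv Kest [K0 K1] Lest a eta /andP[a0 ac] eta0.
have [B B0 HB] := bnd cb; have [B1 B10 HB1] := bnd cb1.
set Q := II c (fun x => `|q x|); have Q0 : 0 <= Q by exact: II_ge0.
have eta4 : 0 < eta / 4 by rewrite divr_gt0.
have [d1 d10 Hd1] := continuous_eps a cb eta4.
have E0 : 0 < eta / 4 / (2 * `|e| * B1 + 1) by rewrite divr_gt0// ltr_pwDr// !mulr_ge0.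
have [d2 d20 Hd2] := small E0.
have B0Q : 0 < eta / 4 / (B * Q + 1) by rewrite divr_gt0// ltr_pwDr// mulr_ge0.
exists (Num.min (c - a) (Num.min d1 (Num.min d2 (eta / 4 / (B * Q + 1))))).
  by rewrite !lt_min subr_gt0 ac d10 d20.
move=> d /andP[d0]; rewrite !lt_min => /and4P[dca dd1 dd2 dd3].
have sc x : d^-1 * x + - (a / d) = (x - a) / d by field; rewrite gt_eqF.
have cL : continuous (fun x => d * L (d^-1 * x + - (a / d))).
  by apply: smooth_continuous; apply: smoothZ; exact: smooth_affine.
have cK : continuous (fun x => K (d^-1 * x + - (a / d))).
  by apply: smooth_continuous; exact: smooth_affine.
have cr : continuous (fun x => d^-1 * r (d^-1 * x + - (a / d))).
  by apply: smooth_continuous; apply: smoothZ; exact: smooth_affine.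
have T1 : `|II c (fun x => q x * (d * L (d^-1 * x + - (a / d)) * b x)) -
            II c (fun x => q x * (pos a x * b x))| <= eta / 4.
  have iL : integ c (fun x => q x * (d * L (d^-1 * x + - (a / d)) * b x)).
    by apply: integMc => // x; apply: cvgM; [exact: cL|exact: cb].
  rewrite -IIB//.
  have -> : II c (fun x => q x * (d * L (d^-1 * x + - (a / d)) * b x) - q x * (pos a x * b x)) =
    II c (fun x => q x * ((d * L (d^-1 * x + - (a / d)) - pos a x) * b x)).
    by apply: eq_II => x _; ring.
  apply: (le_trans (norm_IIM (M := d * B) iq _ _)).
  + apply: bmeas_continuous => x; apply: cvgM; last exact: cb.
    by apply: cvgB; [exact: cL|exact: cpos].
  + move=> x /andP[x0 xc]; rewrite normrM ler_pM//; last by apply: HB; rewrite !ltW.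
    rewrite sc /pos; have -> : Num.max (x - a) 0 = d * Num.max ((x - a) / d) 0.
      by rewrite maxr_pMr ?(ltW d0)// mulr0 mulrCA mulfV ?gt_eqF// mulr1.
    by rewrite -mulrBr normrM (gtr0_norm d0) ler_piMr// ltW.
  + rewrite -mulrA; move: dd3; rewrite ltr_pdivlMr ?ltr_pwDr ?mulr_ge0// => /ltW; apply: le_trans.
    by rewrite ler_wpM2l ?(ltW d0)// lerDl.
have T2 : `|II c (fun x => d^-1 * r (d^-1 * x + - (a / d)) * b x) - b a| <= eta / 4.
  have mass : II c (fun x => d^-1 * r (d^-1 * x + - (a / d))) = 1.
      have dKs (x : R) : is_derive x 1 (fun x : R => K (d^-1 * x + - (a / d)))
        (d^-1 * r (d^-1 * x + - (a / d))) by exact: is_derive_affine.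
    rewrite (II_FTC c0 cr dKs).
    rewrite !sc K1 ?K0 ?subr0// ?add0r.
      by rewrite pmulr_lle0 ?invr_gt0// oppr_le0 ltW.
    by rewrite ler_pdivlMr// mul1r; lra.
  have -> : II c (fun x => d^-1 * r (d^-1 * x + - (a / d)) * b x) - b a =
     II c (fun x => d^-1 * r (d^-1 * x + - (a / d)) * (b x - b a)).
    rewrite -[X in _ - X]mulr1 -mass -IIZ; last exact: integ_continuous.
    rewrite -IIB; [|apply: integ_continuous => x; apply: cvgM; [exact: cr|exact: cb]|
      exact/integZ/integ_continuous].
    by apply: eq_II => x _; ring.
  have ir : integ c (fun x => eta / 4 * (d^-1 * r (d^-1 * x + - (a / d)))).
    exact/integZ/integ_continuous.
  apply: (le_trans (norm_II _ ir _)).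
  + apply: integ_continuous => x; apply: cvgM; first exact: cr.
    by apply: cvgB; [exact: cb|exact: cvg_cst].
  + move=> x _; rewrite normrM ger0_norm; last by rewrite mulr_ge0// invr_ge0 ltW.
    rewrite mulrC; have [xr|/rv ->] := boolP (0 <= d^-1 * x + - (a / d) <= 1); last first.
      by rewrite !mulr0.
    rewrite ler_wpM2r//; first by rewrite mulr_ge0// invr_ge0 ltW.
    apply: Hd1; move: xr; rewrite sc => /andP[].
    rewrite pmulr_lge0 ?invr_gt0// ler_pdivrMr// mul1r => h1 h2.
    by rewrite ger0_norm//; exact: le_lt_trans h2 dd1.
  + by rewrite IIZ ?mass ?mulr1//; exact: integ_continuous.
have T3 : `|2 * e * II c (fun x => K (d^-1 * x + - (a / d)) * b1 x) -
            2 * e * II c (fun x => (a < x)%R%:R * b1 x)| <= eta / 4.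
  have iK : integ c (fun x => K (d^-1 * x + - (a / d)) * b1 x).
    by apply: integ_continuous => x; apply: cvgM; [exact: cK|exact: cb1].
  rewrite -mulrBr -IIB// !normrM (ger0_norm (ler0n _ 2)).
  set J := (X in _ * `|II c X|).
  have imid : integ c (fun x => B1 * ((a < x)%R%:R * (x <= a + d)%R%:R)).
    by apply/integZ/integ_bmeas; apply: bmeasM; [exact: bmeas_ltr|exact: bmeas_ler].
  have HJ : `|II c J| <= B1 * II c (fun x => (a < x)%R%:R * (x <= a + d)%R%:R).
    rewrite -IIZ; last by apply: integ_bmeas; apply: bmeasM; [exact: bmeas_ltr|exact: bmeas_ler].
    apply: norm_II => //; first exact: integB.
    move=> x /andP[x0 xc]; rewrite /J -mulrBl normrM mulrC ler_pM//.
      by apply: HB1; rewrite !ltW.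
    rewrite sc; have := Kest ((x - a) / d).
    by rewrite pmulr_lgt0 ?invr_gt0// subr_gt0 ler_pdivrMr// mul1r lerBlDl.
  have := Hd2 a d; rewrite (ltW d0) dd2 => /(_ isT).
  rewrite ltr_pdivlMr; last by rewrite ltr_pwDr// !mulr_ge0.
  set S := II c _ => HS.
  have S0 : 0 <= S by apply: II_ge0 => x _; rewrite mulr_ge0.
  apply: (@le_trans _ _ (2 * `|e| * (B1 * S))); first by rewrite ler_wpM2l// mulr_ge0.
  apply: le_trans (ltW HS); rewrite mulrDr mulr1.
  by rewrite (_ : 2 * `|e| * (B1 * S) = S * (2 * `|e| * B1)) ?lerDl//; ring.
rewrite /G; move: T1 T2 T3.
set X1 := II c _; set X2 := II c _; set X3 := II c _; set Y1 := 2 * e * _; set Y2 := 2 * e * _.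
move=> T1 T2 T3.
have -> : X1 - X3 - Y1 - (X2 - b a - Y2) = (X1 - X2) - (X3 - b a) - (Y1 - Y2) by ring.
apply: (le_trans (ler_normB _ _)).
by apply: (@le_trans _ _ (eta / 4 + eta / 4 + eta / 4));
  [apply: lerD => //; apply: (le_trans (ler_normB _ _)); apply: lerD|lra].
Qed.

(** The weights annihilate constants and the sequence a_i. To the right the smoothed ramps equal x -
    a_i + k d, so their combination vanishes there and is an admissible test function. *)
Let G_affine a1 a2 a3 : 0 < a1 -> a1 < a2 -> a2 < a3 -> a3 < c ->
  (a3 - a2) * G a1 - (a3 - a1) * G a2 + (a2 - a1) * G a3 = 0.
Proof.
move=> a10 a12 a23 a3c.
have [r [K [L [k [[sr [sK sL]] dK dL [r0 rv Kest [K0 K1] [L0 L1 Lest]]]]]]] := ramp_estimates.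
apply: (@le_eps0 _ ((a3 - a2) + (a3 - a1) + (a2 - a1))) => eta eta0.
have A a : 0 < a < c -> _ := fun ac => affine_approx k (conj sr (conj sK sL)) dK dL r0 rv Kest (conj K0 K1) Lest ac eta0.
have [|d1 d10 H1] := A a1 _; first by rewrite a10 (lt_trans a12 (lt_trans a23 a3c)).
have [|d2 d20 H2] := A a2 _; first by rewrite (lt_trans a10 a12) (lt_trans a23 a3c).
have [|d3 d30 H3] := A a3 _; first by rewrite (lt_trans a10 (lt_trans a12 a23)) a3c.
pose d := Num.min (Num.min d1 d2) (Num.min d3 (c - a3)) / 2.
have m0 : 0 < Num.min (Num.min d1 d2) (Num.min d3 (c - a3)) by rewrite !lt_min d10 d20 d30 subr_gt0.
have d0 : 0 < d by rewrite divr_gt0.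
have : d < Num.min (Num.min d1 d2) (Num.min d3 (c - a3)) by rewrite /d; lra.
rewrite !lt_min => /andP[/andP[h1 h2] /andP[h3 h4]].
have {H1} := H1 d; rewrite d0 h1 => /(_ isT) H1.
have {H2} := H2 d; rewrite d0 h2 => /(_ isT) H2.
have {H3} := H3 d; rewrite d0 h3 => /(_ isT) H3.
pose Ln a x := d * L (d^-1 * x + - (a / d)).
pose Kn a x := K (d^-1 * x + - (a / d)).
pose rn a x := d^-1 * r (d^-1 * x + - (a / d)).
have sLn a : smooth1 (Ln a) by apply: smoothZ; exact: smooth_affine.
have sKn a : smooth1 (Kn a) by exact: smooth_affine.
have srn a : smooth1 (rn a) by apply: smoothZ; exact: smooth_affine.
have dLn a (x : R) : is_derive x 1 (Ln a) (Kn a x).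
  have := is_deriveZ d (is_derive_affine (dL (d^-1 * x + - (a / d)))).
  by rewrite /GRing.scale /= mulrA mulfV ?mul1r// gt_eqF.
have dKn a (x : R) : is_derive x 1 (Kn a) (rn a x) by exact: is_derive_affine.
pose chi x := (a3 - a2) * Ln a1 x + ((- (a3 - a1)) * Ln a2 x + (a2 - a1) * Ln a3 x).
have dcomb (f1 f2 f3 g1 g2 g3 : R -> R) : (forall x : R, is_derive x 1 f1 (g1 x)) ->
    (forall x : R, is_derive x 1 f2 (g2 x)) -> (forall x : R, is_derive x 1 f3 (g3 x)) ->
    derive1 (fun x => (a3 - a2) * f1 x + ((- (a3 - a1)) * f2 x + (a2 - a1) * f3 x)) =
    fun x => (a3 - a2) * g1 x + ((- (a3 - a1)) * g2 x + (a2 - a1) * g3 x).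
  by move=> D1 D2 D3; apply: derive1_eq.
have sc a x : d^-1 * x + - (a / d) = (x - a) / d by field; rewrite gt_eqF.
have schi : smooth1 chi by apply: smooth_lincomb => //; apply: smooth_lincomb => //; exact: smoothZ.
have vchi : vanishes_off a1 (a3 + d) chi.
  move=> x; rewrite negb_and -!ltNge => /orP[xa|xa].
    have L0' a : a1 <= a -> Ln a x = 0.
      move=> aa; rewrite /Ln sc L0 ?mulr0// pmulr_lle0 ?invr_gt0// subr_le0.
      exact: le_trans (ltW xa) aa.
    by rewrite /chi !L0' ?lexx ?(ltW a12) ?(ltW (lt_trans a12 a23))//; ring.
  have L1' a : a <= a3 -> Ln a x = x - a + k * d.
    move=> aa; rewrite /Ln sc L1; first by field; rewrite gt_eqF.
    by rewrite ler_pdivlMr// mul1r; lra.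
  by rewrite /chi !L1' ?lexx ?(ltW a23) ?(ltW (lt_trans a12 a23))//; ring.
have := weak schi vchi a10 _; rewrite -ltrBrDl => /(_ h4).
have E1 : derive1 chi = _ := dcomb _ _ _ _ _ _ (dLn a1) (dLn a2) (dLn a3).
rewrite E1 (dcomb _ _ _ _ _ _ (dKn a1) (dKn a2) (dKn a3)) => W.
have cLn a := smooth_continuous (sLn a); have cKn a := smooth_continuous (sKn a).
have crn a := smooth_continuous (srn a).
have i1 a : integ c (fun x => q x * (Ln a x * b x)).
  by apply: integMc => // x; apply: cvgM; [exact: cLn|exact: cb].
have i2 a : integ c (fun x => rn a x * b x).
  by apply: integ_continuous => x; apply: cvgM; [exact: crn|exact: cb].
have i3 a : integ c (fun x => Kn a x * b1 x).
  by apply: integ_continuous => x; apply: cvgM; [exact: cKn|exact: cb1].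
pose La a := II c (fun x => q x * (Ln a x * b x)) - II c (fun x => rn a x * b x) -
  2 * e * II c (fun x => Kn a x * b1 x).
have i12 a : integ c (fun x => q x * (Ln a x * b x) - rn a x * b x) by apply: integB.
have LaE a : La a = II c (fun x => q x * (Ln a x * b x) - rn a x * b x - 2 * e * (Kn a x * b1 x)).
  by rewrite IIB ?IIB ?IIZ//; exact: integZ.
have iLa a : integ c (fun x => q x * (Ln a x * b x) - rn a x * b x - 2 * e * (Kn a x * b1 x)).
  by apply: integB => //; exact: integZ.
have {}W : (a3 - a2) * La a1 + ((- (a3 - a1)) * La a2 + (a2 - a1) * La a3) = 0.
  rewrite -{}W !LaE -!IIZ// -IID; [|exact: integZ|exact: integZ].
  rewrite -IID; [|exact: integZ|by apply: integD; exact: integZ].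
  by apply: eq_II => x _; rewrite /chi; ring.
have -> : (a3 - a2) * G a1 - (a3 - a1) * G a2 + (a2 - a1) * G a3 =
  - ((a3 - a2) * (La a1 - G a1)) + (a3 - a1) * (La a2 - G a2) - (a2 - a1) * (La a3 - G a3).
  by rewrite -[LHS]subr0 -[in LHS]W; ring.
have w1 : 0 <= a3 - a2 by rewrite subr_ge0 ltW.
have w2 : 0 <= a3 - a1 by rewrite subr_ge0 ltW// (lt_trans a12).
have w3 : 0 <= a2 - a1 by rewrite subr_ge0 ltW.
apply: (le_trans (ler_normB _ _)); rewrite [leRHS]mulrDl; apply: lerD; last first.
  by rewrite normrM (ger0_norm w3) ler_wpM2l.
apply: (le_trans (ler_normD _ _)); rewrite [leRHS]mulrDl normrN; apply: lerD.
  by rewrite normrM (ger0_norm w1) ler_wpM2l.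
by rewrite normrM (ger0_norm w2) ler_wpM2l.
Qed.

Let G_increment a h : 0 <= h -> G (a + h) - G a =
  - II c (fun x => q x * ((pos a x - pos (a + h) x) * b x)) - (b (a + h) - b a) +
  2 * e * II c (fun x => (a < x)%R%:R * (x <= a + h)%R%:R * b1 x).
Proof.
move=> h0; rewrite /G.
have E1 : II c (fun x => q x * ((pos a x - pos (a + h) x) * b x)) =
   II c (fun x => q x * (pos a x * b x)) - II c (fun x => q x * (pos (a + h) x * b x)).
  by rewrite -IIB//; apply: eq_II => x _; ring.
have E2 : II c (fun x => (a < x)%R%:R * (x <= a + h)%R%:R * b1 x) =
   II c (fun x => (a < x)%R%:R * b1 x) - II c (fun x => (a + h < x)%R%:R * b1 x).
  rewrite -IIB//; apply: eq_II => x _; rewrite -mulrBl; congr (_ * _).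
  have [ax|ax] := ltP a x; have [hx|hx] := leP x (a + h); rewrite ?mulr1 ?mulr0 ?subr0 ?subrr//.
  by have := le_lt_trans ax (le_lt_trans (_ : a <= a + h) hx); rewrite lerDl h0 ltxx => /(_ isT).
by rewrite E1 E2; ring.
Qed.

Let pos_diff a h x : 0 <= h -> `|pos a x - pos (a + h) x - h * (a < x)%R%:R| <=
   h * ((a < x)%R%:R * (x <= a + h)%R%:R) /\ `|pos a x - pos (a + h) x| <= h.
Proof.
move=> h0; rewrite /pos; have [ax|ax] := ltP a x.
  rewrite (max_l (_ : 0 <= x - a)) ?subr_ge0 ?(ltW ax)// mulr1 mul1r.
  have [hx|hx] := leP x (a + h).
    rewrite max_r ?subr_le0// subr0 mulr1.
    by split; rewrite ler_norml; apply/andP; split; lra.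
  rewrite max_l ?subr_ge0 ?(ltW hx)// (_ : x - a - (x - (a + h)) - h = 0); last by ring.
  by rewrite normr0 mulr0 (_ : x - a - (x - (a + h)) = h) ?ger0_norm//; ring.
rewrite !max_r ?subr_le0//; first by rewrite subr0 mulr0 subr0 normr0 mul0r mulr0.
by rewrite (le_trans ax)// lerDl.
Qed.

(** An affine [G] has known increments up to its slope, and [G_increment] then yields the increments
    of b. The result is the once integrated form of (b' - 2 e b1)' = q b. *)
Lemma weak_right_derivative : exists Q, forall a, 0 <= a < c ->
  right_derivative b a (2 * e * b1 a + Q - II c (fun x => q x * ((a < x)%R%:R * b x))).
Proof.
have [B B0 HB] := bnd cb; have [B1 B10 HB1] := bnd cb1.
(* Test functions vanish near 0, so affinity is known for positive arguments first; continuity at 0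
   extends it to the end point. *)
have Gcont0 eta : 0 < eta -> exists2 d, 0 < d & forall h, 0 < h < d -> `|G h - G 0| <= eta.
  move=> eta0; have eta4 : 0 < eta / 4 by rewrite divr_gt0.
  have [d1 d10 Hd1] := continuous_eps 0 cb eta4.
  have E0 : 0 < eta / 4 / (2 * `|e| * B1 + 1) by rewrite divr_gt0// ltr_pwDr// !mulr_ge0.
  have [d2 d20 Hd2] := small E0.
  set Q := II c (fun x => `|q x|); have Q0 : 0 <= Q by exact: II_ge0.
  have B0Q : 0 < eta / 4 / (B * Q + 1) by rewrite divr_gt0// ltr_pwDr// mulr_ge0.
  exists (Num.min d1 (Num.min d2 (eta / 4 / (B * Q + 1)))); first by rewrite !lt_min d10 d20.
  move=> h /andP[h0]; rewrite !lt_min => /and3P[hd1 hd2 hd3].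
  rewrite -[h in G h]add0r G_increment ?(ltW h0)// add0r.
  have T1 : `|II c (fun x => q x * ((pos 0 x - pos (0 + h) x) * b x))| <= eta / 4.
    apply: (le_trans (norm_IIM (M := h * B) iq _ _)).
    + apply: bmeas_continuous => x; apply: cvgM; last exact: cb.
      by apply: cvgB; exact: cpos.
    + move=> x /andP[x0 xc]; rewrite normrM ler_pM//; last by apply: HB; rewrite !ltW.
      by have [] := pos_diff 0 x (ltW h0).
    + rewrite -mulrA; move: hd3; rewrite ltr_pdivlMr ?ltr_pwDr ?mulr_ge0// => /ltW; apply: le_trans.
      by rewrite ler_wpM2l ?(ltW h0)// lerDl.
  have T2 : `|b h - b 0| <= eta / 4.
    by apply: Hd1; rewrite subr0 gtr0_norm.
  have T3 : `|2 * e * II c (fun x => (0 < x)%R%:R * (x <= 0 + h)%R%:R * b1 x)| <= eta / 4.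
    rewrite !normrM (ger0_norm (ler0n _ 2)).
    have := Hd2 0 h; rewrite (ltW h0) hd2 => /(_ isT).
    rewrite ltr_pdivlMr; last by rewrite ltr_pwDr// !mulr_ge0.
    have bS : bmeas c (fun x => (0 < x)%R%:R * (x <= 0 + h)%R%:R).
      by apply: bmeasM; [exact: bmeas_ltr|exact: bmeas_ler].
    set S := II c _ => HS.
    have S0 : 0 <= S by apply: II_ge0 => x _; rewrite mulr_ge0.
    have : `|II c (fun x => (0 < x)%R%:R * (x <= 0 + h)%R%:R * b1 x)| <= B1 * S.
      rewrite -IIZ; last exact: integ_bmeas.
      apply: norm_II; [|exact/integZ/integ_bmeas|].
        by apply: integ_bmeas; apply: bmeasM => //; exact: bmeas_continuous.
      move=> x /andP[x0 xc]; rewrite normrM mulrC (ger0_norm (_ : 0 <= _ * _)) ?mulr_ge0// ler_wpM2r ?mulr_ge0//.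
      by apply: HB1; rewrite !ltW.
    move=> HJ; apply: (@le_trans _ _ (2 * `|e| * (B1 * S))).
      by rewrite ler_wpM2l// mulr_ge0.
    apply: le_trans (ltW HS); rewrite mulrDr mulr1.
    by rewrite (_ : 2 * `|e| * (B1 * S) = S * (2 * `|e| * B1)) ?lerDl//; ring.
  apply: (le_trans (ler_normD _ _)).
  have := ler_normB (- II c (fun x => q x * ((pos 0 x - pos (0 + h) x) * b x))) (b h - b 0).
  rewrite normrN add0r in T1 T3 *; lra.
have Gaff0 m : 0 < m < c -> forall m', m < m' < c -> (m' - m) * G 0 + m * G m' = m' * G m.
  move=> /andP[m0 mc] m' /andP[mm m'c].
  apply/eqP; rewrite -subr_eq0; apply/eqP.
  apply: (@le_eps0 _ (`|G m'| + `|G m| + m')) => eta eta0.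
  have [d d0 Hd] := Gcont0 _ eta0.
  pose h := Num.min (Num.min d m) eta / 2.
  have mn0 : 0 < Num.min (Num.min d m) eta by rewrite !lt_min d0 m0.
  have h0 : 0 < h by rewrite divr_gt0.
  have : h < Num.min (Num.min d m) eta by rewrite /h; lra.
  rewrite !lt_min => /andP[/andP[hd hm] he]; clearbody h.
  have := G_affine h0 hm mm m'c => A.
  have := Hd h; rewrite h0 hd => /(_ isT) Hh.
  have -> : (m' - m) * G 0 + m * G m' - m' * G m =
    - ((m' - m) * (G h - G 0)) + h * (G m' - G m).
    by rewrite -[RHS]addr0 -[X in _ = _ + X]A; ring.
  apply: (le_trans (ler_normD _ _)); rewrite normrN !normrM.
  rewrite (ger0_norm (_ : 0 <= m' - m)) ?subr_ge0 ?(ltW mm)// (gtr0_norm h0).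
  rewrite [leRHS]mulrDl [leLHS]addrC; apply: lerD.
    rewrite mulrC; apply: ler_pM => //; [exact: ltW|exact: ler_normB|exact: ltW].
  by apply: ler_pM => //; rewrite ?subr_ge0 ?(ltW mm)// gerBl ltW.
have Gaff a : 0 <= a < c -> G a = G 0 + a * ((G (c / 2) - G 0) / (c / 2)).
  have c2 : 0 < c / 2 by rewrite divr_gt0.
  have c2c : c / 2 < c by lra.
  move=> /andP[]; rewrite le_eqVlt => /predU1P[<- _|a0 ac]; first by rewrite mul0r addr0.
  have [ac2|ac2|->] := ltgtP a (c / 2).
  - have := Gaff0 a _ (c / 2); rewrite a0 ac ac2 c2c => /(_ isT isT) A.
    by apply: (mulfI (lt0r_neq0 c2)); rewrite -A; field; rewrite gt_eqF.
  - have := Gaff0 (c / 2) _ a; rewrite c2 c2c ac2 ac => /(_ isT isT) A.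
    apply: (mulfI (lt0r_neq0 c2)); apply: (addrI ((a - c / 2) * G 0)); rewrite A.
    by field; rewrite gt_eqF.
  - by field; rewrite gt_eqF.
set P := (G (c / 2) - G 0) / (c / 2) in Gaff.
(* The slope of [G] is the constant of integration, with the opposite sign. *)
exists (- P) => a ac; have /andP[a0 ac'] := ac => eta eta0.
have eta2 : 0 < eta / 2 by rewrite divr_gt0.
have iqB : integ c (fun x => q x * B) by apply: integMc => // x; exact: cvg_cst.
have [d1 d10 Hd1] := II_small iqB eta2.
have eta3 : 0 < eta / 2 / (2 * `|e| + 1) by rewrite divr_gt0// ltr_pwDr.
have [d2 d20 Hd2] := continuous_eps a cb1 eta3.
exists (Num.min (c - a) (Num.min d1 d2)); first by rewrite !lt_min subr_gt0 ac' d10 d20.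
move=> h /andP[h0]; rewrite !lt_min => /and3P[hca hd1 hd2].
have GE := G_increment a (ltW h0).
have ahc : 0 <= a + h < c by rewrite addr_ge0 ?(ltW h0)//= -ltrBrDl.
rewrite (Gaff _ ac) (Gaff _ ahc) in GE.
have bS : bmeas c (fun x => (a < x)%R%:R * (x <= a + h)%R%:R).
  by apply: bmeasM; [exact: bmeas_ltr|exact: bmeas_ler].
have mass : II c (fun x => (a < x)%R%:R * (x <= a + h)%R%:R) = h.
  rewrite /II (_ : (fun x => _) = \1_(`]a, a + h] : set R)); last first.
    apply/funext => x; rewrite indicE mem_setE in_itv /=.
    by case: (a < x); case: (x <= a + h); rewrite ?mulr1 ?mulr0.
  rewrite /Rintegral integral_indic//.
  rewrite (_ : (_ `&` _)%classic = [set` `]a, (a + h)]]); last first.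
    apply/seteqP; split => [x []//|x /=]; rewrite !in_itv /= => /andP[ax xh].
    split; first by rewrite ax.
    by rewrite (le_lt_trans a0 ax) (le_lt_trans xh) // -ltrBrDl.
  have : lebesgue_measure [set` `]a, a + h]] = h%:E.
    by rewrite lebesgue_measure_itv /= lte_fin ltrDl h0 -EFinD addrAC subrr add0r.
  by move=> H; exact: (congr1 fine H).
have T1 : `|II c (fun x => q x * ((pos a x - pos (a + h) x) * b x)) -
     h * II c (fun x => q x * ((a < x)%R%:R * b x))| <= eta / 2 * h.
  have i1 : integ c (fun x => q x * ((pos a x - pos (a + h) x) * b x)).
    apply: integMc => // x; apply: cvgM; last exact: cb.
    by apply: cvgB; exact: cpos.
  have i2 : integ c (fun x => q x * ((a < x)%R%:R * b x)).
    by apply: integM => //; apply: bmeasM; [exact: bmeas_ltr|exact: bmeas_continuous].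
  rewrite -IIZ// -IIB//; last exact: integZ.
  have i3 : integ c (fun x => `|q x * B| * ((a < x)%R%:R * (x <= a + h)%R%:R)).
    by apply: integM => //; exact: integ_norm.
  apply: (@le_trans _ _ (h * II c (fun x => `|q x * B| * ((a < x)%R%:R * (x <= a + h)%R%:R)))).
    rewrite -IIZ//; apply: norm_II; [by apply: integB => //; exact: integZ|exact: integZ|].
    move=> x /andP[x0 xc].
    have -> : q x * ((pos a x - pos (a + h) x) * b x) - h * (q x * ((a < x)%R%:R * b x)) =
      q x * b x * (pos a x - pos (a + h) x - h * (a < x)%R%:R) by ring.
    rewrite normrM mulrCA; have [] := pos_diff a x (ltW h0) => H _.
    apply: ler_pM => //; rewrite !normrM ler_wpM2l// (ger0_norm B0).
    by apply: HB; rewrite !ltW.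
  by rewrite mulrC ler_wpM2r ?(ltW h0)// ltW// Hd1// (ltW h0).
have T2 : `|II c (fun x => (a < x)%R%:R * (x <= a + h)%R%:R * b1 x) - h * b1 a| <=
    eta / 2 / (2 * `|e| + 1) * h.
  have i1 : integ c (fun x => (a < x)%R%:R * (x <= a + h)%R%:R * b1 x).
    by apply: integ_bmeas; apply: bmeasM => //; exact: bmeas_continuous.
  have i2 := integ_bmeas bS.
  rewrite -[h in X in _ - X]mass -[X in _ <= _ * X]mass mulrC -IIZ// -IIB//; last exact: integZ.
  rewrite -IIZ//; apply: norm_II; [by apply: integB => //; exact: integZ|exact: integZ|].
  move=> x _.
  have -> : (a < x)%R%:R * (x <= a + h)%R%:R * b1 x - b1 a * ((a < x)%R%:R * (x <= a + h)%R%:R) =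
    (b1 x - b1 a) * ((a < x)%R%:R * (x <= a + h)%R%:R) by ring.
  have [ax|_] := ltP a x; last by rewrite mul0r !mulr0 normr0.
  have [hx|_] := leP x (a + h); last by rewrite mulr0 !mulr0 normr0.
  rewrite !mulr1; apply: Hd2; rewrite gtr0_norm ?subr_gt0//.
  by apply: le_lt_trans hd2; rewrite lerBlDl.
move: GE T1 T2; set X1 := II c _; set X2 := II c _; set X3 := II c _ => GE T1 T2.
have bE : b (a + h) - b a = - X1 + 2 * e * X2 - h * P by lra.
have -> : b (a + h) - b a - h * (2 * e * b1 a + - P - X3) =
   - (X1 - h * X3) + 2 * e * (X2 - h * b1 a) by rewrite bE; ring.
apply: (le_trans (ler_normD _ _)); rewrite normrN.
have -> : eta * h = eta / 2 * h + eta / 2 * h by field.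
apply: lerD => //; rewrite !normrM (ger0_norm (ler0n _ 2)).
apply: (@le_trans _ _ (2 * `|e| * (eta / 2 / (2 * `|e| + 1) * h))).
  by rewrite ler_wpM2l// mulr_ge0.
have e1 : 0 < 2 * `|e| + 1 by rewrite ltr_pwDr// mulr_ge0.
rewrite mulrA ler_wpM2r ?(ltW h0)// mulrA ler_pdivrMr// mulrC ler_wpM2l ?(ltW eta2)//.
by rewrite lerDl.
Qed.

End Limit.

End WeakToClassical.

Section RightDerivative.
Context {R : realType}.
Implicit Types b : R -> R.

Lemma continuous_ext (T : topologicalType) (f g : T -> R) : f =1 g -> continuous f -> continuous g.
Proof. by move=> /funext ->. Qed.

Lemma is_derive_ext (f g : R -> R) (x d d' : R) : f =1 g -> d = d' ->
  is_derive x 1 f d -> is_derive x 1 g d'.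
Proof. by move=> /funext -> ->. Qed.

Lemma continuous_pair_epsE (F : R -> R -> R) :
  continuous (fun p : R * R => F p.1 p.2) ->
  forall x0 s0 e, 0 < e -> exists2 d, 0 < d & forall x s,
     `|x - x0| < d -> `|s - s0| < d -> `|F x s - F x0 s0| <= e.
Proof.
move=> cF x0 s0 e e0.
have cF0 : F p.1 p.2 @[p --> (x0, s0)] --> F x0 s0 := cF (x0, s0).
move/cvgrPdist_le : cF0 => /(_ _ e0)[[A1 A2] /= [[d1 /= d10 Hd1] [d2 /= d20 Hd2]] HA].
exists (Num.min d1 d2); first by rewrite lt_min d10.
move=> y t; rewrite !lt_min => /andP[yd _] /andP[_ td].
rewrite distrC; apply: (HA (y, t)); split => /=.
  by apply: Hd1; rewrite /ball_ /= distrC.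
by apply: Hd2; rewrite /ball_ /= distrC.
Qed.

Lemma right_derivative_unique b a d d' :
  right_derivative b a d -> right_derivative b a d' -> d = d'.
Proof.
move=> H H'; apply/eqP; rewrite -subr_eq0; apply/eqP; apply: (@le_eps0 _ _ 2) => e e0.
have [r r0 Hr] := H e e0; have [r' r'0 Hr'] := H' e e0.
pose h := Num.min r r' / 2.
have m0 : 0 < Num.min r r' by rewrite lt_min r0.
have h0 : 0 < h by rewrite divr_gt0.
have : h < Num.min r r' by rewrite /h; lra.
rewrite lt_min => /andP[hr hr']; clearbody h.
have := Hr h; rewrite h0 hr => /(_ isT) A; have := Hr' h; rewrite h0 hr' => /(_ isT) A'.
rewrite -(ler_pM2r h0) -[X in _ * X <= _](gtr0_norm h0) -normrM.
have -> : (d - d') * h = (b (a + h) - b a - h * d') - (b (a + h) - b a - h * d) by ring.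
by apply: (le_trans (ler_normB _ _)); lra.
Qed.

Lemma right_derivative_ext b b' a d : (forall x, a <= x -> b x = b' x) ->
  right_derivative b a d -> right_derivative b' a d.
Proof.
move=> bb' H e /H[r r0 Hr]; exists r => // h hr; have /andP[h0 _] := hr.
by rewrite -!bb' ?lexx ?lerDl ?(ltW h0)//; exact: Hr.
Qed.

Lemma right_derivative_cst (k a : R) : right_derivative (fun=> k) a 0.
Proof.
move=> e e0; exists 1 => // h /andP[h0 _].
by rewrite subrr mulr0 subr0 normr0 mulr_ge0 ?ltW.
Qed.

Lemma II_potential (q f : R -> R) c : potential q -> bmeas c f -> 1 <= c ->
  II c (fun x => q x * f x) = II 1 (fun x => q x * f x).
Proof.
move=> pq bf; rewrite le_eqVlt => /predU1P[<-//|c1].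
have iq := integM (integ_potential c pq) bf.
have B : lebesgue_measure.-integrable [set` `]0, 1]] (EFin \o (fun x => q x * f x)).
  by apply: (integrableS _ _ _ iq) => //; apply: subset_itvl; rewrite bnd_simp.
have := @Rintegral_itvB R (fun x => q x * f x) (BRight 0) (BLeft c) 1 iq.
rewrite !bnd_simp ler01 c1 => /(_ isT isT).
rewrite [X in _ = X -> _](_ : _ = 0); last first.
  rewrite (_ : \int[_]_(x in _) _ = \int[lebesgue_measure]_(x in `]1, c[) cst 0 x).
    by rewrite Rintegral_cst//= mul0r.
  apply: eq_Rintegral => x; rewrite inE /= in_itv /= => /andP[x1 _].
  by rewrite pq.2// mul0r.
move=> /eqP; rewrite subr_eq0 => /eqP; rewrite -/(II c _) => ->.
rewrite -Rintegral_itv_bndo_bndc// /II.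
by apply: (integrableS _ _ _ B) => //; apply: subset_itvl; rewrite bnd_simp.
Qed.

End RightDerivative.

(** * Riemann invariants, causality and finite speed of propagation *)

Section Characteristics.
Context {R : realType}.
Variables (q : R -> R) (u : R -> (R -> R) -> R).
Hypotheses (pq : potential q) (du : distribution_path u) (wq : wave_equation q u).

Lemma pairing_translate psi (t x s : R) :
  pairing u (translate psi t) x s = pairing u psi x (s + t).
Proof. by rewrite /pairing; congr (u _ _); apply/funext => y; rewrite /translate addrA. Qed.

Lemma continuous_pairing_line psi a b (t e : R) : smooth1 psi -> vanishes_off a b psi ->
  continuous (fun x : R => pairing u psi x (t + e * x)).
Proof.
move=> sp p0; apply: (@continuous_comp2 R R (pairing u psi) id (fun x => t + e * x)).
- exact: pairing_continuous p0.
- by move=> x; exact: cvg_id.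
- by move=> x; apply: cvgD; [exact: cvg_cst|apply: cvgMr; exact: cvg_id].
Qed.

Section OneTestFunction.
Variables (psi : R -> R) (lo hi : R).
Hypotheses (sp : smooth1 psi) (p0 : vanishes_off lo hi psi).

Let z := pairing u psi.
Let zs := pairing u (derive1 psi).

Let cz : continuous (fun p : R * R => z p.1 p.2).
Proof. exact: pairing_continuous p0. Qed.

Let czs : continuous (fun p : R * R => zs p.1 p.2).
Proof. exact: (pairing_continuous du (smooth_derive1 sp) (vanishes_off_derive1 p0)). Qed.

Let dz x (s : R) : is_derive s 1 (z x) (zs x s).
Proof. exact: pairing_derive p0. Qed.

Let line_derivative (e t : R) : e ^+ 2 = 1 -> exists B, forall a, 0 <= a ->
  right_derivative (fun x => z x (t + e * x)) a
    (2 * e * zs a (t + e * a) + B - II 1 (fun x => q x * ((a < x)%R%:R * z x (t + e * x)))).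
Proof.
move=> e2; pose b x := z x (t + e * x); pose b1 x := zs x (t + e * x).
have cb : continuous b by exact: continuous_pairing_line p0.
have cb1 : continuous b1.
  exact: (@continuous_pairing_line _ lo hi t e (smooth_derive1 sp) (vanishes_off_derive1 p0)).
have weak c chi al be : smooth1 chi -> vanishes_off al be chi -> 0 < al -> be < c ->
  II c (fun x => q x * (chi x * b x) - derive1 (derive1 chi) x * b x -
                 2 * e * (derive1 chi x * b1 x)) = 0.
  move=> sc c0 al0 bc.
  have := wave_equation_characteristic du wq (smooth_translate t sp)
    (vanishes_off_translate p0 (lexx `|t|)) sc c0 al0 bc e2.
  have -> : derive1 (translate psi t) = translate (derive1 psi) t.
    exact: derive1_shiftr.
  move=> <-; apply: eq_II => x _.
  by rewrite /b /b1 /z /zs !pairing_translate ![e * x + t]addrC.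
have step c : 1 <= c -> exists Q, forall a, 0 <= a < c -> right_derivative b a
    (2 * e * b1 a + Q - II 1 (fun x => q x * ((a < x)%R%:R * b x))).
  move=> c1; have c0 : 0 < c by exact: lt_le_trans c1.
  have [Q HQ] := weak_right_derivative c0 (integ_potential c pq) cb cb1 (weak c).
  exists Q => a /HQ; rewrite II_potential//.
  by apply: bmeasM; [exact: bmeas_ltr|exact: bmeas_continuous].
(* The constants obtained for different [c] coincide, since each is determined by the right
   derivative at 0. *)
have [B HB] := step 1 (lexx _).
exists B => a a0; have [|Q HQ] := step (a + 1); first by rewrite lerDr.
suff -> : B = Q by apply: HQ; rewrite a0 ltrDl ltr01.
have H1 : 0 <= (0 : R) < 1 by rewrite lexx ltr01.
have H2 : 0 <= (0 : R) < a + 1 by rewrite lexx ltr_wpDl.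
by have := right_derivative_unique (HB 0 H1) (HQ 0 H2); lra.
Qed.

(** The Riemann invariant z_x - e z_s. For x >= 1 the integral vanishes and [B] gives the invariant
    as a function of the characteristic s - e x alone. *)
Let V (B : R -> R) (e x s : R) :=
  B (s - e * x) - II 1 (fun y => q y * ((x < y)%R%:R * z y (s + e * (y - x)))).

Let exB (e : R) : e ^+ 2 = 1 -> exists B : R -> R, forall x s, 0 <= x ->
  right_derivative (fun x => z x s) x (e * zs x s + V B e x s).
Proof.
move=> e2; have [B HB] := choice (fun t => @line_derivative e t e2).
exists B => x s x0; have {HB} := HB (s - e * x) x x0.
rewrite subrK => H eta eta0.
have eta2 : 0 < eta / 2 by rewrite divr_gt0.
have [r r0 Hr] := H _ eta2.
have [d d0 Hd] : exists2 d, 0 < d & forall y t, `|y - x| < d -> `|t - s| < d ->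
    `|zs y t - zs x s| <= eta / 2.
  exact: continuous_pair_epsE czs _ _ _ eta2.
exists (Num.min r d); first by rewrite lt_min r0.
move=> h /andP[h0]; rewrite lt_min => /andP[hr hd].
have {Hr} := Hr h; rewrite h0 hr => /(_ isT) A.
have e1 : `|e| = 1 by apply/eqP; rewrite -sqrp_eq1// real_normK ?num_real// e2.
(* The increment along the characteristic and the one at fixed s differ by a displacement in s
   alone. *)
have T : `|z (x + h) (s + e * h) - z (x + h) s - e * h * zs x s| <= eta / 2 * h.
  pose f t := z (x + h) (s + t) - t * zs x s.
  have df (t : R) : is_derive t 1 f (zs (x + h) (s + t) - zs x s).
    have d1 : is_derive t 1 (fun t => z (x + h) (s + t)) (zs (x + h) (s + t)).
      apply: (is_derive_ext _ _ (@is_derive_shiftr R (z (x + h)) s t _ (dz _ _))).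
        by move=> y; rewrite (addrC s).
      by rewrite (addrC s).
    have d2 : is_derive t 1 (fun y : R => y * zs x s) (zs x s).
      have := @is_deriveM _ _ id (cst (zs x s)) t 1 1 0 (is_derive_id _ _) (is_derive_cst _ _ _).
      by rewrite /GRing.scale /= mulr0 add0r mulr1.
    exact: is_deriveB.
  have bnd t : `|t| <= h -> `|zs (x + h) (s + t) - zs x s| <= eta / 2.
    move=> th; apply: Hd; first by rewrite addrAC subrr add0r gtr0_norm.
    by rewrite addrAC subrr add0r (le_lt_trans th).
  have -> : z (x + h) (s + e * h) - z (x + h) s - e * h * zs x s = f (e * h) - f 0.
    by rewrite /f addr0 mul0r subr0; ring.
  have [e_ge0|e_lt0] := leP 0 e.
    have eE : e = 1 by rewrite -[e]ger0_norm.
    rewrite eE mul1r; have := @MVT_bound R f _ 0 h (eta / 2) (ltW h0) (fun t _ => df t).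
    by rewrite subr0; apply=> t /andP[t0 th]; apply: bnd; rewrite ger0_norm.
  have eE : e = -1 by apply: oppr_inj; rewrite opprK -[- e]ltr0_norm.
  rewrite eE mulN1r distrC; have nh : - h <= 0 by rewrite oppr_le0 ltW.
  have := @MVT_bound R f _ (- h) 0 (eta / 2) nh (fun t _ => df t).
  by rewrite sub0r opprK; apply=> t /andP[th t0]; apply: bnd; rewrite ler0_norm// lerNl.
move: A; set W := II 1 _ => A.
have WE : W = II 1 (fun y => q y * ((x < y)%R%:R * z y (s + e * (y - x)))).
  by apply: eq_II => y _; congr (_ * (_ * z _ _)); ring.
rewrite /V -WE (_ : s - e * x + e * (x + h) = s + e * h) in A *; last by ring.
have -> : z (x + h) s - z x s - h * (e * zs x s + (B (s - e * x) - W)) =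
   (z (x + h) (s + e * h) - z x s - h * (2 * e * zs x s + B (s - e * x) - W)) -
   (z (x + h) (s + e * h) - z (x + h) s - e * h * zs x s) by ring.
apply: (le_trans (ler_normB _ _)).
have -> : eta * h = eta / 2 * h + eta / 2 * h by field.
by apply: lerD => //; move: A; rewrite (_ : s - e * x + e * x = s) ?subrK.
Qed.

Hypothesis cu : causal u.

Lemma pairing_causal x s : hi < s -> z x s = 0.
Proof.
move=> hs; rewrite /z /pairing; apply: (cu (x := Num.max x 0)).
  by rewrite le_max lexx orbT.
apply: (test_function_intro (smooth_translate s sp) (@vanishes_off_shiftr R _ _ _ s p0)).
move=> t; rewrite /= !in_itv /= => /andP[_]; move/le_lt_trans; apply.
by rewrite subr_lt0.
Qed.

Let zs_causal x s : hi < s -> zs x s = 0.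
Proof.
move=> hs; rewrite /zs /pairing; apply: (cu (x := Num.max x 0)).
  by rewrite le_max lexx orbT.
apply: (test_function_intro (smooth_translate s (smooth_derive1 sp))
  (@vanishes_off_shiftr R _ _ _ s (vanishes_off_derive1 p0))).
move=> t; rewrite /= !in_itv /= => /andP[_]; move/le_lt_trans; apply.
by rewrite subr_lt0.
Qed.

Let bz (e x s : R) c : bmeas c (fun y => (x < y)%R%:R * z y (s + e * (y - x))).
Proof.
apply: bmeasM; first exact: bmeas_ltr.
apply: bmeas_continuous.
have := @continuous_pairing_line _ lo hi (s - e * x) e sp p0.
by apply: continuous_ext => y; congr (pairing _ _ _ _); ring.
Qed.

Let Iplus x s := II 1 (fun y => q y * ((x < y)%R%:R * z y (s + (y - x)))).
Let Iminus x s := II 1 (fun y => q y * ((x < y)%R%:R * z y (s - (y - x)))).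

(* The incoming Riemann invariant vanishes to the right of the support of q, which
   is how causality enters; it turns the value on x = 1 into Cauchy data there. *)
Lemma sideways_equations : (forall x s, 0 <= x ->
    2 * zs x s = 2 * zs 1 (s + x - 1) - Iminus x s + Iplus x s) /\
  (forall x s, 0 <= x -> right_derivative (fun x => z x s) x
     (zs 1 (s + x - 1) - (Iminus x s + Iplus x s) / 2)) /\
  (forall s, hi < s -> 2 * zs 1 (s - 1) = Iminus 0 s).
Proof.
have e1 : (1 : R) ^+ 2 = 1 by rewrite expr1n.
have em1 : (-1 : R) ^+ 2 = 1 by rewrite sqrrN expr1n.
have [Bp HBp] := exB e1; have [Bm HBm] := exB em1.
have VpE x s : V Bp 1 x s = Bp (s - x) - Iplus x s.
  by rewrite /V mul1r; congr (_ - _); apply: eq_II => y _; rewrite mul1r.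
have VmE x s : V Bm (-1) x s = Bm (s + x) - Iminus x s.
  rewrite /V mulN1r opprK; congr (_ - _); apply: eq_II => y _.
  by rewrite mulN1r.
have Hp x s : 0 <= x -> right_derivative (fun x => z x s) x (zs x s + (Bp (s - x) - Iplus x s)).
  by move=> /(HBp x s); rewrite VpE mul1r.
have Hm x s : 0 <= x -> right_derivative (fun x => z x s) x (- zs x s + (Bm (s + x) - Iminus x s)).
  by move=> /(HBm x s); rewrite VmE mulN1r.
have E x s : 0 <= x -> 2 * zs x s = (Bm (s + x) - Iminus x s) - (Bp (s - x) - Iplus x s).
  by move=> x0; have := right_derivative_unique (Hp x s x0) (Hm x s x0); lra.
(* For s > hi the translated test function lives in t < 0, so z, z_s and z_x all vanish, and so do
   both invariants. *)
have V0 x s : 0 <= x -> hi < s -> Bp (s - x) - Iplus x s = 0 /\ Bm (s + x) - Iminus x s = 0.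
  move=> x0 hs; have zs0 := zs_causal x hs.
  have D0 : right_derivative (fun x => z x s) x 0.
    apply: (right_derivative_ext _ (right_derivative_cst 0 x)) => y _.
    by rewrite pairing_causal.
  have := right_derivative_unique (Hp x s x0) D0; have := right_derivative_unique (Hm x s x0) D0.
  by rewrite zs0 oppr0 !add0r.
have I0 x s : 1 <= x -> Iplus x s = 0 /\ Iminus x s = 0.
  move=> x1; have H (w : R -> R) : II 1 (fun y => q y * ((x < y)%R%:R * w y)) = 0.
    rewrite (eq_II (g := fun=> 0)) ?II_cst ?mul0r// => y /andP[_ y1].
    by rewrite ltNge (le_trans (ltW y1) x1) mul0r mulr0.
  by split; exact: H.
have Bp0 t : Bp t = 0.
  (* The characteristic s - x = t runs to large s beyond the support of q, where causality applies.
     The other family, s + x = t, runs to small s, and so [Bm] survives. *)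
  pose x := 1 + `|hi - t|; have x1 : 1 <= x by rewrite lerDl.
  have := V0 x (t + x) (le_trans ler01 x1) _; have [-> _] := I0 x (t + x) x1.
  rewrite addrK subr0; case=> //; rewrite -ltrBlDl /x.
  by have := ler_norm (hi - t); lra.
have BmE t : Bm t = 2 * zs 1 (t - 1).
  have [Ip Im] := I0 1 (t - 1) (lexx _).
  by have := E 1 (t - 1) ler01; rewrite Ip Im Bp0 !subr0 subrK => ->.
split; [|split].
- by move=> x s x0; rewrite E// Bp0 BmE; ring.
- move=> x s x0; have := Hp x s x0; rewrite Bp0 sub0r.
  suff -> : zs x s + - Iplus x s = zs 1 (s + x - 1) - (Iminus x s + Iplus x s) / 2 by [].
  by have := E x s x0; rewrite Bp0 BmE; lra.
- by move=> s hs; have [_] := V0 0 s (lexx _) hs; rewrite addr0 BmE => /subr0_eq.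
Qed.

Let domain x s := 0 <= x <= 1 /\ hi < x + s.

(** For x + s > hi the third sideways equation eliminates the trace at x = 1, leaving an integral of
    q z over the two characteristic arcs issuing from (x, s). They stay in the domain at values of s
    that are no smaller, where the decreasing weight is no larger. *)
Let zs_domain_bound (K lam s0 : R) n : 0 < lam ->
  (forall x s, domain x s -> s0 <= s -> `|z x s| <= K * quarter n * expR (- (lam * s))) ->
  forall x s, domain x s -> s0 <= s ->
  2 * `|zs x s| <= II 1 (fun y => `|q y|) * (K * quarter n * expR (- (lam * s))).
Proof.
move=> lam0 Hz x s [/andP[x0 x1] hs] s0s.
have [H1 [_ H2]] := sideways_equations.
pose w y := (y <= x)%R%:R * z y (s + x - y) + (x < y)%R%:R * z y (s + (y - x)).
have cl (t e : R) : continuous (fun y => z y (t + e * y)).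
  exact: (@continuous_pairing_line _ lo hi t e sp p0).
have c1 : continuous (fun y => z y (s + x - y)).
  by apply: (continuous_ext _ (cl (s + x) (-1))) => y; rewrite mulN1r.
have c2 : continuous (fun y => z y (s + (y - x))).
  by apply: (continuous_ext _ (cl (s - x) 1)) => y; congr (z _ _); ring.
have bw : bmeas 1 w.
  have b1 : bmeas 1 (fun y => (y <= x)%R%:R * z y (s + x - y)).
    by apply: bmeasM; [exact: bmeas_ler|exact: bmeas_continuous].
  have b2 : bmeas 1 (fun y => (x < y)%R%:R * z y (s + (y - x))).
    by apply: bmeasM; [exact: bmeas_ltr|exact: bmeas_continuous].
  case: b1 b2 => m1 [M1 HM1] [m2 [M2 HM2]]; split; first exact: measurable_funD.
  exists (M1 + M2) => y yc; apply: (le_trans (ler_normD _ _)).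
  by apply: lerD; [exact: HM1|exact: HM2].
have iq := integ_potential 1 pq.
have zsE : 2 * zs x s = II 1 (fun y => q y * w y).
  have ip : integ 1 (fun y => q y * ((x < y)%R%:R * z y (s + (y - x)))).
    by apply: integM => //; apply: bmeasM; [exact: bmeas_ltr|exact: bmeas_continuous].
  have im : integ 1 (fun y => q y * ((x < y)%R%:R * z y (s + x - y))).
    by apply: integM => //; apply: bmeasM; [exact: bmeas_ltr|exact: bmeas_continuous].
  have i0 : integ 1 (fun y => q y * z y (s + x - y)) by exact: integMc.
  have -> : 2 * zs x s = II 1 (fun y => q y * z y (s + x - y)) -
      II 1 (fun y => q y * ((x < y)%R%:R * z y (s + x - y))) + Iplus x s.
    rewrite (H1 x s x0) (H2 (s + x)); last by rewrite addrC.
    congr (_ - _ + _).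
      by apply: eq_II => y /andP[y0 _]; rewrite y0 mul1r subr0.
    by apply: eq_II => y _; congr (_ * (_ * z _ _)); ring.
  rewrite -IIB// -IID//; last exact: integB.
  apply: eq_II => y _; rewrite /w; case: leP => _; rewrite !(mul0r, mulr0, mul1r); ring.
have -> : 2 * `|zs x s| = `|2 * zs x s| by rewrite normrM ger0_norm.
rewrite zsE.
rewrite [leRHS]mulrC.
apply: norm_IIM => // y /andP[y0 y1].
have key t : domain y t -> s <= t -> `|z y t| <= K * quarter n * expR (- (lam * s)).
  move=> dt st; apply: (le_trans (Hz y t dt (le_trans s0s st))).
  have := le_trans (normr_ge0 _) (Hz y t dt (le_trans s0s st)).
  rewrite pmulr_lge0 ?expR_gt0// => KQ.
  by rewrite ler_wpM2l// ler_expR lerN2 ler_pM2l.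
rewrite /w; have [yx|xy] := leP y x.
  rewrite mul1r mul0r addr0; apply: key; last by rewrite -addrA lerDl subr_ge0.
  by split; [rewrite !ltW|rewrite addrC subrK addrC].
rewrite mul0r mul1r add0r; apply: key; last by rewrite lerDl subr_ge0 ltW.
by split; [rewrite !ltW|lra].
Qed.

(** Nothing reaches depth x before time x. Integrating the bound on z_s from large s, where
    causality gives 0, gains a factor 4 at each round. *)
Lemma finite_speed x s : 0 <= x <= 1 -> hi < x + s -> z x s = 0.
Proof.
move=> x01 hs.
set Q := II 1 (fun y => `|q y|); have Q0 : 0 <= Q by exact: II_ge0.
(* One round multiplies the bound by Q / (2 lam), which is below 1/4 for this choice. *)
pose lam := 2 * Q + 1; have lam0 : 0 < lam by rewrite /lam ltr_wpDl// mulr_ge0.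
have [M HM] := @pairing_bounded R u psi lo hi 1 (`|s| + `|hi|) du sp p0.
have M0 : 0 <= M.
  by apply: (le_trans (normr_ge0 (pairing u psi 0 0))); apply: HM; rewrite ?normr0 ?addr_ge0.
pose K := M * expR (lam * hi).
have claim n x' s' : domain x' s' -> s <= s' -> `|z x' s'| <= K * quarter n * expR (- (lam * s')).
  elim: n x' s' => [|n IH] x' s' ds ss'.
    have [his|shi] := ltP hi s'.
      by rewrite pairing_causal// normr0 !mulr_ge0 ?expR_ge0// ltW ?quarter_gt0.
    rewrite /quarter expr0 mulr1 /K -mulrA -expRD.
    apply: (@le_trans _ _ M).
      apply: HM; first by have [/andP[]] := ds.
      have := ler_norm hi; have := ler_norm (- s); rewrite normrN ler_norml => h1 h2.
      by have := normr_ge0 s; have := normr_ge0 hi; lra.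
    rewrite ler_peMr// -expR0 ler_expR -mulrBr mulr_ge0 ?(ltW lam0)// subr_ge0//.
  pose c := K * quarter n / 4.
  have K0 : 0 <= K by rewrite mulr_ge0 ?expR_ge0.
  have c0 : 0 <= c by rewrite divr_ge0// mulr_ge0// ltW// quarter_gt0.
  have dE (t : R) : is_derive t 1 (fun t => c * expR (- (lam * t))) (- (c * lam * expR (- (lam * t)))).
    have d1 := @is_derive_affine R expR (- lam) 0 t _ (is_derive_expR _).
    apply: (is_derive_ext _ _ (is_deriveZ c d1)).
      by move=> y; rewrite /GRing.scale /= addr0 mulNr.
    by rewrite /GRing.scale /= addr0 !mulNr mulrN mulrA.
  (* At [t1] causality gives 0, and c e^(- lam t) plus or minus z is nonincreasing between s' and
     [t1]; this bounds z at s'. *)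
  pose t1 := Num.max s' hi + 1.
  have st1 : s' <= t1 by rewrite (@le_trans _ _ (Num.max s' hi)) ?le_max ?lexx// lerDl.
  have ht1 : hi < t1 by rewrite ltr_pwDr// le_max lexx orbT.
  have zt1 : z x' t1 = 0 by exact: pairing_causal.
  have bnd t : s' <= t <= t1 -> `|zs x' t| <= c * lam * expR (- (lam * t)).
    move=> /andP[s't _]; have dt : domain x' t.
      by case: ds => x'01 h; split => //; apply: (lt_le_trans h); rewrite lerD2l.
    have := zs_domain_bound lam0 IH dt (le_trans ss' s't).
    rewrite -/Q /c; set E := expR _; have E0 : 0 <= E by exact: expR_ge0.
    have : Q * (K * quarter n * E) * 2 <= lam * (K * quarter n * E).
      by rewrite mulrC mulrA ler_wpM2r ?mulr_ge0// ?(ltW (quarter_gt0 _))// /lam lerDl.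
    rewrite (_ : K * quarter n / 4 * lam * E = lam * (K * quarter n * E) / 4); last by ring.
    by lra.
  have up : z x' s' <= c * expR (- (lam * s')).
    have := @MVT_upper R (fun t => c * expR (- (lam * t)) - z x' t)
      (fun t => - (c * lam * expR (- (lam * t))) - zs x' t) s' t1 0 st1.
    rewrite zt1 subr0 mul0r => H.
    have {}H : c * expR (- (lam * t1)) - (c * expR (- (lam * s')) - z x' s') <= 0.
      have dH (t : R) : is_derive t 1 (fun t => c * expR (- (lam * t)) - z x' t)
          (- (c * lam * expR (- (lam * t))) - zs x' t).
        exact: (@is_deriveB _ _ _ (fun t => c * expR (- (lam * t))) (z x') t 1 _ _ (dE t) (dz x' t)).
      by apply: H => t ht; have := bnd t ht; rewrite ler_norml => /andP[b1 b2]; lra.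
    have : 0 <= c * expR (- (lam * t1)) by rewrite mulr_ge0 ?expR_ge0.
    by lra.
  have dn : - (c * expR (- (lam * s'))) <= z x' s'.
    have := @MVT_upper R (fun t => c * expR (- (lam * t)) + z x' t)
      (fun t => - (c * lam * expR (- (lam * t))) + zs x' t) s' t1 0 st1.
    rewrite zt1 addr0 mul0r => H.
    have {}H : c * expR (- (lam * t1)) - (c * expR (- (lam * s')) + z x' s') <= 0.
      have dH (t : R) : is_derive t 1 (fun t => c * expR (- (lam * t)) + z x' t)
          (- (c * lam * expR (- (lam * t))) + zs x' t).
        exact: (@is_deriveD _ _ _ (fun t => c * expR (- (lam * t))) (z x') t 1 _ _ (dE t) (dz x' t)).
      by apply: H => t ht; have := bnd t ht; rewrite ler_norml => /andP[b1 b2]; lra.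
    have : 0 <= c * expR (- (lam * t1)) by rewrite mulr_ge0 ?expR_ge0.
    by lra.
  rewrite ler_norml (_ : K * quarter n.+1 = c) ?dn ?up//.
  by rewrite /c (quarterS n); field.
apply/eqP; rewrite -normr_le0; apply: (@le_quarter _ _ _ (K * expR (- (lam * s)))) => n.
by rewrite add0r mulrAC; apply: claim.
Qed.

End OneTestFunction.

End Characteristics.

(** * The trace at x = 1 and the boundary identity at x = 0 *)

Section TraceAtOne.
Context {R : realType}.

(** Data on t > 0 and causality on t < 0 would leave room for a part of the trace at t = 0. By
    finite speed the trace vanishes for t < 1, so psi may be cut between 1/3 and 2/3. *)
Lemma trace_at_one (q1 q2 : R -> R) (u1 u2 : R -> (R -> R) -> R) psi lo hi :
  potential q1 -> potential q2 ->
  distribution_path u1 -> distribution_path u2 ->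
  wave_equation q1 u1 -> wave_equation q2 u2 -> causal u1 -> causal u2 ->
  eq_distribution_on `]0, +oo[ (u1 1) (u2 1) ->
  smooth1 psi -> vanishes_off lo hi psi -> u1 1 psi = u2 1 psi.
Proof.
move=> pq1 pq2 du1 du2 wq1 wq2 cu1 cu2 u12 sp p0.
have [r [K [L [sr dK dL [_ _ K0 K1 _]]]]] := @smooth_ramp R.
have sK : smooth1 (fun x => K (3 * x + - 1)) by apply: smooth_affine; exact: smooth_antideriv dK sr.
pose f := fun x => (1 - K (3 * x + - 1)) * psi x; pose g := fun x => K (3 * x + - 1) * psi x.
have sf : smooth1 f.
  by apply: smoothM => //; apply: smoothD (smooth_cst 1) _; exact: smoothN.
have sg : smooth1 g by exact: smoothM.
have f0 : vanishes_off lo (2 / 3) f.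
  move=> x; rewrite negb_and -!ltNge => /orP[xlo|xhi]; last by rewrite /f K1 ?subrr ?mul0r//; lra.
  by rewrite /f p0 ?mulr0// negb_and -ltNge xlo.
have g0 : vanishes_off (1 / 3) hi g.
  move=> x; rewrite negb_and -!ltNge => /orP[xlo|xhi]; first by rewrite /g K0 ?mul0r//; lra.
  by rewrite /g p0 ?mulr0// negb_and -!ltNge xhi orbT.
have psiE : psi = fun t => 1 * f t + g t.
  by apply/funext => t; rewrite /f /g; ring.
have split_u u : distribution_path u -> u 1 psi = u 1 f + u 1 g.
  case=> d1 _; have [lin _] := d1 1 ler01.
  by rewrite psiE lin ?mul1r//; [exact: test_function_setT f0|exact: test_function_setT g0].
have uf0 q u : potential q -> distribution_path u -> wave_equation q u -> causal u -> u 1 f = 0.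
  move=> pq du wq cu; have x01 : (0 : R) <= (1 : R) <= 1 by rewrite ler01 lexx.
  have h1 : (2 / 3 : R) < 1 + 0 by clear; lra.
  have := finite_speed pq du wq sf f0 cu x01 h1.
  rewrite /pairing (max_idPl ler01) => <-; congr (u _ _).
  by apply/funext => t; rewrite /translate addr0.
rewrite !split_u// (uf0 q1)// (uf0 q2)//; congr (_ + _).
apply: u12; apply: (test_function_intro sg g0) => x /=; rewrite !in_itv /= andbT => /andP[+ _].
by apply: lt_le_trans; lra.
Qed.

(** The sign with which a wave is reflected at x = 0. *)
Definition parity (bc : boundary_type) : R := if bc is Neumann then 1 else - 1.

(** The identity below is written for psi'. The Dirichlet condition enters through z_s and costs one
    derivative more than the Neumann condition, which enters through z_x. *)
Definition boundary_source (bc : boundary_type) (psi : R -> R) : R -> R :=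
  if bc is Neumann then derive1 psi else derive1 (derive1 psi).

(** The sideways equations for z_s and z_x at x = 0 carry the same two integrals with different
    signs, which [parity] records. *)
Lemma boundary_identity bc (q : R -> R) (u : R -> (R -> R) -> R) psi lo hi s :
  potential q -> causal_solution bc q u -> smooth1 psi -> vanishes_off lo hi psi ->
  boundary_source bc psi s =
    pairing u (derive1 (derive1 psi)) 1 (s - 1) - parity bc *
    (II 1 (fun y => q y * (pairing u (derive1 psi) y (s + y) +
                           parity bc * pairing u (derive1 psi) y (s - y))) / 2).
Proof.
move=> pq [du wq cu bu] sp p0.
have sp1 := smooth_derive1 sp; have p1 := vanishes_off_derive1 p0.
have sp2 := smooth_derive1 sp1; have p2 := vanishes_off_derive1 p1.
have [H1 [H2 _]] := sideways_equations pq du wq sp1 p1 cu.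
have cz (e : R) : continuous (fun y => pairing u (derive1 psi) y (s + e * y)).
  exact: (@continuous_pairing_line _ u du (derive1 psi) lo hi s e sp1 p1).
have iq := integ_potential 1 pq.
have cp : continuous (fun y => pairing u (derive1 psi) y (s + y)).
  by apply: (continuous_ext _ (cz 1)) => y; rewrite mul1r.
have cm : continuous (fun y => pairing u (derive1 psi) y (s - y)).
  by apply: (continuous_ext _ (cz (-1))) => y; rewrite mulN1r.
have -> : II 1 (fun y => q y * (pairing u (derive1 psi) y (s + y) +
      parity bc * pairing u (derive1 psi) y (s - y))) =
    II 1 (fun y => q y * ((0 < y)%R%:R * pairing u (derive1 psi) y (s + (y - 0)))) +
    parity bc * II 1 (fun y => q y * ((0 < y)%R%:R * pairing u (derive1 psi) y (s - (y - 0)))).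
  rewrite -[X in _ = _ + parity bc * X](eq_II (f := fun y => q y * pairing u (derive1 psi) y (s - y))); last first.
    by move=> y /andP[y0 _]; rewrite y0 mul1r subr0.
  rewrite -[X in _ = X + _](eq_II (f := fun y => q y * pairing u (derive1 psi) y (s + y))); last first.
    by move=> y /andP[y0 _]; rewrite y0 mul1r subr0.
  rewrite -IIZ; last exact: integMc.
  rewrite -IID; [|exact: integMc|by apply: integZ; exact: integMc].
  by apply: eq_II => y _; ring.
case: bc bu => /= bu.
- have := H1 0 s (lexx _); rewrite addr0.
  have -> : pairing u (derive1 (derive1 psi)) 0 s = derive1 (derive1 psi) s.
    rewrite /pairing (max_idPl (lexx _)) bu /delta /translate ?add0r//.
    exact: (test_function_setT (smooth_translate s sp2) (vanishes_off_translate p2 (lexx `|s|))).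
  move: (II 1 _) (II 1 _) (pairing u _ 1 _) (derive1 _ s) => A B C D; lra.
- have D2 := H2 0 s (lexx _); rewrite addr0 in D2.
  have tf := test_function_setT (smooth_translate s sp1) (vanishes_off_translate p1 (lexx `|s|)).
  have D1 : right_derivative (fun x => pairing u (derive1 psi) x s) 0 (derive1 psi s).
    move=> e e0; have /cvgrPdist_le/(_ _ e0)[d /= d0 Hd] := bu _ tf.
    exists d => // h /andP[h0 hd].
    have := Hd h; rewrite /ball_ /= sub0r normrN gtr0_norm// => /(_ hd h0).
    rewrite /pairing !add0r (max_idPl (lexx _)) (max_idPl (ltW h0)) {1}/delta /translate add0r.
    rewrite -(ler_pM2r h0) -[X in _ * X <= _](gtr0_norm h0) -normrM distrC.
    by congr (`|_| <= _); field; rewrite gt_eqF.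
  rewrite (right_derivative_unique D1 D2).
  move: (II 1 _) (II 1 _) (pairing u _ 1 _) => A B C; lra.
Qed.

End TraceAtOne.

(** * Volterra equations on the light cone *)

Section JointContinuity.
Context {R : realType}.

Section Pointwise.
Context {T : topologicalType}.
Implicit Types f g : T -> R.

Lemma ctsD f g : continuous f -> continuous g -> continuous (fun z => f z + g z).
Proof. by move=> cf cg z; apply: cvgD; [exact: cf|exact: cg]. Qed.

Lemma ctsB f g : continuous f -> continuous g -> continuous (fun z => f z - g z).
Proof. by move=> cf cg z; apply: cvgB; [exact: cf|exact: cg]. Qed.

Lemma ctsM f g : continuous f -> continuous g -> continuous (fun z => f z * g z).
Proof. by move=> cf cg z; apply: cvgM; [exact: cf|exact: cg]. Qed.

Lemma cts_cst (k : R) : continuous (fun _ : T => k).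
Proof. by move=> z; exact: cvg_cst. Qed.

Lemma cts_max f g : continuous f -> continuous g -> continuous (fun z => Num.max (f z) (g z)).
Proof. by move=> cf cg z; apply: continuous_max; [exact: cf|exact: cg]. Qed.

Lemma cts_min f g : continuous f -> continuous g -> continuous (fun z => Num.min (f z) (g z)).
Proof. by move=> cf cg z; apply: continuous_min; [exact: cf|exact: cg]. Qed.

Lemma cts_norm f : continuous f -> continuous (fun z => `|f z|).
Proof. by move=> cf z; apply: cvg_norm; exact: cf. Qed.

End Pointwise.

Lemma cts_fst (T U : topologicalType) (f : T -> R) :
  continuous f -> continuous (fun z : T * U => f z.1).
Proof. by move=> cf z; apply: (@cvg_comp _ _ _ fst f _ _ _ _ (cf z.1)); exact: cvg_fst. Qed.

Lemma cts_snd (T U : topologicalType) (f : U -> R) :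
  continuous f -> continuous (fun z : T * U => f z.2).
Proof. by move=> cf z; apply: (@cvg_comp _ _ _ snd f _ _ _ _ (cf z.2)); exact: cvg_snd. Qed.

Lemma cts_id : continuous (fun x : R => x).
Proof. by move=> x; exact: cvg_id. Qed.

Lemma cts_comp (T : topologicalType) (f : T -> R) (g : R -> R) :
  continuous f -> continuous g -> continuous (fun z => g (f z)).
Proof. by move=> cf cg z; apply: (cvg_comp _ _ (cf z) (cg _)). Qed.

Lemma bounded_on_rectangle (X : R -> R -> R) K T :
  continuous (fun p : R * R => X p.1 p.2) ->
  exists2 M, 0 <= M & forall x t, `|x| <= K -> `|t| <= T -> `|X x t| <= M.
Proof.
move=> cX; have kA : compact ([set` `[- K, K]] `*` [set` `[- T, T]] : set (R * R)%type).
  by apply: compact_setX; exact: segment_compact.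
have [M [Mr HM]] := compact_bounded (continuous_compact (continuous_subspaceT cX) kA).
exists (`|M| + 1) => // x t xK tT; apply: (HM (`|M| + 1)).
  by rewrite ltr_pwDr// ler_norm.
by exists (x, t) => //=; split => /=; rewrite in_itv /= -ler_norml.
Qed.

End JointContinuity.

Section Volterra.
Context {R : realType}.
Variables (q : R -> R) (th : R).
Hypotheses (iq : integ 1 q) (th1 : `|th| = 1).
Implicit Types (X Y h : R -> R -> R) (eta : R -> R) (D : R -> R -> Prop).

Definition jointly X := continuous (fun p : R * R => X p.1 p.2).

(** [th] is 1 for propagation from 0 to the right and -1 for propagation from 1 to the left.
    Truncation at 0 removes the points beyond x while staying continuous, so the integration can run
    over all of ]0, 1[. *)
Definition reach (x y : R) : R := Num.max 0 (th * (x - y)).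

(* Half of the integral of X y over [t - r, t + r]. *)
Definition cone_mean X (y t r : R) : R := r * II 1 (fun v => X y (t - r + 2 * r * v)).

(** Duhamel's formula with x in the role of time: half the integral of q X over the cone with apex
    (x, t). Solutions of X = h + volterra X, with h a free wave, are those of X_xx - X_tt = q X in
    integrated form. *)
Definition volterra X (x t : R) : R := II 1 (fun y => q y * cone_mean X y t (reach x y)).

Lemma jointly_section X y : jointly X -> continuous (X y).
Proof.
move=> cX; apply: continuous_ext (@continuous_comp2 R R X (fun=> y) id cX (@cts_cst R R y) (@cts_id R)).
by [].
Qed.

Lemma cone_mean_continuous X : jointly X ->
  continuous (fun z : (R * R) * R => cone_mean X z.2 z.1.2 (reach z.1.1 z.2)).
Proof.
have cid := @cts_id R.
have c11 : continuous (fun z : (R * R) * R => z.1.1) by exact: (@cts_fst _ _ _ fst (@cts_fst _ _ _ id cid)).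
have c12 : continuous (fun z : (R * R) * R => z.1.2) by exact: (@cts_fst _ _ _ snd (@cts_snd _ _ _ id cid)).
have c2 : continuous (fun z : (R * R) * R => z.2) by exact: (@cts_snd _ _ _ id cid).
move=> cX; have cr : continuous (fun z : (R * R) * R => reach z.1.1 z.2).
  apply: cts_max; first exact: cts_cst.
  apply: ctsM; first exact: cts_cst.
  exact: ctsB.
apply: ctsM => //.
have := @II_continuous R _ 1 (fun=> 1) (fun (z : (R * R) * R) v =>
  X z.2 (z.1.2 - reach z.1.1 z.2 + 2 * reach z.1.1 z.2 * v)) (integ_bmeas (bmeas_cst 1 1)).
move=> H; apply: continuous_ext (H _).
  by move=> z; apply: eq_II => v _; rewrite mul1r.
apply: (continuous_comp2 cX); first exact: (cts_fst c2).
apply: ctsD.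
  by apply: ctsB; [exact: (cts_fst c12)|exact: (cts_fst cr)].
apply: ctsM; last exact: (@cts_snd _ _ _ id cid).
by apply: ctsM; [exact: cts_cst|exact: (cts_fst cr)].
Qed.

Lemma volterra_continuous X : jointly X -> jointly (volterra X).
Proof.
move=> cX; exact: (II_continuous (F := fun p y => cone_mean X y p.2 (reach p.1 y)) iq
  (cone_mean_continuous cX)).
Qed.

Lemma cone_mean_section X x t : jointly X -> continuous (fun y : R => cone_mean X y t (reach x y)).
Proof.
move=> cX y; have := cone_mean_continuous cX; move=> /(_ ((x, t), y)) H.
by apply: (@cvg_comp _ _ _ (fun y => ((x, t), y)) _ _ _ _ _ H); exact: cvg_pair (cvg_cst _) cvg_id.
Qed.

Lemma cone_mean_argument_continuous X (y t r : R) : jointly X ->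
  continuous (fun v : R => X y (t - r + 2 * r * v)).
Proof.
move=> cX; apply: (cts_comp _ (@jointly_section X y cX)).
apply: (@ctsD _ _ _ _ (@cts_cst R _ _)); apply: (@ctsM _ _ _ _ (@cts_cst R _ _)); exact: cts_id.
Qed.

Lemma jointlyDZ c X Y : jointly X -> jointly Y -> jointly (fun x t => c * X x t + Y x t).
Proof. by move=> cX cY; apply: ctsD cY; apply: ctsM cX; exact: cts_cst. Qed.

Lemma volterra_lincomb c X Y x t : jointly X -> jointly Y ->
  volterra (fun x t => c * X x t + Y x t) x t = c * volterra X x t + volterra Y x t.
Proof.
move=> cX cY; rewrite /volterra -IIZ; last exact: integMc iq (@cone_mean_section X x t cX).
rewrite -IID; [|by apply: integZ; exact: integMc iq (@cone_mean_section X x t cX)|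
  exact: integMc iq (@cone_mean_section Y x t cY)].
apply: eq_II => y _; rewrite /cone_mean IID; first rewrite IIZ; first by ring.
- exact: integ_continuous (@cone_mean_argument_continuous X _ _ _ cX).
- by apply: integZ; exact: integ_continuous (@cone_mean_argument_continuous X _ _ _ cX).
- exact: integ_continuous (@cone_mean_argument_continuous Y _ _ _ cY).
Qed.

Lemma volterra_shift X x t s : volterra (fun x t => X x (t + s)) x t = volterra X x (t + s).
Proof.
apply: eq_II => y _; congr (_ * (_ * _)); apply: eq_II => v _; congr (X _ _); ring.
Qed.

Lemma cone_mean_bound X y t r M : jointly X -> 0 <= r ->
  (0 < r -> forall v, `|v - t| <= r -> `|X y v| <= M) -> `|cone_mean X y t r| <= r * M.
Proof.
move=> cX; rewrite le_eqVlt => /predU1P[<- _|r0 /(_ r0) HM]; first by rewrite /cone_mean !mul0r normr0.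
rewrite /cone_mean normrM gtr0_norm// ler_pM2l//.
have := @norm_II R 1 (fun v => X y (t - r + 2 * r * v)) (fun=> M).
rewrite II_cst ?ler01// mulr1; apply.
- exact: integ_continuous (@cone_mean_argument_continuous X _ _ _ cX).
- exact/integ_bmeas/bmeas_cst.
- move=> v /andP[v0 v1]; apply: HM; rewrite ler_norml.
  have rv0 : 0 <= r * v by rewrite mulr_ge0 ?ltW.
  have rv1 : r * v <= r by rewrite ler_piMr ?ltW.
  by apply/andP; split; lra.
Qed.

Let Q := II 1 (fun y => `|q y|).
Let lam := 4 * Q + 1.
Let wt (x : R) := expR (lam * (th * x)).

Let Q0 : 0 <= Q. Proof. by apply: II_ge0 => y _. Qed.
Let lam0 : 0 < lam. Proof. by rewrite ltr_pwDr// mulr_ge0. Qed.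
Let wt0 x : 0 < wt x. Proof. exact: expR_gt0. Qed.

(** The points (y, v) are those at which [volterra X x t] reads X. *)
Definition past_closed D := forall x t y v,
  D x t -> 0 < y < 1 -> 0 < th * (x - y) -> `|v - t| <= th * (x - y) -> D y v.

(** From r <= e^(lam r) / lam and the multiplicativity of the weight the integral is at most M wt x
    Q / lam, and lam > 4 Q turns this into a factor 1/4. *)
Lemma volterra_bound D X M x t : past_closed D -> jointly X -> 0 <= M ->
  (forall y v, D y v -> `|X y v| <= M * wt y) -> D x t -> `|volterra X x t| <= M / 4 * wt x.
Proof.
move=> pD cX M0 HM dxt.
have H : `|volterra X x t| <= M * wt x / lam * Q.
  apply: norm_IIM => //; first exact: bmeas_continuous (@cone_mean_section X x t cX).
  move=> y y01; set r := reach x y.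
  have r0 : 0 <= r by rewrite le_max lexx.
  apply: (@le_trans _ _ (r * (M * wt y))).
    apply: cone_mean_bound => // r0' v vt.
    have rE : r = th * (x - y) by move: r0'; rewrite /r /reach lt_max ltxx /= => /ltW/max_idPr.
    by apply: HM; apply: (pD x t) => //; rewrite -rE.
  have [->|rn0] := eqVneq r 0; first by rewrite mul0r divr_ge0 ?(ltW lam0)// mulr_ge0 ?(ltW (wt0 _)).
  have r1 : 0 < r by rewrite lt_neqAle eq_sym rn0.
  have rE : r = th * (x - y) by move: r1; rewrite /r /reach lt_max ltxx /= => /ltW/max_idPr.
  rewrite ler_pdivlMr// -!mulrA [r * _]mulrCA; apply: ler_wpM2l => //.
  have -> : wt x = expR (lam * r) * wt y.
    by rewrite /wt -expRD; congr expR; rewrite rE; ring.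
  rewrite mulrCA mulrC; apply: ler_wpM2r; first exact: ltW.
  by apply: le_trans (expR_ge1Dx _); rewrite mulrC lerDr.
apply: (le_trans H).
rewrite [leRHS](_ : _ = M * wt x / lam * (lam / 4)); last by field; rewrite gt_eqF.
apply: ler_wpM2l; first by rewrite divr_ge0 ?(ltW lam0)// mulr_ge0 ?(ltW (wt0 _)).
by rewrite /lam; lra.
Qed.

Definition bounded_domain D := exists K T, forall y v, D y v -> `|y| <= K /\ `|v| <= T.

Lemma weight_bounds K y : `|y| <= K -> expR (- (lam * K)) <= wt y <= expR (lam * K).
Proof.
move=> yK; rewrite !ler_expR -mulrN !ler_pM2l// -ler_norml.
by rewrite normrM th1 mul1r.
Qed.

Lemma weighted_bound D X : bounded_domain D -> jointly X ->
  exists2 B, 0 <= B & forall y v, D y v -> `|X y v| <= B * wt y.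
Proof.
move=> [K [T HD]] cX; have [M M0 HM] := bounded_on_rectangle K T cX.
exists (M * expR (lam * K)); first by rewrite mulr_ge0 ?expR_ge0.
move=> y v /HD[yK vT]; apply: (le_trans (HM _ _ yK vT)).
have /andP[w1 _] := weight_bounds yK.
rewrite -mulrA ler_peMr//; apply: le_trans (ler_wpM2l (expR_ge0 _) w1).
by rewrite -expRD addrN expR0.
Qed.

Lemma volterra_apriori D X h m x t : past_closed D -> bounded_domain D ->
  jointly X -> 0 <= m ->
  (forall y v, D y v -> X y v = h y v + volterra X y v) ->
  (forall y v, D y v -> `|h y v| <= m * wt y) ->
  D x t -> `|X x t| <= 4 / 3 * m * wt x.
Proof.
move=> pD bD cX m0 HX Hh dxt; have [B B0 HB] := weighted_bound bD cX.
(* The value 4/3 m is the fixed point of b -> m + b / 4. *)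
have claim n : forall y v, D y v -> `|X y v| <= (B * quarter n + 4 / 3 * m) * wt y.
  elim: n => [|n IH] y v dyv.
    apply: (le_trans (HB _ _ dyv)); rewrite /quarter expr0 mulr1.
    rewrite ler_wpM2r ?(ltW (wt0 _))//; lra.
  have C0 : 0 <= B * quarter n + 4 / 3 * m.
    by rewrite addr_ge0// mulr_ge0 ?divr_ge0// ltW// quarter_gt0.
  have b1 := volterra_bound pD cX C0 IH dyv; have b2 := Hh _ _ dyv.
  rewrite HX//; apply: (le_trans (ler_normD _ _)).
  apply: (le_trans (lerD b2 b1)); rewrite -mulrDl ler_wpM2r ?(ltW (wt0 _))//.
  by rewrite (quarterS n); lra.
apply: (@le_quarter _ _ _ (B * wt x)) => n; apply: (le_trans (claim n _ _ dxt)).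
by rewrite mulrDl addrC (mulrAC B).
Qed.

(** The edges have slope one, the speed of propagation, so past cones stay inside; such sets exhaust
    the plane. *)
Definition strip K T (y v : R) := `|y| <= K /\ `|v| <= T - th * y.

Lemma strip_past_closed K T : 1 <= K -> past_closed (strip K T).
Proof.
move=> K1 x t y v [_ tT] /andP[y0 y1] r0 vt; split.
  by rewrite gtr0_norm// (le_trans (ltW y1)).
have -> : v = (v - t) + t by rewrite subrK.
by apply: (le_trans (ler_normD _ _)); move: tT vt; rewrite mulrBr; lra.
Qed.

Lemma strip_bounded K T : bounded_domain (strip K T).
Proof.
exists K, (T + K) => y v [yK vT]; split => //; apply: (le_trans vT).
rewrite lerD2l; apply: (le_trans (ler_norm _)).
by rewrite normrN normrM th1 mul1r.
Qed.

Lemma strip_mem K T y v : `|y| <= K -> `|v| + K <= T -> strip K T y v.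
Proof.
move=> yK vT; split => //; rewrite lerBrDr; apply: le_trans vT.
rewrite lerD2l; apply: (le_trans (ler_norm _)).
by rewrite normrM th1 mul1r.
Qed.

Lemma volterra_unique D X x t : past_closed D -> bounded_domain D -> jointly X ->
  (forall y v, D y v -> X y v = volterra X y v) -> D x t -> X x t = 0.
Proof.
move=> pD bD cX HX dxt; apply/eqP; rewrite -normr_le0.
have := @volterra_apriori D X (fun _ _ => 0) 0 x t pD bD cX (lexx _).
rewrite mulr0 mul0r; apply=> //.
- by move=> y v dyv; rewrite add0r HX.
- by move=> y v _; rewrite normr0 mul0r.
Qed.

(** Neumann series: on every strip the weighted bound gives convergence at rate 4^(-n), so the limit
    is continuous and the equation passes to it. *)
Lemma volterra_exists h : jointly h ->
  exists2 X, jointly X & forall x t, X x t = h x t + volterra X x t.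
Proof.
move=> ch; pose Y n := iter n volterra h.
have cY n : jointly (Y n) by elim: n => //= n; exact: volterra_continuous.
have Y0 : Y 0%N = h by [].
have YS n : Y n.+1 = volterra (Y n) by [].
clearbody Y; pose S m x t := \sum_(k < m) Y k x t.
have cS m : jointly (S m).
  elim: m => [|m IH].
    by apply: (continuous_ext _ (@cts_cst R _ 0)) => p; rewrite /S big_ord0.
  by apply: (continuous_ext _ (ctsD IH (cY m))) => p; rewrite /S big_ord_recr.
have SE m x t : S m.+1 x t = h x t + volterra (S m) x t.
  elim: m => [|m IH].
    rewrite /S big_ord_recr !big_ord0 /= add0r Y0 /volterra (eq_II (g := fun=> 0)) ?II_cst ?mul0r ?addr0//.
    move=> y _; rewrite /cone_mean (eq_II (g := fun=> 0)) ?II_cst ?mul0r ?mulr0//.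
    by move=> v _; rewrite big_ord0.
  have -> : S m.+2 x t = S m.+1 x t + volterra (Y m) x t by rewrite /S big_ord_recr -YS.
  rewrite IH -addrA; congr (_ + _).
  rewrite addrC -[X in X + _]mul1r -(volterra_lincomb 1 x t (cY m) (cS m)).
  apply: eq_II => y _; congr (_ * (_ * _)); apply: eq_II => v _.
  by rewrite mul1r /S big_ord_recr addrC.
have YB K T : 1 <= K -> exists2 M, 0 <= M &
    forall n x t, strip K T x t -> `|Y n x t| <= M * quarter n * wt x.
  move=> K1; have [B B0 HB] := weighted_bound (strip_bounded K T) ch.
  exists B => //; elim=> [|n IH] x t dxt; first by rewrite Y0 /quarter expr0 mulr1; exact: HB.
  have C0 : 0 <= B * quarter n by rewrite mulr_ge0 ?(ltW (quarter_gt0 _)).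
  have b := @volterra_bound (strip K T) (Y n) (B * quarter n) x t (@strip_past_closed K T K1) (cY n) C0 IH dxt.
  rewrite YS; apply: (le_trans b).
  by rewrite (quarterS n) ler_wpM2r ?(ltW (wt0 _))//; lra.
have YB' K T : 1 <= K -> exists2 M, 0 <= M &
    forall n x t, strip K T x t -> `|Y n x t| <= M * quarter n.
  move=> K1; have [M M0 HM] := YB K T K1; exists (M * expR (lam * K)).
    by rewrite mulr_ge0 ?expR_ge0.
  move=> n x t dxt; apply: (le_trans (HM _ _ _ dxt)).
  rewrite mulrAC ler_wpM2r ?(ltW (quarter_gt0 _))// ler_wpM2l//.
  by have [xK _] := dxt; have /andP[] := weight_bounds xK.
have lim (p : R * R) : exists l, exists M, forall m, `|l - S m p.1 p.2| <= M * quarter m.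
  case: p => x t /=; have [|M M0 HM] := YB' (`|x| + 1) (`|t| + (`|x| + 1)); first by rewrite lerDr.
  have [|l Hl] := @quarter_sum_limit R (fun n => Y n x t) M.
    by move=> n; apply: HM; apply: strip_mem => //; rewrite lerDl.
  by exists l, (M * (4 / 3)).
have [X' HX'] := choice lim; pose X x t := X' (x, t).
have XB K T : 1 <= K -> exists2 M, 0 <= M &
    forall m x t, strip K T x t -> `|X x t - S m x t| <= M * quarter m.
  move=> K1; have [M M0 HM] := YB' K T K1; exists (M * (4 / 3)); first by rewrite mulr_ge0.
  move=> m x t dxt; have [l Hl] := quarter_sum_limit (fun n => HM n x t dxt).
  suff -> : X x t = l by exact: Hl.
  apply/eqP; rewrite -subr_eq0 -normr_le0.
  have [M' HM'] := HX' (x, t).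
  apply: (@le_quarter _ _ _ (M' + M * (4 / 3))) => n; rewrite add0r mulrDl.
  have -> : X x t - l = (X x t - S n x t) - (l - S n x t) by ring.
  by apply: (le_trans (ler_normB _ _)); apply: lerD; [exact: (HM' n)|exact: Hl].
have cX : jointly X.
  apply: continuous_pair_eps => x0 t0 e e0.
  have [|M M0 HM] := XB (`|x0| + 1) (`|t0| + 1 + (`|x0| + 1)); first by rewrite lerDr.
  have [m Hm] : exists m, M * quarter m <= e / 3.
    apply: contrapT => /forallNP H; have : e / 3 <= 0.
      by apply: (@le_quarter _ _ _ M) => n; rewrite add0r ltW// ltNge; exact/negP.
    by rewrite leNgt divr_gt0.
  have [d d0 Hd] := continuous_pair_epsE (cS m) x0 t0 (divr_gt0 e0 (ltr0Sn R 2)).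
  exists (Num.min d 1); first by rewrite lt_min d0 ltr01.
  move=> x t; rewrite !lt_min => /andP[xd x1] /andP[td t1].
  have near1 (a b : R) : `|a - b| < 1 -> `|a| <= `|b| + 1.
    move=> ab; have -> : a = b + (a - b) by ring.
    by apply: (le_trans (ler_normD _ _)); rewrite lerD2l ltW.
  have i0 : strip (`|x0| + 1) (`|t0| + 1 + (`|x0| + 1)) x0 t0.
    by apply: strip_mem; rewrite ?lerDl// lerD2r lerDl.
  have i1 : strip (`|x0| + 1) (`|t0| + 1 + (`|x0| + 1)) x t.
    by apply: strip_mem; [exact: near1|rewrite lerD2r; exact: near1].
  have -> : X x t - X x0 t0 = (X x t - S m x t) + (S m x t - S m x0 t0) - (X x0 t0 - S m x0 t0) by ring.
  have b1 := le_trans (HM m _ _ i1) Hm; have b0 := le_trans (HM m _ _ i0) Hm.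
  have b2 := Hd _ _ xd td.
  apply: (le_trans (ler_normB _ _)); have := ler_normD (X x t - S m x t) (S m x t - S m x0 t0).
  by lra.
exists X => // x t; apply/eqP; rewrite -subr_eq0 -normr_le0.
have K1 : 1 <= `|x| + 1 by rewrite lerDr.
have [M M0 HM] := XB (`|x| + 1) (`|t| + (`|x| + 1)) K1.
have dxt : strip (`|x| + 1) (`|t| + (`|x| + 1)) x t by apply: strip_mem; rewrite ?lerDl.
pose c := expR (lam * (`|x| + 1)).
apply: (@le_quarter _ _ _ (M + M * c / 4 * wt x)) => m; rewrite add0r.
pose Z y v := (-1) * S m y v + X y v.
have cZ : jointly Z by exact: jointlyDZ.
have ZB y v : strip (`|x| + 1) (`|t| + (`|x| + 1)) y v -> `|Z y v| <= M * c * quarter m * wt y.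
  move=> dyv; rewrite /Z mulN1r addrC; apply: (le_trans (HM m _ _ dyv)).
  have [yK _] := dyv; have /andP[w1 _] := weight_bounds yK.
  have cw : 1 <= c * wt y.
    by apply: le_trans (ler_wpM2l (expR_ge0 _) w1); rewrite -expRD addrN expR0.
  rewrite (_ : M * c * quarter m * wt y = M * quarter m * (c * wt y)); last by ring.
  by rewrite ler_peMr// mulr_ge0// ltW// quarter_gt0.
have -> : X x t - (h x t + volterra X x t) = (X x t - S m.+1 x t) - volterra Z x t.
  rewrite SE (volterra_lincomb _ _ _ (cS m) cX) mulN1r; move: (volterra (S m) x t) (volterra X x t) => A B.
  by ring.
have q0 := quarter_gt0 (R := R) m.
apply: (le_trans (ler_normB _ _)); rewrite mulrDl; apply: lerD.
  apply: (le_trans (HM m.+1 _ _ dxt)); rewrite ler_wpM2l//.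
  by rewrite (quarterS m) in q0 *; lra.
have MC : 0 <= M * c * quarter m by rewrite !mulr_ge0 ?expR_ge0 ?(ltW q0).
apply: (le_trans (volterra_bound (@strip_past_closed _ _ K1) cZ MC ZB dxt)).
by rewrite [leRHS](_ : _ = M * c * quarter m / 4 * wt x)//; ring.
Qed.

End Volterra.

(** * Density of exponentials *)

Section ExponentialDensity.
Context {R : realType}.
Implicit Types f g F : R -> R.

Lemma jointly_uniform (X : R -> R -> R) (x0 K e : R) : jointly X -> 0 < e ->
  exists2 d, 0 < d & forall x t, `|x - x0| < d -> `|t| <= K -> `|X x t - X x0 t| <= e.
Proof.
move=> cX e0; have /compact_near_coveringP kK := @segment_compact R (- K) K.
have /kK [d /= d0 Hd] : forall t, [set` `[- K, K]] t ->
    \forall t' \near t & x \near nbhs x0, `|X x t' - X x0 t'| <= e.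
  move=> t _; have [d d0 Hd] := continuous_pair_epsE cX x0 t (divr_gt0 e0 (ltr0Sn R 1)).
  exists ([set t' | `|t' - t| < d], [set x | `|x - x0| < d]) => /=.
    by split; exists d => //= y; rewrite /ball_ /= distrC.
  move=> [t' x] /= [td xd].
  have -> : X x t' - X x0 t' = (X x t' - X x0 t) - (X x0 t' - X x0 t) by ring.
  apply: (le_trans (ler_normB _ _)); rewrite [leRHS](splitr e).
  by apply: lerD; apply: Hd => //; rewrite subrr normr0.
exists d => // x t xd tK; apply: (Hd x); last by rewrite /= in_itv /= -ler_norml.
by rewrite /ball_ /= distrC.
Qed.

(** The mean of g(d S) for S binomial with parameters n and v, obtained by conditioning on one
    trial. For d = 1/n it is the n-th Bernstein polynomial of g. *)
Fixpoint binomial_mean (n : nat) (d : R) g (v : R) : R :=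
  if n is m.+1 then
    v * binomial_mean m d (fun y => g (y + d)) v + (1 - v) * binomial_mean m d g v
  else g 0.

Lemma binomial_mean_le n d f g v : 0 <= v <= 1 -> (forall y, `|f y| <= g y) ->
  `|binomial_mean n d f v| <= binomial_mean n d g v.
Proof.
move=> /andP[v0 v1]; elim: n f g => [|n IH] f g fg //=.
apply: (le_trans (ler_normD _ _)); rewrite !normrM (ger0_norm v0) (ger0_norm (_ : 0 <= 1 - v)) ?subr_ge0//.
by apply: lerD; [rewrite ler_wpM2l// IH|rewrite ler_wpM2l ?subr_ge0// IH].
Qed.

Lemma binomial_meanB_cst n d f k v :
  binomial_mean n d (fun y => f y - k) v = binomial_mean n d f v - k.
Proof. by elim: n f => [|n IH] f //=; rewrite !IH; ring. Qed.

(** Variance plus squared bias. *)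
Lemma binomial_mean_square n d (A B a : R) v :
  binomial_mean n d (fun y => A + B * (y - a) ^+ 2) v =
  A + B * (d ^+ 2 * n%:R * v * (1 - v) + (n%:R * d * v - a) ^+ 2).
Proof.
elim: n a => [|n IH] a /=; first by ring.
have -> : (fun y => A + B * (y + d - a) ^+ 2) = (fun y => A + B * (y - (a - d)) ^+ 2).
  by apply/funext => y; congr (_ + _ * _ ^+ 2); ring.
by rewrite !IH -natr1; ring.
Qed.

Lemma binomial_mean_poly n d g : exists p : {poly R}, forall v, binomial_mean n d g v = p.[v].
Proof.
elim: n g => [|n IH] g /=; first by exists (g 0)%:P => v; rewrite hornerC.
have [p Hp] := IH (fun y => g (y + d)); have [p' Hp'] := IH g.
by exists ('X * p + (1 - 'X) * p') => v; rewrite !hornerE Hp Hp'.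
Qed.

Lemma binomial_mean0 n d g : binomial_mean n d g 0 = g 0.
Proof. by elim: n => [|n IH] //=; rewrite IH mul0r subr0 mul1r add0r. Qed.

(** Bernstein polynomials reproduce the value at 0 exactly, which later removes the constant
    term. *)
Lemma polynomial_approximation F B e : continuous F -> (forall v, `|F v| <= B) -> 0 < e ->
  exists2 p : {poly R}, p.[0] = F 0 & forall v, 0 <= v <= 1 -> `|p.[v] - F v| <= e.
Proof.
move=> cF FB e0; have B0 : 0 <= B := le_trans (normr_ge0 _) (FB 0).
have cF2 : jointly (fun x t => F (t + x)).
  apply: (cts_comp _ cF); apply: ctsD; first exact: (@cts_snd _ _ _ id (@cts_id R)).
  exact: (@cts_fst _ _ _ id (@cts_id R)).
have [d d0 Hd] := @jointly_uniform _ 0 1 _ cF2 (divr_gt0 e0 (ltr0Sn R 1)).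
(* Chebyshev's argument: outside the window of radius d the oscillation 2 B is at most K (y -
   v)^2. *)
pose K := 2 * B / d ^+ 2; have K0 : 0 <= K by rewrite divr_ge0 ?sqr_ge0// mulr_ge0.
have mod v y : 0 <= v <= 1 -> `|F y - F v| <= e / 2 + K * (y - v) ^+ 2.
  move=> /andP[v0 v1]; have [yv|yv] := ltP `|y - v| d.
    apply: (@le_trans _ _ (e / 2)); last by rewrite lerDl mulr_ge0 ?sqr_ge0.
    have := Hd (y - v) v; rewrite subr0 addr0 subrKC; apply=> //.
    by rewrite ger0_norm.
  apply: (@le_trans _ _ (2 * B)).
    by apply: (le_trans (ler_normB _ _)); have := FB y; have := FB v; lra.
  apply: (@le_trans _ _ (K * (y - v) ^+ 2)); last by rewrite lerDr divr_ge0// ltW.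
  rewrite -[2 * B](@divfK _ (d ^+ 2)) ?expf_neq0 ?gt_eqF// -/K ler_wpM2l//.
  by rewrite -[leRHS]real_normK ?num_real// ler_sqr ?nnegrE// ltW.
have [n n0 Hn] : exists2 n : nat, (0 < n)%N & K / n%:R <= e / 2.
  have K2 : 0 <= K / (e / 2) by rewrite divr_ge0// divr_ge0// ltW.
  have Hn := archi_boundP K2; exists (Num.bound (K / (e / 2))).+1 => //.
  rewrite ler_pdivrMr// mulrC -ler_pdivrMr ?divr_gt0//.
  by rewrite (le_trans (ltW Hn))// ler_nat leqnSn.
have nR : n%:R != 0 :> R by rewrite pnatr_eq0 -lt0n.
have [p Hp] := binomial_mean_poly n n%:R^-1 F.
exists p; first by rewrite -Hp binomial_mean0.
move=> v v01; rewrite -Hp -binomial_meanB_cst.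
apply: (le_trans (binomial_mean_le n n%:R^-1 v01 (fun y => mod v y v01))).
rewrite binomial_mean_square mulfV// mul1r subrr expr0n /= addr0.
rewrite [leRHS](splitr e) lerD2l; apply: le_trans Hn.
have -> : n%:R^-1 ^+ 2 * n%:R * v * (1 - v) = n%:R^-1 * (v * (1 - v)) by field.
rewrite ler_wpM2l// ler_piMr ?invr_ge0//.
by have /andP[v0 v1] := v01; rewrite mulr_ile1 ?subr_ge0// gerBl.
Qed.

Definition linear_functional (L : (R -> R) -> R) := forall c f g,
  continuous f -> continuous g -> L (fun t => c * f t + g t) = c * L f + L g.

Lemma linear_functional0 L : linear_functional L -> L (fun=> 0) = 0.
Proof.
move=> lL; have := lL (-1) (fun=> 0) (fun=> 0) (@cts_cst R R 0) (@cts_cst R R 0).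
by rewrite mulN1r oppr0 addr0 mulN1r addNr.
Qed.

Lemma linear_functional_sum L n (a : nat -> R) (f : nat -> R -> R) :
  linear_functional L -> (forall i, continuous (f i)) ->
  continuous (fun t => \sum_(i < n) a i * f i t) /\
  L (fun t => \sum_(i < n) a i * f i t) = \sum_(i < n) a i * L (f i).
Proof.
move=> lL cf; elim: n => [|n [IHc IH]].
  rewrite big_ord0 -[RHS](linear_functional0 lL); split.
    by apply: (continuous_ext _ (@cts_cst R R 0)) => t; rewrite big_ord0.
  by congr L; apply/funext => t; rewrite big_ord0.
rewrite big_ord_recr /= -IH addrC -lL//.
have E : (fun t => \sum_(i < n.+1) a i * f i t) =
    fun t => a n * f n t + \sum_(i < n) a i * f i t.
  by apply/funext => t; rewrite big_ord_recr addrC.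
by rewrite E; split => //; apply: ctsD => //; apply: ctsM => //; exact: cts_cst.
Qed.

(* In the variable e^t these are polynomials without constant term, which suffice
   because e^t stays away from 0 on bounded sets. *)
Lemma exponentials_total (L : (R -> R) -> R) C T : linear_functional L -> 0 <= C ->
  (forall f M, continuous f -> (forall t, `|t| <= T -> `|f t| <= M) -> `|L f| <= C * M) ->
  (forall n, L (fun t => expR (n.+1%:R * t)) = 0) ->
  forall f, continuous f -> L f = 0.
Proof.
move=> lL C0 LC L0 f cf.
have cexp (k : R) : continuous (fun t : R => expR (k * t)).
  by apply: (cts_comp (ctsM (@cts_cst R R k) (@cts_id R))); exact: continuous_expR.
pose E := expR T; have E0 : 0 < E := expR_gt0 _.
pose a := expR (- T - T); have a0 : 0 < a := expR_gt0 _.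
(* In the variable v = e^(t - T), which lies in [a, 1] for |t| <= T, this is f. The first factor is
   1 there and forces [G 0 = 0]. *)
pose G v := Num.min 1 (v / a) * f (ln (E * Num.max a v)).
pose F v := G (Num.max 0 (Num.min 1 v)).
have cmin : continuous (fun v : R => Num.max 0 (Num.min 1 v)).
  apply: cts_max; first exact: cts_cst.
  by apply: cts_min; [exact: cts_cst|exact: cts_id].
have cG : continuous G.
  apply: ctsM.
    by apply: cts_min; [exact: cts_cst|apply: ctsM; [exact: cts_id|exact: cts_cst]].
  apply: (cts_comp _ cf).
  have cM : continuous (fun v => E * Num.max a v).
    apply: ctsM; first exact: cts_cst.
    by apply: cts_max; [exact: cts_cst|exact: cts_id].
  move=> v; apply: (@cvg_comp _ _ _ (fun v => E * Num.max a v) (@ln R) _ _ _ (cM v)); apply: continuous_ln.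
  by rewrite mulr_gt0// lt_max a0.
have cF : continuous F := cts_comp cmin cG.
have [B _ HB] := @continuous_bounded_on R G 0 1 (continuous_subspaceT cG).
have FB v : `|F v| <= B.
  by apply: HB; rewrite le_max lexx /= ge_max ler01 ge_min lexx.
apply: (@le_eps0 R _ C) => e e0.
have [p p0 Hp] := polynomial_approximation cF FB e0.
pose ai i := p`_i * E^-1 ^+ i; pose fi i (t : R) := expR (i%:R * t).
have pE t : p.[E^-1 * expR t] = \sum_(i < size p) ai i * fi i t.
  by rewrite horner_coef; apply: eq_bigr => i _; rewrite exprMn -expRM_natl mulrA.
have [cS LS] := linear_functional_sum (size p) ai lL (fun i => cexp i%:R).
have LS0 : L (fun t => \sum_(i < size p) ai i * fi i t) = 0.
  rewrite LS big1// => -[[|i] ip] _ /=; last by rewrite L0 mulr0.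
  have := p0; rewrite horner_coef0 /F (_ : Num.max 0 (Num.min 1 0) = 0); last first.
    by rewrite (min_idPr ler01) maxxx.
  by rewrite /ai /G mul0r (min_idPr ler01) mul0r => ->; rewrite !mul0r.
have -> : L f = L (fun t => (-1) * (\sum_(i < size p) ai i * fi i t) + f t).
  by rewrite lL// LS0 mulr0 add0r.
apply: LC; first by apply: ctsD => //; apply: ctsM => //; exact: cts_cst.
move=> t tT; rewrite -pE mulN1r addrC distrC.
have /andP[t1 t2] : - T <= t <= T by rewrite -ler_norml.
have v0 : 0 < E^-1 * expR t by rewrite mulr_gt0 ?invr_gt0 ?expR_gt0.
have v1 : E^-1 * expR t <= 1 by rewrite mulrC ler_pdivrMr// mul1r ler_expR.
have va : a <= E^-1 * expR t by rewrite /E -expRN -expRD ler_expR; lra.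
suff <- : F (E^-1 * expR t) = f t by apply: Hp; rewrite ltW.
rewrite /F (min_idPr v1) (max_idPr (ltW v0)) /G (max_idPr va) mulVKf ?gt_eqF// expRK.
by rewrite (_ : Num.min _ _ = 1) ?mul1r//; apply/min_idPl; rewrite ler_pdivlMr// mul1r.
Qed.

(** The window 4 is made of 3 for a transmutation and 1 for its evaluation at s + y or s - y. *)
Definition local_operator (A : (R -> R) -> R -> R) :=
  [/\ forall f, continuous f -> continuous (A f),
      forall t, linear_functional (A^~ t),
      forall f s t, continuous f -> A (fun v => f (v + s)) t = A f (t + s)
    & exists2 C, 0 <= C & forall f M t, continuous f ->
        (forall v, `|v - t| <= 4 -> `|f v| <= M) -> `|A f t| <= C * M].

Lemma continuous_exp_linear (k : R) : continuous (fun t : R => expR (k * t)).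
Proof.
by apply: (cts_comp (ctsM (@cts_cst R R k) (@cts_id R))); exact: continuous_expR.
Qed.

Lemma local_operator_exp A k t : local_operator A ->
  A (fun v => expR (k * v)) t = A (fun v => expR (k * v)) 0 * expR (k * t).
Proof.
case=> _ lin shift _; have ck := @continuous_exp_linear k.
rewrite -[in LHS](add0r t) -shift// mulrC.
have := lin 0 (expR (k * t)) _ (fun=> 0) ck (@cts_cst R R 0).
rewrite (linear_functional0 (lin 0)) addr0 => <-; congr (A _ 0).
by apply/funext => v; rewrite addr0 -expRD; congr expR; ring.
Qed.

(** Translation invariance makes exponentials common eigenfunctions, so the commutator at 0 kills
    them. It is a functional with window 4 + 4 = 8, and density finishes. *)
Lemma local_operators_commute A B f t : local_operator A -> local_operator B ->
  continuous f -> A (B f) t = B (A f) t.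
Proof.
move=> lA lB; have [cA linA shA [CA CA0 HA]] := lA; have [cB linB shB [CB CB0 HB]] := lB.
have comp_lin A' B' : local_operator A' -> local_operator B' ->
    linear_functional (fun f => A' (B' f) 0).
  move=> [cA' linA' _ _] [cB' linB' _ _] c g h cg ch.
  rewrite -linA'; [|exact: cB'|exact: cB'].
  by congr (A' _ 0); apply/funext => v; rewrite linB'.
suff H g : continuous g -> A (B g) 0 = B (A g) 0.
  move=> cf; have cft : continuous (fun v => f (v + t)).
    by apply: (cts_comp _ cf); apply: ctsD; [exact: cts_id|exact: cts_cst].
  have := H _ cft.
  rewrite (_ : B (fun v => f (v + t)) = fun v => B f (v + t)); last by apply/funext => v; rewrite shB.
  rewrite (_ : A (fun v => f (v + t)) = fun v => A f (v + t)); last by apply/funext => v; rewrite shA.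
  by rewrite shA ?shB ?add0r//; [exact: cA|exact: cB].
move=> cg; apply/eqP; rewrite -subr_eq0; apply/eqP.
have near8 (v w : R) : `|v - 0| <= 4 -> `|w - v| <= 4 -> `|w| <= 8.
  rewrite subr0 => v4 wv; have -> : w = (w - v) + v by rewrite subrK.
  by apply: (le_trans (ler_normD _ _)); lra.
apply: (@exponentials_total (fun g => A (B g) 0 - B (A g) 0) (CA * CB + CB * CA) 8) => //.
- move=> c h k ch ck /=; rewrite (comp_lin A B)// (comp_lin B A)//; ring.
- by rewrite addr_ge0// mulr_ge0.
- move=> h M ch HM; apply: (le_trans (ler_normB _ _)); rewrite mulrDl -!mulrA.
  apply: lerD.
    apply: HA => [|v v4]; first exact: cB.
    by apply: HB => // w wv; apply: HM; exact: near8 v4 wv.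
  apply: HB => [|v v4]; first exact: cA.
  by apply: HA => // w wv; apply: HM; exact: near8 v4 wv.
- move=> n; have eigen A' : local_operator A' -> A' (fun t => expR (n.+1%:R * t)) =
      fun t => A' (fun t => expR (n.+1%:R * t)) 0 * expR (n.+1%:R * t) + 0.
    by move=> lA'; apply/funext => v; rewrite addr0 -local_operator_exp.
  have ck := @continuous_exp_linear n.+1%:R; have c0 := @cts_cst R R 0.
  rewrite (eigen B)// linA// (linear_functional0 (linA 0)) addr0.
  rewrite [X in _ - B X 0](eigen A)// linB// (linear_functional0 (linB 0)) addr0.
  by rewrite mulrC subrr.
Qed.

End ExponentialDensity.

(** * Transmutation operators *)

Section Transmutation.
Context {R : realType}.
Implicit Types (eta f g : R -> R) (P : (R -> R) -> R -> R -> R) (D : R -> R -> Prop).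

(** Two instances are used: eta(t + x - 1), the free wave with trace eta at x = 1, and (eta(t + x) +
    sg eta(t - x)) / 2, whose symmetry at x = 0 is that of the boundary condition. *)
Definition free_wave (c1 b c2 : R) eta (x t : R) : R :=
  c1 * eta (t + x + b) + c2 * eta (t - x).

Definition transmutation (q : R -> R) (th c1 b c2 : R) P := forall eta, continuous eta ->
  jointly (P eta) /\
  forall x t, P eta x t = free_wave c1 b c2 eta x t + volterra q th (P eta) x t.

Lemma free_wave_jointly c1 b c2 eta : continuous eta -> jointly (free_wave c1 b c2 eta).
Proof.
move=> ce; have f1 := @cts_fst R R R id (@cts_id R); have f2 := @cts_snd R R R id (@cts_id R).
apply: ctsD; (apply: ctsM; first exact: cts_cst); apply: (cts_comp _ ce).
  by apply: ctsD; [exact: ctsD|exact: cts_cst].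
exact: ctsB.
Qed.

Lemma transmutation_exists q th c1 b c2 : integ 1 q -> `|th| = 1 ->
  exists P, transmutation q th c1 b c2 P.
Proof.
move=> iq th1; have H eta : exists X : R -> R -> R, continuous eta -> jointly X /\
    forall x t, X x t = free_wave c1 b c2 eta x t + volterra q th X x t.
  have [ce|nce] := pselect (continuous eta); last by exists (fun _ _ => 0).
  by have [X cX HX] := volterra_exists iq th1 (@free_wave_jointly c1 b c2 eta ce); exists X.
by have [P HP] := choice H; exists P.
Qed.

(** For |y| <= 1 the weights lie between fixed bounds, so the constant does not depend on the
    domain. *)
Lemma volterra_stable (q : R -> R) th : integ 1 q -> `|th| = 1 ->
  exists2 C, 0 <= C & forall D X h m x t, past_closed th D -> bounded_domain D ->
    (forall y v, D y v -> `|y| <= 1) -> jointly X -> 0 <= m ->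
    (forall y v, D y v -> X y v = h y v + volterra q th X y v) ->
    (forall y v, D y v -> `|h y v| <= m) -> D x t -> `|X x t| <= C * m.
Proof.
move=> iq th1; pose e := expR ((4 * II 1 (fun y => `|q y|) + 1) * 1).
have e0 : 0 <= e by exact: expR_ge0.
exists (4 / 3 * e * e); first by rewrite !mulr_ge0.
move=> D X h m x t pD bD D1 cX m0 HX Hh dxt.
have me0 : 0 <= m * e by rewrite mulr_ge0.
have H := @volterra_apriori R q th iq th1 D X h (m * e) x t pD bD cX me0 HX.
have {}H := H _ dxt; apply: le_trans (H _) _ => [y v dyv|].
  apply: (le_trans (Hh _ _ dyv)); rewrite -mulrA ler_peMr//.
  have /andP[w1 _] := weight_bounds q th1 (D1 _ _ dyv).
  by apply: le_trans (ler_wpM2l e0 w1); rewrite /e -expRD addrN expR0.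
have /andP[_ w2] := weight_bounds q th1 (D1 _ _ dxt).
rewrite [leRHS](_ : _ = 4 / 3 * (m * e) * e); last by ring.
by rewrite ler_wpM2l// mulr_ge0.
Qed.

Definition cone (th x0 t0 y v : R) : Prop := 0 <= y <= 1 /\ `|v - t0| <= th * (x0 - y).

Lemma cone_past_closed th x0 t0 : past_closed th (cone th x0 t0).
Proof.
move=> x t y v [_ H1] /andP[y0 y1] r0 H2; split; first by rewrite !ltW.
have -> : v - t0 = (v - t) + (t - t0) by ring.
by apply: (le_trans (ler_normD _ _)); move: H1 H2; rewrite !mulrBr; lra.
Qed.

Lemma cone_radius th x0 t0 y v : `|th| = 1 -> 0 <= x0 <= 1 -> cone th x0 t0 y v ->
  `|v - t0| <= 1 /\ `|y| <= 1.
Proof.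
move=> th1 /andP[x00 x01] [/andP[y0 y1] H]; split; last by rewrite ger0_norm.
apply: (le_trans H); apply: (le_trans (ler_norm _)); rewrite normrM th1 mul1r ler_norml.
by apply/andP; split; lra.
Qed.

Lemma cone_bounded th x0 t0 : `|th| = 1 -> 0 <= x0 <= 1 -> bounded_domain (cone th x0 t0).
Proof.
move=> th1 x01; exists 1, (1 + `|t0|) => y v /(cone_radius th1 x01)[vt y1]; split => //.
have -> : v = (v - t0) + t0 by rewrite subrK.
by apply: (le_trans (ler_normD _ _)); rewrite lerD2r.
Qed.

Lemma cone_apex th x0 t0 : 0 <= x0 <= 1 -> cone th x0 t0 x0 t0.
Proof. by move=> x01; split => //; rewrite !subrr mulr0 normr0. Qed.

Section Properties.
Variables (q : R -> R) (th c1 b c2 : R) (P : (R -> R) -> R -> R -> R).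
Hypotheses (iq : integ 1 q) (th1 : `|th| = 1) (b1 : `|b| <= 1).
Hypothesis tP : transmutation q th c1 b c2 P.

Lemma transmutation_unique D X eta x t : past_closed th D -> bounded_domain D ->
  jointly X -> continuous eta ->
  (forall y v, D y v -> X y v = free_wave c1 b c2 eta y v + volterra q th X y v) ->
  D x t -> X x t = P eta x t.
Proof.
move=> pD bD cX ce HX dxt; have [cP HP] := tP ce.
have cZ : jointly (fun y v => (-1) * P eta y v + X y v) by exact: jointlyDZ.
have := @volterra_unique R q th iq th1 D _ x t pD bD cZ.
move=> H; apply/eqP; rewrite -subr_eq0 -(H _ dxt) ?mulN1r 1?addrC// => y v dyv.
rewrite (volterra_lincomb th iq (-1) y v cP cX) HX// HP.
by move: (volterra _ _ (P eta) _ _) (volterra _ _ X _ _) => A B; ring.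
Qed.

Lemma transmutation_uniqueT X eta x t : jointly X -> continuous eta ->
  (forall y v, X y v = free_wave c1 b c2 eta y v + volterra q th X y v) ->
  X x t = P eta x t.
Proof.
move=> cX ce HX.
have K1 : 1 <= `|x| + 1 by rewrite lerDr.
apply: (@transmutation_unique (strip th (`|x| + 1) (`|t| + (`|x| + 1)))) => //.
- exact: strip_past_closed.
- exact: strip_bounded.
- by apply: strip_mem; rewrite ?lerDl.
Qed.

Lemma transmutation_lincomb c f g x t : continuous f -> continuous g ->
  P (fun v => c * f v + g v) x t = c * P f x t + P g x t.
Proof.
move=> cf cg; have [cPf HPf] := tP cf; have [cPg HPg] := tP cg.
symmetry; apply: (@transmutation_uniqueT (fun x t => c * P f x t + P g x t)).
- exact: jointlyDZ.
- by apply: ctsD => //; apply: ctsM => //; exact: cts_cst.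
- move=> y v; rewrite (volterra_lincomb th iq c y v cPf cPg) HPf HPg /free_wave.
  by move: (volterra _ _ (P f) _ _) (volterra _ _ (P g) _ _) => A B; ring.
Qed.

Lemma transmutation_shift f s x t : continuous f ->
  P (fun v => f (v + s)) x t = P f x (t + s).
Proof.
move=> cf; have [cPf HPf] := tP cf.
symmetry; apply: (@transmutation_uniqueT (fun x t => P f x (t + s))).
- apply: (continuous_comp2 cPf); first exact: (@cts_fst _ _ _ id (@cts_id R)).
  by apply: ctsD; [exact: (@cts_snd _ _ _ id (@cts_id R))|exact: cts_cst].
- by apply: (cts_comp _ cf); apply: ctsD; [exact: cts_id|exact: cts_cst].
- move=> y v; rewrite HPf -volterra_shift; congr (_ + _).
  by rewrite /free_wave; congr (_ * f _ + _ * f _); ring.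
Qed.

(** The window 3 adds the radius of the cone, the shift by x and the offset b, each at most 1. *)
Lemma transmutation_bound : exists2 C, 0 <= C & forall eta M x t, continuous eta ->
  0 <= x <= 1 -> (forall v, `|v - t| <= 3 -> `|eta v| <= M) -> `|P eta x t| <= C * M.
Proof.
have [C C0 HC] := volterra_stable iq th1.
have c0 : 0 <= `|c1| + `|c2| by rewrite addr_ge0.
exists (C * (`|c1| + `|c2|)); first by rewrite mulr_ge0.
move=> eta M x t ce x01 HM; have [cP HP] := tP ce.
have M0 : 0 <= M by apply: (le_trans (normr_ge0 (eta t))); apply: HM; rewrite subrr normr0.
rewrite -mulrA; apply: (HC (cone th x t) (P eta) (free_wave c1 b c2 eta)) => //.
- exact: cone_past_closed.
- exact: cone_bounded.
- by move=> y v /(cone_radius th1 x01)[].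
- by rewrite mulr_ge0.
- move=> y v /(cone_radius th1 x01)[vt y1].
  apply: (le_trans (ler_normD _ _)); rewrite !normrM mulrDl.
  have tri (p r s : R) : `|p| <= 1 -> `|r| <= 1 -> `|s| <= 1 -> `|p + r + s| <= 3.
    rewrite !ler_norml => /andP[h1 h2] /andP[h3 h4] /andP[h5 h6].
    by apply/andP; split; lra.
  apply: lerD; apply: ler_wpM2l => //; apply: HM.
    by rewrite (_ : v + y + b - t = (v - t) + y + b); [exact: tri|ring].
  rewrite (_ : v - y - t = (v - t) + (- y) + 0); last by ring.
  by apply: tri; rewrite ?normrN// normr0.
- exact: cone_apex.
Qed.

Lemma transmutation_local x : 0 <= x <= 1 -> local_operator (fun eta => P eta x).
Proof.
move=> x01; have [C C0 HC] := transmutation_bound; split.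
- by move=> f /tP[cP _]; exact: jointly_section.
- by move=> t c f g cf cg; exact: transmutation_lincomb.
- by move=> f s t cf; exact: transmutation_shift.
- exists C => // f M t cf HM; apply: HC => // v vt; apply: HM.
  by apply: (le_trans vt); rewrite ler_nat.
Qed.

Lemma continuous_boundary_integrand sg f s : continuous f ->
  continuous (fun y : R => P f y (s + y) + sg * P f y (s - y)).
Proof.
move=> /tP[cP _]; apply: ctsD.
  apply: (continuous_comp2 cP); first exact: cts_id.
  by apply: ctsD; [exact: cts_cst|exact: cts_id].
apply: ctsM; first exact: cts_cst.
apply: (continuous_comp2 cP); first exact: cts_id.
by apply: ctsB; [exact: cts_cst|exact: cts_id].
Qed.

End Properties.

(** The integral term of the boundary identity, as an operator on the trace eta at x = 1. *)
Definition boundary_mean (q : R -> R) P (sg : R) eta (s : R) : R :=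
  II 1 (fun y => q y * (P eta y (s + y) + sg * P eta y (s - y))) / 2.

Lemma boundary_mean_local q th c1 b c2 P sg : integ 1 q -> `|th| = 1 -> `|b| <= 1 ->
  transmutation q th c1 b c2 P -> `|sg| = 1 -> local_operator (boundary_mean q P sg).
Proof.
move=> iq th1 b1 tP sg1; have [C C0 HC] := transmutation_bound iq th1 b1 tP.
have cI f s : continuous f -> continuous (fun y : R => P f y (s + y) + sg * P f y (s - y)).
  by move=> cf; exact: (@continuous_boundary_integrand q th c1 b c2 P tP sg f s cf).
split.
- move=> f cf; have [cP _] := tP f cf.
  apply: (@ctsM _ _ _ (fun=> 2^-1)); last exact: cts_cst.
  apply: (II_continuous (F := fun s y => P f y (s + y) + sg * P f y (s - y)) iq).
  have f1 := @cts_fst R R R id (@cts_id R); have f2 := @cts_snd R R R id (@cts_id R).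
  apply: ctsD; first by apply: (continuous_comp2 cP f2); exact: ctsD.
  by apply: ctsM; [exact: cts_cst|apply: (continuous_comp2 cP f2); exact: ctsB].
- move=> s c f g cf cg; rewrite /boundary_mean mulrA -mulrDl; congr (_ / _).
  rewrite -IIZ; last exact: integMc iq (cI f s cf).
  rewrite -IID; [|by apply: integZ; exact: integMc iq (cI f s cf)|exact: integMc iq (cI g s cg)].
  by apply: eq_II => y _; rewrite !(transmutation_lincomb iq th1 tP)//; ring.
- move=> f s t cf; rewrite /boundary_mean; congr (_ / _); apply: eq_II => y _.
  by rewrite !(transmutation_shift iq th1 tP)//; congr (_ * (P f y _ + _ * P f y _)); ring.
- exists (C * II 1 (fun y => `|q y|)).
    by rewrite mulr_ge0// II_ge0.
  move=> f M t cf HM; rewrite /boundary_mean normrM normfV (ger0_norm (ler0n R 2)) ler_pdivrMr//.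
  have -> : C * II 1 (fun y => `|q y|) * M * 2 = (2 * (C * M)) * II 1 (fun y => `|q y|) by ring.
  apply: norm_IIM => //; first exact: bmeas_continuous (cI f t cf).
  move=> y /andP[y0 y1]; apply: (le_trans (ler_normD _ _)).
  rewrite normrM sg1 mul1r mulr_natl mulr2n.
  have y01 : 0 <= y <= 1 by rewrite !ltW.
  have near4 (s v : R) : `|s| <= 1 -> `|v - (t + s)| <= 3 -> `|v - t| <= 4.
    move=> s1 vs; have -> : v - t = (v - (t + s)) + s by ring.
    by apply: (le_trans (ler_normD _ _)); lra.
  apply: lerD; apply: HC => // v vs; apply: HM.
    by apply: near4 vs; rewrite gtr0_norm// ltW.
  by apply: near4 vs; rewrite normrN gtr0_norm// ltW.
Qed.

Lemma cone_mean_derive (X Z : R -> R -> R) y t r : jointly X ->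
  (forall v : R, is_derive v 1 (Z y) (X y v)) ->
  2 * cone_mean X y t r = Z y (t + r) - Z y (t - r).
Proof.
move=> cX dZ; rewrite /cone_mean mulrA -IIZ; last first.
  exact: integ_continuous (@cone_mean_argument_continuous _ X _ _ _ cX).
have dZ' (v : R) : is_derive v 1 (fun v => Z y (2 * r * v + (t - r))) (2 * r * X y (t - r + 2 * r * v)).
  by rewrite (addrC (t - r)); apply: is_derive_affine; exact: dZ.
have cX' : continuous (fun v : R => 2 * r * X y (t - r + 2 * r * v)).
  apply: ctsM; first exact: cts_cst.
  exact: (@cone_mean_argument_continuous _ X _ _ _ cX).
by rewrite (II_FTC ltr01 cX' dZ'); congr (Z y _ - Z y _); ring.
Qed.

End Transmutation.

(** * From equal traces to equal boundary data of exponentials *)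

Section BoundaryData.
Context {R : realType}.
Implicit Types (psi : R -> R).

(** Pairing with psi' gives z_s. Its cone mean is half the difference of z at the two ends of the
    interval, so the sideways equation for z_s becomes a Volterra equation for z_s itself, and
    uniqueness on a cone identifies it. *)
Lemma pairing_transmutation (q : R -> R) u P psi lo hi x s :
  potential q -> distribution_path u -> wave_equation q u -> causal u ->
  transmutation q (-1) 1 (-1) 0 P -> smooth1 psi -> vanishes_off lo hi psi ->
  0 <= x <= 1 ->
  pairing u (derive1 psi) x s = P (pairing u (derive1 psi) 1) x s.
Proof.
move=> pq du wq cu tP sp p0 x01.
have sp1 := smooth_derive1 sp; have p1 := vanishes_off_derive1 p0.
have N1 : `|-1 : R| = 1 by rewrite normrN normr1.
have iq := integ_potential 1 pq.
have cX : jointly (pairing u (derive1 psi)) by exact: pairing_continuous p1.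
have ct : continuous (pairing u (derive1 psi) 1) by exact: jointly_section.
apply: (@transmutation_unique R q (-1) 1 (-1) 0 P iq N1 tP (cone (-1) x s) _ _ x s
  (@cone_past_closed _ _ _ _) (@cone_bounded _ _ _ _ N1 x01) cX ct _ (@cone_apex _ _ _ _ x01)).
move=> y v [/andP[y0 y1] _]; have [H1 _] := sideways_equations pq du wq sp p0 cu.
have dX z w := @pairing_derive R u psi lo hi z w du sp p0.
have := H1 y v y0; move: (pairing u (derive1 psi)) cX dX {H1 ct} => X cX dX.
set Ip := II 1 _; set Im := II 1 _ => E.
suff VE : 2 * volterra q (-1) X y v = Im - Ip.
  rewrite /free_wave mul0r addr0 mul1r.
  by move: E VE; move: (volterra _ _ _ _ _) (X y v) (X 1 (v + y - 1)) => *; lra.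
have bm (e : R) : integ 1 (fun z => q z * ((y < z)%R%:R * pairing u psi z (v + e * (z - y)))).
  apply: integM => //; apply: bmeasM; first exact: bmeas_ltr.
  apply: bmeas_continuous.
  have := @continuous_pairing_line R u du psi lo hi (v - e * y) e sp p0.
  by apply: continuous_ext => w; congr (pairing _ _ _ _); ring.
have bp : integ 1 (fun z => q z * ((y < z)%R%:R * pairing u psi z (v + (z - y)))).
  by apply: eq_integ (bm 1) => z _; rewrite mul1r.
have bn : integ 1 (fun z => q z * ((y < z)%R%:R * pairing u psi z (v - (z - y)))).
  by apply: eq_integ (bm (-1)) => z _; rewrite mulN1r.
rewrite /Im /Ip -IIB// /volterra -IIZ; last first.
  exact: integMc iq (@cone_mean_section R (-1) X y v cX).
apply: eq_II => z _; rewrite mulrCA (cone_mean_derive _ _ cX (fun w => dX z w)).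
rewrite /reach mulN1r opprB.
have [yz|zy] := ltP y z.
  have -> : Num.max 0 (z - y) = z - y by apply/max_idPr; rewrite subr_ge0 ltW.
  by rewrite !mul1r mulrBr.
have -> : Num.max 0 (z - y) = 0 by apply/max_idPl; rewrite subr_le0.
by rewrite !mul0r mulr0 addr0 !subr0 subrr mulr0.
Qed.

Lemma cutoff : exists chi : R -> R, [/\ smooth1 chi, vanishes_off (-6) 6 chi &
  forall t, -5 < t < 5 -> chi t = 1].
Proof.
have [r [K [L [sr dK _ [_ _ K0 K1 _]]]]] := @smooth_ramp R.
have sK := smooth_antideriv dK sr.
exists (fun t => K (1 * t + 6) * K (-1 * t + 6)); split.
- by apply: smoothM; exact: smooth_affine.
- move=> t; rewrite negb_and -!ltNge => /orP[t1|t1].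
    by rewrite K0 ?mul0r//; lra.
  by rewrite [X in _ * X]K0 ?mulr0//; lra.
- by move=> t /andP[t1 t2]; rewrite !K1 ?mulr1//; lra.
Qed.

Lemma derive1_congr (a b : R) (f g : R -> R) : smooth1 f -> smooth1 g ->
  (forall x, a < x < b -> f x = g x) -> forall x, a < x < b -> derive1 f x = derive1 g x.
Proof.
move=> sf sg fg x xab.
have H : forall x, a < x < b -> (fun x => f x - g x) x = 0 by move=> y /fg ->; rewrite subrr.
have := derive1_eq0 H xab.
have df y := smooth_is_derive y sf; have dg y := smooth_is_derive y sg.
have -> : derive1 (fun x => f x - g x) = fun x => derive1 f x - derive1 g x.
  by apply: derive1_eq => y; exact: is_deriveB.
by move=> /subr0_eq.
Qed.

(** Division by k or k^2 compensates the derivatives in the source. The plateau ]-5, 5[ of the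
    cutoff contains the window 4 of the local operators. *)
Lemma boundary_source_exponential bc (k : R) : k != 0 -> exists psi lo hi,
  [/\ smooth1 psi, vanishes_off lo hi psi &
   forall t : R, -5 < t < 5 -> boundary_source bc psi t = expR (k * t)].
Proof.
move=> k0; have [chi [schi chi0 chi1]] := cutoff.
have dE (c t : R) : is_derive t 1 (fun t => c * expR (k * t)) (c * k * expR (k * t)).
  have d1 := @is_derive_affine R expR k 0 t _ (is_derive_expR _).
  apply: (is_derive_ext _ _ (is_deriveZ c d1)).
    by move=> y; rewrite /GRing.scale /= addr0.
  by rewrite /GRing.scale /= addr0 mulrA.
have sE c : smooth1 (fun t => c * expR (k * t)).
  apply: smoothZ; have := @smooth_affine R expR k 0 smooth_expR.
  by rewrite (_ : (fun x => _) = fun x => expR (k * x))//; apply/funext => t; rewrite addr0.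
pose psi c t := chi t * (c * expR (k * t)).
have sp c : smooth1 (psi c) by exact: smoothM.
have p0 c : vanishes_off (-6) 6 (psi c) by move=> t /chi0 e; rewrite /psi e mul0r.
have loc c t : -5 < t < 5 -> psi c t = c * expR (k * t) by rewrite /psi => /chi1 ->; rewrite mul1r.
have loc1 c t : -5 < t < 5 -> derive1 (psi c) t = c * k * expR (k * t).
  by move=> t5; rewrite (derive1_congr (sp c) (sE c) (loc c) t5) (derive1_eq (dE c)).
have loc2 c t : -5 < t < 5 -> derive1 (derive1 (psi c)) t = c * k * k * expR (k * t).
  move=> t5; rewrite (derive1_congr (smooth_derive1 (sp c)) (sE (c * k)) (loc1 c) t5).
  by rewrite (derive1_eq (dE _)).
exists (psi (if bc is Neumann then k^-1 else k^-1 * k^-1)), (-6), 6; split => // t t5.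
case: bc => /=; [rewrite loc2|rewrite loc1]; rewrite ?mulVf// ?mul1r//.
by rewrite divfK// mulVf// mul1r.
Qed.

Section TwoPotentials.
Variables (bc : boundary_type) (q1 q2 : R -> R) (u1 u2 : R -> (R -> R) -> R).
Variables (P1 P2 : (R -> R) -> R -> R -> R).
Hypotheses (pq1 : potential q1) (pq2 : potential q2).
Hypotheses (cs1 : causal_solution bc q1 u1) (cs2 : causal_solution bc q2 u2).
Hypothesis u12 : eq_distribution_on `]0, +oo[ (u1 1) (u2 1).
Hypothesis tP1 : transmutation q1 (-1) 1 (-1) 0 P1.
Hypothesis tP2 : transmutation q2 (-1) 1 (-1) 0 P2.

Let M1 := boundary_mean q1 P1 (parity bc).
Let M2 := boundary_mean q2 P2 (parity bc).

Let N1 : `|-1 : R| = 1. Proof. by rewrite normrN normr1. Qed.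

Let parity1 : `|parity bc : R| = 1.
Proof. by case: bc => /=; rewrite ?normrN normr1. Qed.

Let lM1 : local_operator M1.
Proof.
by apply: (boundary_mean_local (integ_potential 1 pq1) N1 _ tP1 parity1); rewrite N1.
Qed.

Let lM2 : local_operator M2.
Proof.
by apply: (boundary_mean_local (integ_potential 1 pq2) N1 _ tP2 parity1); rewrite N1.
Qed.

Let trace_eq psi lo hi : smooth1 psi -> vanishes_off lo hi psi ->
  pairing u1 psi 1 = pairing u2 psi 1.
Proof.
move=> sp p0; apply/funext => s; rewrite /pairing (max_idPl ler01).
have [du1 wq1 cu1 _] := cs1; have [du2 wq2 cu2 _] := cs2.
exact: (trace_at_one pq1 pq2 du1 du2 wq1 wq2 cu1 cu2 u12 (smooth_translate s sp)
  (@vanishes_off_shiftr R _ _ _ s p0)).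
Qed.

Let identity1 psi lo hi s : smooth1 psi -> vanishes_off lo hi psi ->
  boundary_source bc psi s = pairing u1 (derive1 (derive1 psi)) 1 (s - 1) -
    parity bc * M1 (pairing u1 (derive1 psi) 1) s.
Proof.
move=> sp p0; rewrite (boundary_identity s pq1 cs1 sp p0); congr (_ - _ * (_ / _)).
have [du wq cu _] := cs1; apply: eq_II => y /andP[y0 y1].
have y01 : 0 <= y <= 1 by rewrite !ltW.
by rewrite !(pairing_transmutation _ pq1 du wq cu tP1 sp p0 y01).
Qed.

(** As the traces coincide, the second problem can be expressed through the trace of [u1]; only the
    operator changes. *)
Let identity2 psi lo hi s : smooth1 psi -> vanishes_off lo hi psi ->
  boundary_source bc psi s = pairing u1 (derive1 (derive1 psi)) 1 (s - 1) -
    parity bc * M2 (pairing u1 (derive1 psi) 1) s.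
Proof.
move=> sp p0; have sp1 := smooth_derive1 sp; have p1 := vanishes_off_derive1 p0.
rewrite (trace_eq sp1 p1) (trace_eq (smooth_derive1 sp1) (vanishes_off_derive1 p1)).
rewrite (boundary_identity s pq2 cs2 sp p0); congr (_ - _ * (_ / _)).
have [du wq cu _] := cs2; apply: eq_II => y /andP[y0 y1].
have y01 : 0 <= y <= 1 by rewrite !ltW.
by rewrite !(pairing_transmutation _ pq2 du wq cu tP2 sp p0 y01).
Qed.

Let parity0 : parity bc != 0 :> R.
Proof. by rewrite -normr_gt0 parity1. Qed.

Let data_agree psi lo hi : smooth1 psi -> vanishes_off lo hi psi ->
  M1 (pairing u1 (derive1 psi) 1) = M2 (pairing u1 (derive1 psi) 1).
Proof.
move=> sp p0; apply/funext => s; apply: (mulfI parity0).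
by have := identity1 s sp p0; rewrite (identity2 s sp p0) => /addrI/oppr_inj.
Qed.

(** A source is a translated trace plus a multiple of M1 g, where g is a trace. On the first term
    the operators agree by translation invariance, and M1 (M1 g) = M1 (M2 g) = M2 (M1 g) by
    commutation. *)
Let source_agree psi lo hi s : smooth1 psi -> vanishes_off lo hi psi ->
  M1 (boundary_source bc psi) s = M2 (boundary_source bc psi) s.
Proof.
move=> sp p0; have sp1 := smooth_derive1 sp; have p1 := vanishes_off_derive1 p0.
have [du1 _ _ _] := cs1.
pose g := pairing u1 (derive1 psi) 1; pose g1 := pairing u1 (derive1 (derive1 psi)) 1.
have cg : continuous g by exact: jointly_section (pairing_continuous du1 sp1 p1).
have cg1 : continuous g1.
  exact: jointly_section (pairing_continuous du1 (smooth_derive1 sp1) (vanishes_off_derive1 p1)).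
have BE : boundary_source bc psi = fun v => (- parity bc) * M1 g v + g1 (v + -1).
  by apply/funext => v; rewrite (identity1 v sp p0) mulNr addrC.
have [cM1 linM1 shM1 _] := lM1; have [cM2 linM2 shM2 _] := lM2.
have cg1' : continuous (fun v : R => g1 (v + -1)).
  by apply: (cts_comp _ cg1); apply: ctsD; [exact: cts_id|exact: cts_cst].
rewrite BE linM1; [|exact: cM1|exact: cg1'].
rewrite linM2; [|exact: cM1|exact: cg1'].
rewrite shM1// shM2// (data_agree sp1 p1); congr (_ * _ + _).
rewrite [in LHS](data_agree sp p0) (local_operators_commute _ lM1 lM2 cg).
by rewrite (data_agree sp p0).
Qed.

Lemma boundary_mean_exponential (k : R) : k != 0 ->
  boundary_mean q1 P1 (parity bc) (fun t => expR (k * t)) 0 =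
  boundary_mean q2 P2 (parity bc) (fun t => expR (k * t)) 0.
Proof.
move=> k0; have [psi [lo [hi [sp p0 HB]]]] := boundary_source_exponential bc k0.
have cE := @continuous_exp_linear R k.
have cB : continuous (boundary_source bc psi).
  case: (bc) => /=; apply: smooth_continuous; do ?exact: smooth_derive1.
  by do 2 apply: smooth_derive1.
have local A : local_operator A -> A (fun t => expR (k * t)) 0 = A (boundary_source bc psi) 0.
  case=> _ lin _ [C C0 HC].
  have := lin 0 (-1) _ _ cB cE => /= E.
  have := HC (fun t => -1 * boundary_source bc psi t + expR (k * t)) 0 0 _ _.
  rewrite E mulr0 mulN1r => H; apply/eqP; rewrite -subr_eq0 -normr_le0 addrC; apply: H.
    by apply: ctsD => //; apply: ctsM => //; exact: cts_cst.
  move=> v; rewrite subr0 ler_norml => v4; rewrite HB ?mulN1r ?addNr ?normr0//.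
  by move/andP: v4 => [h1 h2]; apply/andP; split; lra.
by rewrite -/M1 -/M2 (local _ lM1) (local _ lM2) (source_agree _ sp p0).
Qed.

End TwoPotentials.

End BoundaryData.

(** * Orthogonality of products of solutions *)

Section Orthogonality.
Context {R : realType}.
Implicit Types (f g : R -> R) (P J E : (R -> R) -> R -> R -> R).

(* Both sides are linear in the kernel and agree on exponentials, where the kernel
   separates; density then replaces Fubini's theorem. *)
Lemma convolution_exchange (a b K : R -> R) : integ 1 a -> integ 1 b -> continuous K ->
  II 1 (fun x => a x * II 1 (fun y => b y * K (y - x))) =
  II 1 (fun y => b y * II 1 (fun x => a x * K (y - x))).
Proof.
move=> ia ib cK.
have c1 := @cts_fst R R R id (@cts_id R); have c2 := @cts_snd R R R id (@cts_id R).
have k1 (F : R -> R) x : continuous F -> continuous (fun y : R => F (y - x)).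
  by move=> cF; apply: (cts_comp _ cF); apply: ctsB; [exact: cts_id|exact: cts_cst].
have k2 (F : R -> R) x : continuous F -> continuous (fun y : R => F (x - y)).
  by move=> cF; apply: (cts_comp _ cF); apply: ctsB; [exact: cts_cst|exact: cts_id].
have cI (F : R -> R) : continuous F -> continuous (fun x => II 1 (fun y => b y * F (y - x))).
  move=> cF; apply: (II_continuous (F := fun x y => F (y - x)) ib).
  by apply: (cts_comp _ cF); exact: ctsB.
have cJ (F : R -> R) : continuous F -> continuous (fun y => II 1 (fun x => a x * F (y - x))).
  move=> cF; apply: (II_continuous (F := fun y x => F (y - x)) ia).
  by apply: (cts_comp _ cF); exact: ctsB.
apply/eqP; rewrite -subr_eq0; apply/eqP.
pose A := II 1 (fun x => `|a x|); pose B := II 1 (fun x => `|b x|).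
have A0 : 0 <= A by exact: II_ge0.
have B0 : 0 <= B by exact: II_ge0.
apply: (@exponentials_total R (fun K => II 1 (fun x => a x * II 1 (fun y => b y * K (y - x))) -
  II 1 (fun y => b y * II 1 (fun x => a x * K (y - x)))) (A * B + A * B) 1) cK.
- move=> c f g cf cg.
  have E1 x : II 1 (fun y => b y * (c * f (y - x) + g (y - x))) =
      c * II 1 (fun y => b y * f (y - x)) + II 1 (fun y => b y * g (y - x)).
    rewrite -IIZ; last exact: integMc ib (@k1 f x cf).
    rewrite -IID; [|by apply: integZ; exact: integMc ib (@k1 f x cf)|exact: integMc ib (@k1 g x cg)].
    by apply: eq_II => y _; ring.
  have E2 y : II 1 (fun x => a x * (c * f (y - x) + g (y - x))) =
      c * II 1 (fun x => a x * f (y - x)) + II 1 (fun x => a x * g (y - x)).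
    rewrite -IIZ; last exact: integMc ia (@k2 f y cf).
    rewrite -IID; [|by apply: integZ; exact: integMc ia (@k2 f y cf)|exact: integMc ia (@k2 g y cg)].
    by apply: eq_II => x _; ring.
  rewrite (eq_II (fun x _ => congr1 (fun r => a x * r) (E1 x))).
  rewrite (eq_II (fun y _ => congr1 (fun r => b y * r) (E2 y))).
  have split2 w f1 f2 : integ 1 w -> continuous f1 -> continuous f2 ->
      II 1 (fun x => w x * (c * f1 x + f2 x)) =
      c * II 1 (fun x => w x * f1 x) + II 1 (fun x => w x * f2 x).
    move=> iw cf1 cf2; rewrite -IIZ; last exact: integMc.
    rewrite -IID; [|by apply: integZ; exact: integMc|exact: integMc].
    by apply: eq_II => y _; ring.
  rewrite (split2 _ _ _ ia (cI f cf) (cI g cg)) (split2 _ _ _ ib (cJ f cf) (cJ g cg)).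
  by move: (II _ _) (II _ _) (II _ _) (II _ _) => r1 r2 r3 r4; ring.
- by rewrite addr_ge0// mulr_ge0.
- move=> f M cf HM.
  have near1 x y : 0 < x < 1 -> 0 < y < 1 -> `|f (y - x)| <= M.
    move=> /andP[x0 x1] /andP[y0 y1]; apply: HM; rewrite ler_norml.
    by apply/andP; split; lra.
  apply: (le_trans (ler_normB _ _)); rewrite mulrDl; apply: lerD.
    rewrite (_ : A * B * M = M * B * A); last by ring.
    apply: norm_IIM => //; first exact: bmeas_continuous (cI f cf).
    move=> x x01; apply: norm_IIM => //; first exact: bmeas_continuous (@k1 f x cf).
    by move=> y; exact: near1.
  rewrite (_ : A * B * M = M * A * B); last by ring.
  apply: norm_IIM => //; first exact: bmeas_continuous (cJ f cf).
  move=> y y01; apply: norm_IIM => //; first exact: bmeas_continuous (@k2 f y cf).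
  by move=> x x01; exact: near1.
- move=> n; set k := n.+1%:R.
  have cE := @continuous_exp_linear R k; have cE' := @continuous_exp_linear R (- k).
  have eB (x y : R) : expR (k * (y - x)) = expR (- k * x) * expR (k * y).
    by rewrite -expRD; congr expR; ring.
  apply/eqP; rewrite subr_eq0; apply/eqP.
  transitivity (II 1 (fun y => b y * expR (k * y)) * II 1 (fun x => a x * expR (- k * x))).
    rewrite -IIZ; last exact: integMc.
    apply: eq_II => x _; rewrite [RHS]mulrCA; congr (_ * _).
    rewrite mulrC -IIZ; last exact: integMc.
    by apply: eq_II => y _; rewrite eB; ring.
  rewrite mulrC -IIZ; last exact: integMc.
  apply: eq_II => y _; rewrite [LHS]mulrCA; congr (_ * _).
  rewrite mulrC -IIZ; last exact: integMc.
  by apply: eq_II => x _; rewrite eB; ring.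
Qed.

(** This is sinh(k r) / k, half the integral of e^(k v) over [-r, r]. *)
Definition shs (k r : R) : R := (expR (k * r) - expR (- k * r)) / (2 * k).

Lemma shs_continuous k : continuous (shs k).
Proof.
apply: ctsM; last exact: cts_cst.
by apply: ctsB; exact: continuous_exp_linear.
Qed.

Lemma shsN k r : shs (- k) r = shs k r.
Proof. by rewrite /shs opprK mulrN invrN mulrN -mulNr opprB. Qed.

Lemma shs_odd k r : shs k (Num.max 0 r) - shs k (Num.max 0 (- r)) = shs k r.
Proof.
have s0 : shs k 0 = 0 by rewrite /shs !mulr0 subrr mul0r.
have sN v : shs k (- v) = - shs k v by rewrite /shs mulrNN mulrN mulNr -[RHS]mulNr opprB.
have [r0|r0] := leP 0 r.
  have -> : Num.max 0 (- r) = 0 by apply/max_idPl; rewrite oppr_le0.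
  by rewrite s0 subr0.
have -> : Num.max 0 (- r) = - r by apply/max_idPr; rewrite oppr_ge0 ltW.
by rewrite s0 sN opprK add0r.
Qed.

Lemma transmutation_exponential (q : R -> R) (th c1 b c2 : R) P (k x t : R) :
  integ 1 q -> `|th| = 1 -> `|b| <= 1 -> transmutation q th c1 b c2 P -> 0 <= x <= 1 ->
  P (fun v => expR (k * v)) x t = P (fun v => expR (k * v)) x 0 * expR (k * t).
Proof.
move=> iq th1 b1 tP x01.
exact: (local_operator_exp k t (transmutation_local iq th1 b1 tP x01)).
Qed.

(** On exponentials the t-dependence separates and the cone mean becomes the scalar factor [shs].
    This is f'' = (k^2 + q) f in integrated form. *)
Lemma scalar_equation (q : R -> R) (th c1 b c2 : R) P (k x : R) : k != 0 ->
  integ 1 q -> `|th| = 1 -> `|b| <= 1 -> transmutation q th c1 b c2 P ->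
  P (fun v => expR (k * v)) x 0 =
  c1 * expR (k * (x + b)) + c2 * expR (- k * x) +
  II 1 (fun y => q y * (P (fun v => expR (k * v)) y 0 * shs k (reach th x y))).
Proof.
move=> k0 iq th1 b1 tP; have ck := @continuous_exp_linear R k; have [cP HP] := tP _ ck.
rewrite HP /free_wave add0r sub0r mulrN mulNr; congr (_ + _).
apply: eq_II => y /andP[y0 y1]; congr (_ * _).
have y01 : 0 <= y <= 1 by rewrite !ltW.
set r := reach th x y; set e := fun v => expR (k * v).
have dZ (v : R) : is_derive v 1 (fun v => P e y 0 / k * expR (k * v)) (P e y v).
  have d1 := @is_derive_affine R expR k 0 v _ (is_derive_expR _).
  apply: (is_derive_ext _ _ (is_deriveZ (P e y 0 / k) d1)).
    by move=> w; rewrite /GRing.scale /= addr0.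
  rewrite /GRing.scale /= addr0 mulrA divfK//.
  by rewrite [in RHS](transmutation_exponential k v iq th1 b1 tP y01).
have := @cone_mean_derive R (P e) (fun y v => P e y 0 / k * expR (k * v)) y 0 r cP dZ.
rewrite add0r sub0r => H; rewrite -[LHS](mulKf (_ : 2 != 0 :> R)) ?pnatr_eq0//.
by rewrite H /shs mulrN -mulNr; field.
Qed.

Section TwoTransmutations.
Variables (q : R -> R) (sg k : R) (J E : (R -> R) -> R -> R -> R).
Hypotheses (iq : integ 1 q) (k0 : k != 0).
Hypothesis tJ : transmutation q (-1) 1 (-1) 0 J.
Hypothesis tE : transmutation q 1 (1 / 2) 0 (sg / 2) E.

Let e (v : R) := expR (k * v).
Let phi x := E e x 0.

Let c_phi : continuous phi.
Proof.
have [cE _] := tE (@continuous_exp_linear R k).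
by apply: (continuous_comp2 cE); [exact: cts_id|exact: cts_cst].
Qed.

Let iqphi : integ 1 (fun x => q x * phi x). Proof. exact: integMc. Qed.

(* Symmetry of the two Volterra kernels turns the boundary value of the solution
   propagated from x = 1 into an integral of the one propagated from x = 0. *)
Lemma jost_pairing k' : k' = k \/ k' = - k ->
  II 1 (fun x => q x * phi x * expR (k' * (x - 1))) =
  II 1 (fun x => q x * J (fun v => expR (k' * v)) x 0 * ((e x + sg * e (- x)) / 2)).
Proof.
move=> kk'; have k'0 : k' != 0 by case: kk' => ->; rewrite ?oppr_eq0.
have N1 : `|-1 : R| = 1 by rewrite normrN normr1.
have N1' : `|-1 : R| <= 1 by rewrite N1.
have Z1 : `|0 : R| <= 1 by rewrite normr0.
set f := fun x => J (fun v => expR (k' * v)) x 0.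
have c_f : continuous f.
  have [cJ _] := tJ (@continuous_exp_linear R k').
  by apply: (continuous_comp2 cJ); [exact: cts_id|exact: cts_cst].
have iqf : integ 1 (fun x => q x * f x) by exact: integMc.
pose K r := shs k (Num.max 0 r).
have cK : continuous K by apply: (cts_comp _ (@shs_continuous k)); apply: cts_max; [exact: cts_cst|exact: cts_id].
have fE x : f x = expR (k' * (x - 1)) + II 1 (fun y => q y * f y * K (y - x)).
  have := scalar_equation x k'0 iq N1 N1' tJ; rewrite mul1r mul0r addr0 -/(f x) => ->.
  congr (_ + _); apply: eq_II => y _; rewrite -/(f y) mulrA; congr (_ * _).
  rewrite /K /reach mulN1r opprB.
  by case: kk' => ->; rewrite ?shsN.
have phiE x : phi x = (e x + sg * e (- x)) / 2 + II 1 (fun y => q y * phi y * K (x - y)).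
  have := scalar_equation x k0 iq (normr1 R) Z1 tE.
  rewrite -/e -/(phi x) addr0 => ->; congr (_ + _).
    by rewrite /e mulNr mulrN; ring.
  by apply: eq_II => y _; rewrite -/(phi y) mulrA /K /reach mul1r.
have cK1 : continuous (fun x => II 1 (fun y => q y * f y * K (y - x))).
  apply: (II_continuous (F := fun x y => K (y - x)) iqf); apply: (cts_comp _ cK).
  by apply: ctsB; [exact: (@cts_snd R R R id (@cts_id R))|exact: (@cts_fst R R R id (@cts_id R))].
have cK2 : continuous (fun x => II 1 (fun y => q y * phi y * K (x - y))).
  apply: (II_continuous (F := fun x y => K (x - y)) iqphi); apply: (cts_comp _ cK).
  by apply: ctsB; [exact: (@cts_fst R R R id (@cts_id R))|exact: (@cts_snd R R R id (@cts_id R))].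
have ce : continuous (fun x : R => expR (k' * (x - 1))).
  apply: (cts_comp _ (@continuous_expR R)); apply: ctsM; first exact: cts_cst.
  by apply: ctsB; [exact: cts_id|exact: cts_cst].
have c0 : continuous (fun x => (e x + sg * e (- x)) / 2).
  apply: ctsM; last exact: cts_cst; apply: ctsD; first exact: continuous_exp_linear.
  apply: ctsM; first exact: cts_cst.
  by apply: (continuous_ext _ (@continuous_exp_linear R (- k))) => x; rewrite /e mulNr mulrN.
have H1 : II 1 (fun x => q x * phi x * f x) = II 1 (fun x => q x * phi x * expR (k' * (x - 1))) +
    II 1 (fun x => q x * phi x * II 1 (fun y => q y * f y * K (y - x))).
  rewrite -IID; [|exact: integMc iqphi ce|exact: integMc iqphi cK1].
  by apply: eq_II => x _; rewrite -mulrDr -fE.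
have H2 : II 1 (fun x => q x * phi x * f x) = II 1 (fun x => q x * f x * ((e x + sg * e (- x)) / 2)) +
    II 1 (fun x => q x * f x * II 1 (fun y => q y * phi y * K (x - y))).
  rewrite -IID; [|exact: integMc iqf c0|exact: integMc iqf cK2].
  by apply: eq_II => x _; rewrite -mulrDr -phiE mulrAC.
(* [f] sees the kernel [K (y - x)] and [phi] its transpose [K (x - y)], so the two expansions of one
   integral share their double integral. *)
have := convolution_exchange iqphi iqf cK => H3.
exact: esym (addIr _ (etrans (esym H2) (etrans H1 (congr1 (fun r => _ + r) H3)))).
Qed.

End TwoTransmutations.

Section Orthogonal.
Variables (q1 q2 : R -> R) (sg k : R) (J1 J2 E1 E2 : (R -> R) -> R -> R -> R).
Hypotheses (iq1 : integ 1 q1) (iq2 : integ 1 q2) (k0 : k != 0) (sg2 : sg * sg = 1).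
Hypothesis tJ1 : transmutation q1 (-1) 1 (-1) 0 J1.
Hypothesis tJ2 : transmutation q2 (-1) 1 (-1) 0 J2.
Hypothesis tE1 : transmutation q1 1 (1 / 2) 0 (sg / 2) E1.
Hypothesis tE2 : transmutation q2 1 (1 / 2) 0 (sg / 2) E2.
Hypothesis data : forall l, l = k \/ l = - k ->
  boundary_mean q1 J1 sg (fun v => expR (l * v)) 0 =
  boundary_mean q2 J2 sg (fun v => expR (l * v)) 0.

Let e (v : R) := expR (k * v).

Let moment (q : R -> R) E l := II 1 (fun x : R => q x * E e x 0 * expR (l * x)).

Let boundary_meanE (q : R -> R) J l : integ 1 q -> transmutation q (-1) 1 (-1) 0 J ->
  boundary_mean q J sg (fun v => expR (l * v)) 0 =
  II 1 (fun x => q x * J (fun v => expR (l * v)) x 0 * ((expR (l * x) + sg * expR (l * - x)) / 2)).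
Proof.
move=> iq tJ; have N1 : `|-1 : R| = 1 by rewrite normrN normr1.
have N1' : `|-1 : R| <= 1 by rewrite N1.
have cl := @continuous_exp_linear R l; have [cJ _] := tJ _ cl.
rewrite /boundary_mean mulrC -IIZ; last first.
  exact: (integMc iq (@continuous_boundary_integrand _ _ _ _ _ _ _ tJ sg _ 0 cl)).
apply: eq_II => y /andP[y0 y1]; have y01 : 0 <= y <= 1 by rewrite !ltW.
rewrite add0r sub0r (transmutation_exponential l y iq N1 N1' tJ y01).
by rewrite (transmutation_exponential l (- y) iq N1 N1' tJ y01); ring.
Qed.

(** The factor e^l moves the base point of the exponential from 0 to 1. For l = - k the free
    solution built on k is [sg] times the one built on l, because [sg] squares to 1. *)
Let momentE (q : R -> R) J E l : integ 1 q -> transmutation q (-1) 1 (-1) 0 J ->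
  transmutation q 1 (1 / 2) 0 (sg / 2) E -> l = k \/ l = - k ->
  moment q E l = expR l * ((if l == k then 1 else sg) *
    boundary_mean q J sg (fun v => expR (l * v)) 0).
Proof.
move=> iq tJ tE lk; rewrite boundary_meanE//.
have [cE _] := tE _ (@continuous_exp_linear R k).
have cphi : continuous (fun x => E e x 0).
  by apply: (continuous_comp2 cE); [exact: cts_id|exact: cts_cst].
have cl := @continuous_exp_linear R l; have [cJ _] := tJ _ cl.
have cf : continuous (fun x => J (fun v => expR (l * v)) x 0).
  by apply: (continuous_comp2 cJ); [exact: cts_id|exact: cts_cst].
have c0 : continuous (fun x : R => (expR (l * x) + sg * expR (l * - x)) / 2).
  apply: ctsM; last exact: cts_cst; apply: ctsD => //.
  apply: ctsM; first exact: cts_cst.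
  by apply: (continuous_ext _ (@continuous_exp_linear R (- l))) => x; rewrite mulNr mulrN.
rewrite -IIZ; last exact: (integMc (integMc iq cf) c0).
have -> : II 1 (fun x => (if l == k then 1 else sg) * (q x * J (fun v => expR (l * v)) x 0 *
    ((expR (l * x) + sg * expR (l * - x)) / 2))) =
    II 1 (fun x => q x * J (fun v => expR (l * v)) x 0 * ((e x + sg * e (- x)) / 2)).
  apply: eq_II => x _; case: eqP => [->|lnk]; first by rewrite mul1r.
  have -> : l = - k by case: lk.
  rewrite /e mulrN mulNr opprK mulrN [in LHS]mulrCA; congr (_ * _).
  by rewrite mulrA mulrDr mulrA sg2 mul1r addrC.
rewrite -(jost_pairing iq k0 tJ tE lk) -IIZ; last first.
  apply: (integMc (integMc iq cphi)); apply: (cts_comp _ (@continuous_expR R)).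
  by apply: ctsM; [exact: cts_cst|apply: ctsB; [exact: cts_id|exact: cts_cst]].
apply: eq_II => x _; rewrite mulrCA; congr (_ * _).
by rewrite -expRD; congr expR; ring.
Qed.

Let moments_agree l : l = k \/ l = - k -> moment q1 E1 l = moment q2 E2 l.
Proof. by move=> lk; rewrite (momentE iq1 tJ1 tE1 lk) (momentE iq2 tJ2 tE2 lk) data. Qed.

(** Expanding E2 in the integral with q1 and E1 in the one with q2 leaves moments, which agree, and
    two double integrals with transposed kernels. *)
Lemma products_orthogonal :
  II 1 (fun x => (q1 x - q2 x) * (E1 (fun v => expR (k * v)) x 0 * E2 (fun v => expR (k * v)) x 0)) = 0.
Proof.
have Z1 : `|0 : R| <= 1 by rewrite normr0.
pose f1 x := E1 e x 0; pose f2 x := E2 e x 0.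
have ce := @continuous_exp_linear R k; have ce' := @continuous_exp_linear R (- k).
have [cE1 _] := tE1 ce; have [cE2 _] := tE2 ce.
have c1 : continuous f1 by apply: (continuous_comp2 cE1); [exact: cts_id|exact: cts_cst].
have c2 : continuous f2 by apply: (continuous_comp2 cE2); [exact: cts_id|exact: cts_cst].
pose a x := q1 x * f1 x; pose b x := q2 x * f2 x.
have ia : integ 1 a by exact: integMc.
have ib : integ 1 b by exact: integMc.
pose K r := shs k (Num.max 0 r).
have cK : continuous K by apply: (cts_comp _ (@shs_continuous k)); apply: cts_max; [exact: cts_cst|exact: cts_id].
pose h x := (e x + sg * expR (- k * x)) / 2.
have ch : continuous h.
  apply: ctsM; last exact: cts_cst; apply: ctsD => //.
  by apply: ctsM; [exact: cts_cst|].
have phiE q E x : integ 1 q -> transmutation q 1 (1 / 2) 0 (sg / 2) E ->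
    E e x 0 = h x + II 1 (fun y => q y * E e y 0 * K (x - y)).
  move=> iq tE; have := scalar_equation x k0 iq (normr1 R) Z1 tE.
  rewrite -/e addr0 => ->; congr (_ + _).
    by rewrite /h /e; ring.
  by apply: eq_II => y _; rewrite mulrA /K /reach mul1r.
have cI w : integ 1 w -> continuous (fun x => II 1 (fun y => w y * K (x - y))).
  move=> iw; apply: (II_continuous (F := fun x y => K (x - y)) iw); apply: (cts_comp _ cK).
  by apply: ctsB; [exact: (@cts_fst R R R id (@cts_id R))|exact: (@cts_snd R R R id (@cts_id R))].
have cI' w : integ 1 w -> continuous (fun x => II 1 (fun y => w y * K (y - x))).
  move=> iw; apply: (II_continuous (F := fun x y => K (y - x)) iw); apply: (cts_comp _ cK).
  by apply: ctsB; [exact: (@cts_snd R R R id (@cts_id R))|exact: (@cts_fst R R R id (@cts_id R))].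
have H1 : II 1 (fun x => a x * f2 x) = II 1 (fun x => a x * h x) +
    II 1 (fun x => a x * II 1 (fun y => b y * K (x - y))).
  rewrite -IID; [|exact: integMc|exact: integMc ia (cI _ ib)].
  by apply: eq_II => x _; rewrite -mulrDr /f2 (phiE q2 E2).
have H2 : II 1 (fun x => b x * f1 x) = II 1 (fun x => b x * h x) +
    II 1 (fun x => a x * II 1 (fun y => b y * K (y - x))).
  rewrite (convolution_exchange ia ib cK).
  rewrite -IID; [|exact: integMc|exact: integMc ib (cI _ ia)].
  by apply: eq_II => x _; rewrite -mulrDr /f1 (phiE q1 E1).
have M1 := moments_agree (or_introl (erefl k)).
have M2 := moments_agree (or_intror (erefl (- k))).
have Hh w : integ 1 w -> II 1 (fun x => w x * h x) =
    (II 1 (fun x => w x * expR (k * x)) + sg * II 1 (fun x => w x * expR (- k * x))) / 2.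
  move=> iw; have i1 := integMc iw ce; have i2 := integMc iw ce'.
  rewrite -IIZ// -IID//; last exact: integZ.
  rewrite mulrC -IIZ; last by apply: integD => //; exact: integZ.
  by apply: eq_II => x _; rewrite /h /e; ring.
(* The kernel difference is sinh(k (x - y)) / k, which has rank two. The result is a determinant of
   moments at k and -k, zero once the moments of a and b agree. *)
have D : II 1 (fun x => a x * II 1 (fun y => b y * K (x - y))) -
    II 1 (fun x => a x * II 1 (fun y => b y * K (y - x))) =
    (II 1 (fun x => a x * expR (k * x)) * II 1 (fun x => b x * expR (- k * x)) -
     II 1 (fun x => a x * expR (- k * x)) * II 1 (fun x => b x * expR (k * x))) / (2 * k).
  set B1 := II 1 (fun x => b x * expR (- k * x)); set B2 := II 1 (fun x => b x * expR (k * x)).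
  rewrite -IIB; [|exact: integMc ia (cI _ ib)|exact: integMc ia (cI' _ ib)].
  transitivity (II 1 (fun x => a x * (expR (k * x) * (B1 / (2 * k)) - expR (- k * x) * (B2 / (2 * k))))).
    apply: eq_II => x _; rewrite -mulrBr; congr (_ * _).
    have j1 : integ 1 (fun y => b y * K (x - y)).
      by apply: integMc => //; apply: (cts_comp _ cK); apply: ctsB; [exact: cts_cst|exact: cts_id].
    have j2 : integ 1 (fun y => b y * K (y - x)).
      by apply: integMc => //; apply: (cts_comp _ cK); apply: ctsB; [exact: cts_id|exact: cts_cst].
    rewrite -IIB//.
    have i1 : integ 1 (fun y => b y * expR (- k * y)) by exact: integMc.
    have i2 : integ 1 (fun y => b y * expR (k * y)) by exact: integMc.
    have -> : expR (k * x) * (B1 / (2 * k)) - expR (- k * x) * (B2 / (2 * k)) =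
       expR (k * x) / (2 * k) * B1 - expR (- k * x) / (2 * k) * B2 by ring.
    rewrite /B1 /B2 -!IIZ// -IIB; [|exact: integZ|exact: integZ].
    apply: eq_II => y _; rewrite -mulrBr.
    have := shs_odd k (x - y); rewrite opprB -/(K (x - y)) -/(K (y - x)) => ->.
    rewrite /shs (_ : expR (k * (x - y)) = expR (k * x) * expR (- k * y)); last first.
      by rewrite -expRD; congr expR; ring.
    rewrite (_ : expR (- k * (x - y)) = expR (- k * x) * expR (k * y)); last first.
      by rewrite -expRD; congr expR; ring.
    by ring.
  have i1 : integ 1 (fun y => a y * expR (- k * y)) by exact: integMc.
  have i2 : integ 1 (fun y => a y * expR (k * y)) by exact: integMc.
  transitivity (B1 / (2 * k) * II 1 (fun x => a x * expR (k * x)) - B2 / (2 * k) * II 1 (fun x => a x * expR (- k * x))); last by ring.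
  rewrite -!IIZ// -IIB; [|exact: integZ|exact: integZ].
  by apply: eq_II => x _; ring.
have -> : II 1 (fun x => (q1 x - q2 x) * (E1 (fun v => expR (k * v)) x 0 * E2 (fun v => expR (k * v)) x 0)) =
    II 1 (fun x => a x * f2 x) - II 1 (fun x => b x * f1 x).
  rewrite -IIB; [|exact: integMc|exact: integMc].
  by apply: eq_II => x _; rewrite /a /b /f1 /f2 /e; ring.
rewrite H1 H2 !Hh//; move: M1 M2 D; rewrite /moment -/(a _) -/(b _).
rewrite -[II 1 (fun x => q1 x * E1 e x 0 * expR (k * x))]/(II 1 (fun x => a x * expR (k * x))).
rewrite -[II 1 (fun x => q2 x * E2 e x 0 * expR (k * x))]/(II 1 (fun x => b x * expR (k * x))).
rewrite -[II 1 (fun x => q1 x * E1 e x 0 * expR (- k * x))]/(II 1 (fun x => a x * expR (- k * x))).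
rewrite -[II 1 (fun x => q2 x * E2 e x 0 * expR (- k * x))]/(II 1 (fun x => b x * expR (- k * x))).
move=> -> -> D; rewrite opprD addrACA D subrr add0r [X in X / _](_ : _ = 0) ?mul0r//; ring.
Qed.

End Orthogonal.

End Orthogonality.

(** * Completeness of products of solutions *)

Section SupportPropagation.
Context {R : realType}.
Implicit Types (X : R -> R -> R) (eta : R -> R) (P E : (R -> R) -> R -> R -> R).

(* The support condition confines the mean to a set of length l / (2 * r), whose
   indicator is dominated by an exponential. *)
Lemma cone_mean_barrier X (y t r l B : R) : jointly X -> 0 <= r -> 0 <= B -> 0 < l ->
  (forall v, 0 < v < 1 -> `|X y (t - r + 2 * r * v)| <= B) ->
  (forall v, 0 < v < 1 -> l < 2 * r * (1 - v) -> X y (t - r + 2 * r * v) = 0) ->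
  `|cone_mean X y t r| <= expR 1 * B * l.
Proof.
move=> cX r0 B0 l0 HB H0.
have C0 : 0 <= expR 1 * B * l by rewrite !mulr_ge0 ?expR_ge0// ltW.
move: r0; rewrite le_eqVlt => /predU1P[r0|r0]; first by rewrite /cone_mean -r0 mul0r normr0.
pose k := 2 * r / l; have k0 : 0 < k by rewrite divr_gt0// mulr_gt0.
(* The integrand can be nonzero only where k (1 - v) <= 1, and there [g] is at least B. *)
pose g v := B * expR (1 - k) * expR (k * v).
have cg : continuous g by apply: ctsM; [exact: cts_cst|exact: continuous_exp_linear].
have cX' := @cone_mean_argument_continuous _ X y t r cX.
have H1 : `|II 1 (fun v => X y (t - r + 2 * r * v))| <= II 1 g.
  apply: norm_II; [exact: integ_continuous|exact: integ_continuous|].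
  move=> v v01; have [lv|vl] := ltP l (2 * r * (1 - v)).
    by rewrite H0// normr0 !mulr_ge0 ?expR_ge0.
  apply: (le_trans (HB v v01)); rewrite /g -mulrA ler_peMr// -expRD -[leLHS]expR0 ler_expR.
  have -> : 1 - k + k * v = 1 - 2 * r * (1 - v) / l by rewrite /k; ring.
  by rewrite subr_ge0 ler_pdivrMr// mul1r.
have dG (v : R) : is_derive v 1 (fun v => B * expR (1 - k) / k * expR (k * v)) (g v).
  have d1 := @is_derive_affine R expR k 0 v _ (is_derive_expR _).
  apply: (is_derive_ext _ _ (is_deriveZ (B * expR (1 - k) / k) d1)).
    by move=> w; rewrite /GRing.scale /= addr0.
  by rewrite /GRing.scale /= addr0 mulrA divfK// gt_eqF.
have H2 : II 1 g <= B * expR 1 / k.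
  rewrite (II_FTC ltr01 cg dG) mulr1 mulr0 expR0 mulr1.
  have -> : B * expR (1 - k) / k * expR k = B * expR 1 / k.
    by have -> : expR 1 = expR (1 - k) * expR k by [rewrite -expRD subrK]; ring.
  by rewrite gerBl; apply: divr_ge0; [apply: mulr_ge0 => //; exact: expR_ge0|exact: ltW].
rewrite /cone_mean normrM gtr0_norm//.
apply: (le_trans (ler_wpM2l (ltW r0) (le_trans H1 H2))).
have -> : r * (B * expR 1 / k) = expR 1 * B * l / 2.
  by rewrite /k; field; rewrite !gt_eqF.
by rewrite ler_pdivrMr// mulr_natr mulr2n lerDl.
Qed.

Section Barrier.
Variables (q : R -> R) (c1 c2 : R) (E : (R -> R) -> R -> R -> R).
Hypotheses (iq : integ 1 q) (tE : transmutation q 1 c1 0 c2 E).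

Let th1 : `|1 : R| = 1. Proof. exact: normr1. Qed.
Let b1 : `|0 : R| <= 1. Proof. by rewrite normr0. Qed.

(** On the cone with apex (x, t) both arguments of the free wave stay below t + x, so the equation
    there is homogeneous. *)
Lemma transmutation_support eta c x t : continuous eta -> 0 <= x <= 1 ->
  (forall v, v < c -> eta v = 0) -> t + x < c -> E eta x t = 0.
Proof.
move=> ce x01 e0 tc; have [cE HE] := tE ce.
apply: (volterra_unique iq th1 (@cone_past_closed _ 1 x t) (cone_bounded t th1 x01) cE _
  (cone_apex 1 t x01)) => y v [/andP[y0 _] vt].
rewrite HE /free_wave; move: vt; rewrite mul1r => /ler_normlW vt.
by rewrite !e0 ?mulr0 ?add0r//; lra.
Qed.

(** At each level y of the cone [E eta] is supported within distance t + x - c of the right end of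
    the mean, so the Volterra correction is at most proportional to that length. *)
Lemma transmutation_barrier : exists2 C, 0 <= C & forall eta M c, continuous eta ->
  (forall v, `|eta v| <= M) -> (forall v, v < c -> eta v = 0) ->
  forall x t, 0 <= x <= 1 -> `|E eta x t| <= C * M /\
    `|E eta x t - free_wave c1 0 c2 eta x t| <= C * M * Num.max 0 (t + x - c).
Proof.
have [C C0 HC] := transmutation_bound iq th1 b1 tE.
pose Q := II 1 (fun y => `|q y|); have Q0 : 0 <= Q by exact: II_ge0.
have K0 : 0 <= expR 1 * C * Q :> R by rewrite !mulr_ge0 ?expR_ge0.
exists (C + expR 1 * C * Q); first by rewrite addr_ge0.
move=> eta M c ce HM e0 x t x01; have [cE HE] := tE ce.
have M0 : 0 <= M := le_trans (normr_ge0 _) (HM 0).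
have B y v : 0 <= y <= 1 -> `|E eta y v| <= C * M by move=> y01; apply: HC.
have CM0 : 0 <= C * M by rewrite mulr_ge0.
split; first by apply: (le_trans (B x t x01)); rewrite mulrDl lerDl mulr_ge0.
rewrite HE addrAC subrr add0r.
apply: (@le_trans _ _ (expR 1 * (C * M) * Num.max 0 (t + x - c) * Q)); last first.
  rewrite mulrDl [leRHS]mulrDl.
  rewrite (_ : expR 1 * C * Q * M * _ = expR 1 * (C * M) * Num.max 0 (t + x - c) * Q); last by ring.
  by rewrite lerDr mulr_ge0// le_max lexx.
apply: norm_IIM => //; first exact: bmeas_continuous (@cone_mean_section _ 1 _ x t cE).
move=> y /andP[y0 y1]; have y01 : 0 <= y <= 1 by rewrite !ltW.
rewrite /reach mul1r; have [xy|yx] := leP (x - y) 0.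
  by rewrite /cone_mean mul0r normr0 !mulr_ge0 ?expR_ge0// le_max lexx.
have [l0|l0] := ltP 0 (t + x - c).
  apply: cone_mean_barrier => //; first exact: ltW.
    by move=> v _; exact: B.
  move=> v _ lv; apply: (transmutation_support ce y01 e0).
  by move: lv; rewrite mulrBr; lra.
rewrite mulr0 /cone_mean (eq_II (g := fun=> 0)).
  by rewrite II_cst// mul0r mulr0 normr0.
move=> v /andP[v0 v1]; apply: (transmutation_support ce y01 e0).
have : (x - y) * v < x - y by rewrite gtr_pMr.
by move: l0; rewrite -mulrA; lra.
Qed.

End Barrier.

End SupportPropagation.

Section Completeness.
Context {R : realType}.
Variables (q1 q2 : R -> R) (sg : R) (E1 E2 : (R -> R) -> R -> R -> R).
Hypotheses (iq1 : integ 1 q1) (iq2 : integ 1 q2).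
Hypothesis tE1 : transmutation q1 1 (1 / 2) 0 (sg / 2) E1.
Hypothesis tE2 : transmutation q2 1 (1 / 2) 0 (sg / 2) E2.
Hypothesis orth : forall n, II 1 (fun x => (q1 x - q2 x) *
  (E1 (fun v => expR (n.+1%:R * v)) x 0 * E2 (fun v => expR (n.+1%:R * v)) x 0)) = 0.

Let p x := q1 x - q2 x.

Let ip : integ 1 p. Proof. exact: integB. Qed.

Let th1 : `|1 : R| = 1. Proof. exact: normr1. Qed.
Let b1 : `|0 : R| <= 1. Proof. by rewrite normr0. Qed.

(* This turns the exponential e^(k t) into the product of the two scalar solutions. *)
Let W (eta : R -> R) x := E1 (E2 eta x) x 0.

(** The transmutation bounds are uniform for x in [0, 1]; clamping yields functions continuous on
    the whole line. *)
Let clamp (x : R) := Num.max 0 (Num.min 1 x).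

Let clamp01 x : 0 <= clamp x <= 1.
Proof. by rewrite /clamp le_max lexx ge_max ler01 ge_min lexx. Qed.

Let clampE x : 0 < x < 1 -> clamp x = x.
Proof. by move=> /andP[x0 x1]; rewrite /clamp (min_idPr (ltW x1)) (max_idPr (ltW x0)). Qed.

Let section2 eta x : continuous eta -> continuous (E2 eta x).
Proof. by move=> /tE2[cE _]; exact: jointly_section. Qed.

Let continuousW eta : continuous eta -> continuous (fun x => W eta (clamp x)).
Proof.
move=> ce; have [cE2 _] := tE2 ce.
have [C C0 HC] := transmutation_bound iq1 th1 b1 tE1.
have cc : continuous clamp.
  by apply: cts_max; [exact: cts_cst|apply: cts_min; [exact: cts_cst|exact: cts_id]].
have cX : jointly (fun x v => E2 eta (clamp x) v).
  apply: (continuous_comp2 cE2); last exact: (@cts_snd _ _ _ id (@cts_id R)).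
  by apply: (cts_comp _ cc); exact: (@cts_fst _ _ _ id (@cts_id R)).
move=> x0; have [cE1 _] := tE1 (@section2 eta (clamp x0) ce).
have cY : continuous (fun x => E1 (E2 eta (clamp x0)) (clamp x) 0).
  by apply: (continuous_comp2 cE1 cc); exact: cts_cst.
apply/cvgrPdist_le => e e0; have C1 : 0 < C + 1 by rewrite ltr_pwDr.
have [d1 d10 Hd1] := @jointly_uniform _ _ x0 3 _ cX (divr_gt0 (divr_gt0 e0 (ltr0Sn R 1)) C1).
have [d2 d20 Hd2] := @continuous_eps _ _ x0 _ cY (divr_gt0 e0 (ltr0Sn R 1)).
exists (Num.min d1 d2) => /=; first by rewrite lt_min d10.
move=> x; rewrite /ball_ /= distrC lt_min => /andP[xd1 xd2].
rewrite distrC; have s1 := @section2 eta (clamp x) ce; have s0 := @section2 eta (clamp x0) ce.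
have -> : W eta (clamp x) - W eta (clamp x0) =
    E1 (fun v => (-1) * E2 eta (clamp x0) v + E2 eta (clamp x) v) (clamp x) 0 +
    (E1 (E2 eta (clamp x0)) (clamp x) 0 - E1 (E2 eta (clamp x0)) (clamp x0) 0).
  by rewrite (transmutation_lincomb iq1 th1 tE1 _ _ _ s0 s1) /W; ring.
apply: (le_trans (ler_normD _ _)); rewrite [leRHS](splitr e); apply: lerD; last exact: Hd2.
apply: (@le_trans _ _ (C * (e / 2 / (C + 1)))).
  apply: HC; first by apply: ctsD => //; apply: ctsM => //; exact: cts_cst.
    exact: clamp01.
  by move=> v; rewrite subr0 mulN1r addrC => v3; exact: Hd1.
by rewrite mulrCA ler_piMr ?divr_ge0 ?(ltW e0)// ler_pdivrMr// mul1r lerDl.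
Qed.

Let integW eta : continuous eta -> integ 1 (fun x => p x * W eta x).
Proof.
move=> ce; apply: (eq_integ _ (integMc ip (continuousW ce))) => x x01 /=.
by rewrite clampE.
Qed.

(** On e^(k t) the two transmutations at t = 0 give the product of the scalar solutions, so
    orthogonality is the vanishing on exponentials. The window 6 is 3 + 3. *)
Let products_complete eta : continuous eta -> II 1 (fun x => p x * W eta x) = 0.
Proof.
have [C1 C10 HC1] := transmutation_bound iq1 th1 b1 tE1.
have [C2 C20 HC2] := transmutation_bound iq2 th1 b1 tE2.
pose Q := II 1 (fun y => `|p y|); have Q0 : 0 <= Q by exact: II_ge0.
apply: (@exponentials_total R (fun eta => II 1 (fun x => p x * W eta x)) (C1 * C2 * Q) 6).
- move=> c f g cf cg.
  rewrite -IIZ; last exact: integW.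
  rewrite -IID; [|by apply: integZ; exact: integW|exact: integW].
  apply: eq_II => x _; rewrite /W.
  have -> : E2 (fun t => c * f t + g t) x = fun v => c * E2 f x v + E2 g x v.
    by apply/funext => v; rewrite (transmutation_lincomb iq2 th1 tE2 _ _ _ cf cg).
  rewrite (transmutation_lincomb iq1 th1 tE1 _ _ _ (section2 cf) (section2 cg)); ring.
- by rewrite !mulr_ge0.
- move=> f M cf HM.
  rewrite (eq_II (g := fun x => p x * W f (clamp x))); last by move=> x x01; rewrite clampE.
  rewrite (_ : C1 * C2 * Q * M = C1 * (C2 * M) * Q); last by ring.
  apply: norm_IIM => //; first exact: bmeas_continuous (continuousW cf).
  move=> x _; apply: HC1; [exact: section2|exact: clamp01|].
  move=> v; rewrite subr0 => v3; apply: HC2 => //.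
  move=> w wv; apply: HM; have -> : w = (w - v) + v by rewrite subrK.
  by apply: (le_trans (ler_normD _ _)); lra.
- move=> n; rewrite -[RHS](orth n); apply: eq_II => x /andP[x0 x1].
  have x01 : 0 <= x <= 1 by rewrite !ltW.
  rewrite -/(p x) /W; congr (_ * _); set e := fun v => expR _.
  have ce : continuous e by exact: continuous_exp_linear.
  have -> : E2 e x = fun v => E2 e x 0 * e v + 0.
    apply/funext => v; rewrite addr0.
    exact: (transmutation_exponential n.+1%:R v iq2 th1 b1 tE2 x01).
  rewrite (transmutation_lincomb iq1 th1 tE1 _ _ _ ce (@cts_cst R R 0)).
  have [_ linE _ _] := transmutation_local iq1 th1 b1 tE1 x01.
  have L0 : E1 (fun=> 0) x 0 = 0 := linear_functional0 (linE 0).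
  by rewrite L0 !addr0 /e mulr0 expR0 mulr1 mulrC.
Qed.

Lemma localized_estimate : exists2 C, 0 <= C & forall (s : R) (chi : R -> R), 0 < s -> continuous chi ->
  (forall x, `|chi x| <= 1) -> (forall x, x < s -> chi x = 0) ->
  `|II 1 (fun x => p x * chi x)| <= C * II 1 (fun x => `|p x| * Num.max 0 (x - s)).
Proof.
have [C1 C10 HC1] := transmutation_barrier iq1 tE1.
have [C2 C20 HC2] := transmutation_barrier iq2 tE2.
pose K := 2 * (C1 * C2) + C2; have K0 : 0 <= K by rewrite addr_ge0// !mulr_ge0.
exists (4 * K); first by rewrite mulr_ge0.
(* Halving the argument makes the leading term eta(2 x) / 4 equal to chi(x) / 4. *)
move=> s chi s0 cchi chi1 chi0; pose eta (v : R) := chi (v / 2).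
have ce : continuous eta.
  by apply: (cts_comp _ cchi); apply: ctsM; [exact: cts_id|exact: cts_cst].
have eta1 v : `|eta v| <= 1 by exact: chi1.
have eta0 v : v < 2 * s -> eta v = 0.
  by move=> vs; apply: chi0; rewrite ltr_pdivrMr// mulrC.
have err x : 0 < x < 1 -> `|chi x - 4 * W eta x| <= 4 * K * Num.max 0 (x - s).
  move=> /andP[x0 x1]; have x01 : 0 <= x <= 1 by rewrite !ltW.
  have z1 v : `|E2 eta x v| <= C2.
    by have [+ _] := HC2 eta 1 (2 * s) ce eta1 eta0 x v x01; rewrite mulr1.
  have z0 v : v < 2 * s - x -> E2 eta x v = 0.
    move=> vs; apply: (transmutation_support iq2 tE2 ce x01 eta0).
    by rewrite -ltrBrDr.
  have [_ a1] := HC1 (E2 eta x) C2 (2 * s - x) (section2 ce) z1 z0 x 0 x01.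
  have [_ a2] := HC2 eta 1 (2 * s) ce eta1 eta0 x x x01.
  move: a1 a2; rewrite /free_wave -/(W eta x) !add0r !addr0 subrr.
  (* The reflected waves drop out by support, as - x < 2 s - x and 0 < 2 s; this is where s > 0
     enters. *)
  rewrite (z0 (- x)) ?mulr0 ?addr0; last by lra.
  rewrite (eta0 0) ?mulr0 ?addr0; last by lra.
  have -> : eta (x + x) = chi x by congr chi; field.
  have mE : Num.max 0 (2 * (x - s)) = 2 * Num.max 0 (x - s).
    by rewrite -[in LHS](mulr0 2) maxr_pMr.
  rewrite (_ : x - (2 * s - x) = 2 * (x - s)); last by ring.
  rewrite (_ : x + x - 2 * s = 2 * (x - s)); last by ring.
  rewrite mE mulr1; set m := Num.max _ _ => a1 a2.
  have -> : chi x - 4 * W eta x =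
     - (4 * (W eta x - 1 / 2 * E2 eta x x)) - 2 * (E2 eta x x - 1 / 2 * chi x) by field.
  apply: (le_trans (ler_normB _ _)); rewrite normrN !normrM !(ger0_norm (ler0n _ _)).
  rewrite /K; move: a1 a2; move: `|_ - _| `|_ - _| => r1 r2 a1 a2.
  have -> : 4 * (2 * (C1 * C2) + C2) * m = 4 * (C1 * C2 * (2 * m)) + 2 * (C2 * (2 * m)) by ring.
  by lra.
have icW := integW ce; have ic := integMc ip cchi.
have -> : II 1 (fun x => p x * chi x) = II 1 (fun x => p x * (chi x - 4 * W eta x)).
  rewrite -[LHS]subr0 -[X in _ - X](mulr0 4) -(products_complete ce) -IIZ//.
  rewrite -IIB//; last exact: integZ.
  by apply: eq_II => x _; ring.
have cm : continuous (fun x => Num.max 0 (x - s)).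
  by apply: cts_max; [exact: cts_cst|apply: ctsB; [exact: cts_id|exact: cts_cst]].
have im : integ 1 (fun x => `|p x| * Num.max 0 (x - s)) by exact: integMc (integ_norm ip) cm.
rewrite -IIZ//; apply: norm_II; last 1 first.
- by move=> x /err; rewrite normrM mulrCA => h; apply: ler_wpM2l.
- apply: (eq_integ (f := fun x => p x * chi x - 4 * (p x * W eta x))).
    by move=> x _; ring.
  by apply: integB => //; exact: integZ.
- exact: integZ.
Qed.

End Completeness.

(** * Descent from x = 1 *)

Section Descent.
Context {R : realType}.
Notation mu := (@lebesgue_measure R).
Variables (p : R -> R) (C : R).
Hypotheses (ip : integ 1 p) (C0 : 0 <= C).

Let tail (s : R) := II 1 (fun x => `|p x| * (s < x)%R%:R).
Let moment (s : R) := II 1 (fun x => `|p x| * Num.max 0 (x - s)).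

Hypothesis localized : forall (s : R) (chi : R -> R), 0 < s -> continuous chi ->
  (forall x, `|chi x| <= 1) -> (forall x, x < s -> chi x = 0) ->
  `|II 1 (fun x => p x * chi x)| <= C * moment s.

Let ipn : integ 1 (fun x => `|p x|). Proof. exact: integ_norm. Qed.

Lemma approximation_in_mean (e : R) : 0 < e -> exists2 w : R -> R, continuous w &
  II 1 (fun x => `|p x - w x|) < e.
Proof.
move=> e0; have m1 : (mu [set` `]0%R, 1%R[] < +oo)%E.
  by rewrite lebesgue_measure_itv /=; case: ifP => _; rewrite ltry.
have [g [cg ig gp]] := approximation_continuous_integrable (measurable_itv `]0%R, 1%R[) m1 ip.
have /fine_cvgP[_ /cvgrPdist_lt /(_ e e0)[n _ /(_ n (leqnn n))]] := gp.
rewrite /= sub0r normrN => Hn; exists (g n) => //.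
by apply: le_lt_trans Hn; exact: ler_norm.
Qed.

(** A continuous substitute for the sign of p on ]s, 1[ is tested: a ramp starting at s times a
    regularised sign of a continuous approximation w of p in mean. *)
Let tail_moment s : 0 < s -> tail s <= C * moment s.
Proof.
(* The budget is 2 e for exchanging p and w, e for the regularised sign and e for the interval of
   the ramp. *)
move=> s0; apply/ler_addgt0Pr => e' e'0; pose e := e' / 4.
have e0 : 0 < e by rewrite divr_gt0.
have [w cw Hw] := approximation_in_mean e0.
have [d d0 Hd] := II_small ip e0.
have Hd2 := Hd s (d / 2); rewrite divr_ge0 ?(ltW d0)//= in Hd2.
have {Hd2}Hs : II 1 (fun x => `|p x| * ((s < x)%R%:R * (x <= s + d / 2)%R%:R)) < e.
  by apply: Hd2; rewrite ltr_pdivrMr// ltr_pMr// ltr1n.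
pose rho x := Num.min 1 (Num.max 0 ((x - s) / (d / 2))).
have h0 : 0 < d / 2 by rewrite divr_gt0.
have crho : continuous rho.
  apply: cts_min; first exact: cts_cst.
  apply: cts_max; first exact: cts_cst.
  apply: ctsM; last exact: cts_cst.
  by apply: ctsB; [exact: cts_id|exact: cts_cst].
have rho0 x : 0 <= rho x by rewrite le_min ler01 le_max lexx.
have rho1 x : rho x <= 1 by rewrite ge_min lexx.
have rhoE x : x <= s -> rho x = 0.
  move=> xs; rewrite /rho (_ : Num.max 0 _ = 0); first by apply/min_idPr; exact: ler01.
  by apply/max_idPl; rewrite pmulr_lle0 ?invr_gt0// subr_le0.
have rhoT x : s + d / 2 <= x -> rho x = 1.
  move=> xs; apply/min_idPl; rewrite le_max ler_pdivlMr// mul1r; apply/orP; right.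
  by lra.
have we0 x : 0 < `|w x| + e by rewrite ltr_wpDl.
pose k x := w x / (`|w x| + e).
have ck : continuous k.
  apply: ctsM => //; move=> x; apply: cvgV; first by rewrite gt_eqF.
  by apply: cvgD; [exact: cts_norm|exact: cvg_cst].
have k1 x : `|k x| <= 1.
  by rewrite /k normrM normfV (gtr0_norm (we0 x)) ler_pdivrMr// mul1r lerDl ltW.
have kw x : 0 <= w x * k x.
  by rewrite /k mulrA mulr_ge0 ?invr_ge0 ?(ltW (we0 x))// -expr2 sqr_ge0.
have kw' x : `|w x| - e <= w x * k x.
  rewrite /k mulrA ler_pdivlMr// -expr2 -[w x ^+ 2]real_normK ?num_real//.
  rewrite (_ : (`|w x| - e) * (`|w x| + e) = `|w x| ^+ 2 - e ^+ 2); last by ring.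
  by rewrite gerBl sqr_ge0.
pose chi x := rho x * k x.
have cchi : continuous chi by exact: ctsM.
have chi1 x : `|chi x| <= 1 by rewrite /chi normrM (ger0_norm (rho0 x)) mulr_ile1.
have chi0 x : x < s -> chi x = 0 by move=> /ltW/rhoE; rewrite /chi => ->; rewrite mul0r.
have Hchi := localized s0 cchi chi1 chi0.
have i1 : integ 1 (fun x => p x * chi x) by exact: integMc.
have i2 : integ 1 (fun x => `|p x - w x|).
  by apply: integ_norm; apply: integB => //; exact: integ_continuous.
have i3 : integ 1 (fun x => `|p x| * ((s < x)%R%:R * (x <= s + d / 2)%R%:R)).
  by apply: integM => //; apply: bmeasM; [exact: bmeas_ltr|exact: bmeas_ler].
have i4 : integ 1 (fun=> e) by exact: integ_continuous (@cts_cst R R e).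
have i22 := integZ 2 i2.
have i12 := integD i1 i22; have i124 := integD i12 i4; have i1243 := integD i124 i3.
have T : tail s <= II 1 (fun x => p x * chi x + 2 * `|p x - w x| + e +
    `|p x| * ((s < x)%R%:R * (x <= s + d / 2)%R%:R)).
  apply: le_II => //; first by apply: integM => //; exact: bmeas_ltr.
  move=> x _; have pw : p x * chi x = w x * chi x + (p x - w x) * chi x by ring.
  have b1 : - `|p x - w x| <= (p x - w x) * chi x.
    have : `|(p x - w x) * chi x| <= `|p x - w x| by rewrite normrM ler_piMr.
    by rewrite ler_norml => /andP[].
  have wchi : w x * chi x = rho x * (w x * k x) by rewrite /chi; ring.
  have wchi0 : 0 <= w x * chi x by rewrite wchi mulr_ge0.
  have tri : `|p x| <= `|w x| + `|p x - w x|.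
    by rewrite -{1}(subrK (w x) (p x)) addrC (le_trans (ler_normD _ _)).
  have n0 := normr_ge0 (p x - w x).
  have [sx|xs] := ltP s x; last first.
    by rewrite mul0r !mulr0 addr0 pw; lra.
  have [xd|dx] := leP x (s + d / 2).
    by rewrite !mulr1 pw; lra.
  rewrite !mulr1 !mulr0 addr0 pw wchi rhoT ?(ltW dx)// mul1r.
  by have := kw' x; lra.
apply: (le_trans T); rewrite IID// IID// IID// IIZ// II_cst ?ler01// mulr1.
have Hc : II 1 (fun x => p x * chi x) <= C * moment s := le_trans (ler_norm _) Hchi.
rewrite (_ : e' = e + 2 * e + e); last by rewrite /e; field.
by move: Hc Hw Hs; move: (II _ _) (II _ _) (II _ _) => r1 r2 r3; lra.
Qed.

Let tail_ge0 s : 0 <= tail s.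
Proof. by apply: II_ge0 => x _; rewrite mulr_ge0. Qed.

(** For x < 1 the weight max 0 (x - s) is at most h up to s + h and at most 1 beyond. *)
Let tail_descent s h : 0 < s -> 0 < h -> tail s <= C * (h * tail s + tail (s + h)).
Proof.
move=> s0 h0; apply: (le_trans (tail_moment s0)); apply: ler_wpM2l => //.
have it a : integ 1 (fun x => `|p x| * (a < x)%R%:R).
  by apply: integM => //; exact: bmeas_ltr.
rewrite -IIZ// -IID//; last exact: integZ.
apply: le_II.
- apply: integMc => //; apply: cts_max; first exact: cts_cst.
  by apply: ctsB; [exact: cts_id|exact: cts_cst].
- by apply: integD => //; exact: integZ.
move=> x /andP[x0 x1]; rewrite mulrCA -mulrDr; apply: ler_wpM2l => //.
rewrite ge_max addr_ge0 ?mulr_ge0 ?(ltW h0)//=.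
have [sx|xs] := ltP s x; have [hx|xh] := ltP (s + h) x; rewrite /= ?mulr1n ?mulr0n; lra.
Qed.

Lemma vanishing_of_localized : II 1 (fun x => `|p x|) = 0.
Proof.
(* With C h <= 1/2, [tail (s + h) = 0] gives tail s <= tail s / 2, hence [tail s = 0]. As h depends
   on C only, finitely many steps lead from 1 to any s > 0. *)
pose h := (2 * C + 2)^-1; have C1 : 0 < 2 * C + 2 by rewrite ltr_wpDl// mulr_ge0.
have h0 : 0 < h by rewrite invr_gt0.
have Ch : C * h <= 1 / 2 by rewrite /h ler_pdivrMr//; lra.
have vanish n : forall s, 0 < s -> 1 <= s + n%:R * h -> tail s = 0.
  elim: n => [|n IH] s s0 sn.
    rewrite /tail (eq_II (g := fun=> 0)) ?II_cst ?mul0r// => x /andP[_ x1].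
    by rewrite ltNge (le_trans (ltW x1)) ?mulr0//; rewrite mul0r addr0 in sn.
  have T0 : tail (s + h) = 0.
    apply: IH; first by rewrite addr_gt0.
    by move: sn; rewrite -natr1 mulrDl mul1r; lra.
  have := tail_descent s0 h0; rewrite T0 addr0 mulrA => H.
  apply/le_anti; rewrite tail_ge0 andbT.
  have := ler_wpM2r (tail_ge0 s) Ch; move: H; move: (tail s) => r; lra.
(* The descent reaches every positive s but not 0; absolute continuity makes the remaining piece of
   the integral small. *)
apply/le_anti; rewrite II_ge0// andbT; apply/ler_addgt0Pr => e e0; rewrite add0r.
have [d d0 Hd] := II_small ip e0.
have d2 : 0 < d / 2 by rewrite divr_gt0.
have Hd2 := Hd 0 (d / 2); rewrite (ltW d2) add0r ltr_pdivrMr// ltr_pMr// ltr1n /= in Hd2.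
have T0 : tail (d / 2) = 0.
  have n0 : 0 <= h^-1 by rewrite invr_ge0 ltW.
  apply: (vanish (Num.bound h^-1)) => //.
  have := archi_boundP n0; rewrite -(ltr_pM2r h0) mulVf ?gt_eqF// => H.
  by apply: (le_trans (ltW H)); rewrite lerDr ltW.
apply: ltW; apply: le_lt_trans (Hd2 isT).
apply: (@le_trans _ _ (II 1 (fun x => `|p x| * ((0 < x)%R%:R * (x <= d / 2)%R%:R)) + tail (d / 2)));
  last by rewrite T0 addr0.
rewrite -IID; last first.
- by apply: integM => //; exact: bmeas_ltr.
- by apply: integM => //; apply: bmeasM; [exact: bmeas_ltr|exact: bmeas_ler].
apply: le_II => //.
  apply: integD; first by apply: integM => //; apply: bmeasM; [exact: bmeas_ltr|exact: bmeas_ler].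
  by apply: integM => //; exact: bmeas_ltr.
move=> x /andP[x0 _]; rewrite -mulrDr x0 mul1r.
by case: leP => _; rewrite ?addr0 ?add0r mulr1.
Qed.

End Descent.

(** * Equality almost everywhere *)

Section Uniqueness.
Context {R : realType}.

Lemma II_norm_eq0 (p : R -> R) : integ 1 p -> II 1 (fun x => `|p x|) = 0 ->
  {ae @lebesgue_measure R, forall x, 0 < x < 1 -> p x = 0}.
Proof.
move=> ip H; have /integrableP[mp fp] := ip.
have I0 : (\int[lebesgue_measure]_(x in [set` `]0%R, 1%R[]) `|(EFin \o p) x| = 0)%E.
  have fin : (\int[lebesgue_measure]_(x in [set` `]0%R, 1%R[]) `|(EFin \o p) x|)%E \is a fin_num.
    by rewrite ge0_fin_numE// integral_ge0.
  by rewrite -(fineK fin); congr (_%:E); exact: H.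
have := (ae_eq_integral_abs lebesgue_measure (measurable_itv `]0%R, 1%R[) mp).1 I0.
by apply: filterS => x /= Hx x01; have := Hx; rewrite in_itv /= => /(_ x01)[].
Qed.

(** Neither the interval ]0, 1[ nor the condition x > 1 controls the point x = 1, which is discarded
    as a null set. *)
Lemma ae_neq (c : R) : {ae @lebesgue_measure R, forall x, x <> c}.
Proof.
exists [set c]; split; [exact: measurable_set1|exact: lebesgue_measure_set1|].
by move=> x /= /contrapT.
Qed.

End Uniqueness.

Theorem theorem10p3p1 (R : realType) (bc : boundary_type) (q1 q2 : R -> R)
    (u1 u2 : R -> (R -> R) -> R) (a : (R -> R) -> R)
    (hq1 : potential q1) (hq2 : potential q2)
    (hu1 : causal_solution bc q1 u1) (hu2 : causal_solution bc q2 u2)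
    (ha1 : eq_distribution_on `]0, +oo[ (u1 1) a)
    (ha2 : eq_distribution_on `]0, +oo[ (u2 1) a) :
  {ae (@lebesgue_measure R), forall x : R, 0 < x -> q1 x = q2 x}.
Proof.
have iq1 := integ_potential 1 hq1; have iq2 := integ_potential 1 hq2.
have N1 : `|-1 : R| = 1 by rewrite normrN normr1.
have P1 := normr1 R.
have sg2 : (parity bc : R) * parity bc = 1 by case: bc {hu1 hu2} => /=; rewrite ?mulrNN mulr1.
have u12 : eq_distribution_on `]0, +oo[ (u1 1) (u2 1) by move=> f tf; rewrite ha1// ha2.
have [J1 tJ1] := transmutation_exists 1 (-1) 0 iq1 N1.
have [J2 tJ2] := transmutation_exists 1 (-1) 0 iq2 N1.
have [E1 tE1] := transmutation_exists (1 / 2) 0 (parity bc / 2) iq1 P1.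
have [E2 tE2] := transmutation_exists (1 / 2) 0 (parity bc / 2) iq2 P1.
have data := boundary_mean_exponential hq1 hq2 hu1 hu2 u12 tJ1 tJ2.
have orth n : II 1 (fun x => (q1 x - q2 x) *
    (E1 (fun v => expR (n.+1%:R * v)) x 0 * E2 (fun v => expR (n.+1%:R * v)) x 0)) = 0.
  have n0 : n.+1%:R != 0 :> R by rewrite pnatr_eq0.
  (* Data at both k and -k enter, because the solutions normalised at x = 0 mix the two
     exponentials. *)
  apply: (products_orthogonal iq1 iq2 n0 sg2 tJ1 tJ2 tE1 tE2) => l ln; apply: data.
  by case: ln => ->; rewrite ?oppr_eq0.
have [C C0 HC] := localized_estimate iq1 iq2 tE1 tE2 orth.
have ip : integ 1 (fun x => q1 x - q2 x) by exact: integB.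
have A := II_norm_eq0 ip (vanishing_of_localized ip C0 HC).
have Hae := ae_filter_ringOfSetsType (@lebesgue_measure R).
have := ae_neq (1 : R); move: A; apply: filterS2 => x /= A x1 x0.
have [xlt1|xgt1|//] := ltgtP x 1; first by apply/eqP; rewrite -subr_eq0 A ?x0.
by rewrite hq1.2// hq2.2.
Qed.
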